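(* Let $\mathcal U=\mathbb R^d$, let $\mathcal Y$ be a separable Hilbert space, and let $c(z,v;y,u)=\|u-v\|_2^2$. Suppose that $\gamma\in\mathbb P(\mathcal Y)$ and that $F:\mathcal U\times\mathcal Y\to\mathcal Y$ is continuous. Suppose further that: (a) the prior $\mu\in\mathbb P(\mathbb R^d)$ is supported on a compact and convex set $A\subset\mathbb R^d$ and is absolutely continuous with respect to Lebesgue measure with a density that is bounded from above and below on $A$; (b) the potential $\Phi$ is positive, bounded, and bi-Lipschitz. Then there are constants $C_1,C_2\ge0$, depending on $d$, $A$, $\Phi$ and the choice of $\mu$, such that for $\nu_{\mathcal Y}$-a.e. $y,y'$ and for $N\le d$, $$\|T^N_{\mathcal U}(y,\cdot)-T^\star_{\mathcal U}(y,\cdot)\|_{L^2(\mu)}\le C_1\|\mathrm{Id}-P^N_{\mathcal U}\|_{L^2(\mu)}^{1/6},$$ $$\|T^\star_{\mathcal U}(y,\cdot)-T^\star_{\mathcal U}(y',\cdot)\|_{L^2(\mu)}\le C_2\|y-y'\|_{\mathcal Y}^{1/6}.$$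
   Context: $\mathbb P(\mathcal X)$ denotes the Borel probability measures on $\mathcal X$. The Bayesian inverse problem is $y=F(u,\xi)$, with prior $u\sim\mu$ and independent noise $\xi\sim\gamma$. Let $\nu\in\mathbb P(\mathcal Y\times\mathcal U)$ be the law of $(F(u,\xi),u)$, $\nu_{\mathcal Y}$ its $\mathcal Y$-marginal and $\nu(\cdot\mid y)$ its conditionals (the posteriors). It is assumed that the posterior is given by Bayes' rule with a negative log-likelihood (potential) $\Phi(u;y)$, where $\exp(-\Phi(u;y))$ is proportional to $\frac{\mathrm d\nu(\cdot\mid u)}{\mathrm d\gamma}(y)$, i.e. $$\frac{\mathrm d\nu(\cdot\mid y)}{\mathrm d\mu}(u)=\frac1{Z(y)}\exp(-\Phi(u;y)),\quad Z(y)=\int_{\mathcal U}\exp(-\Phi(u;y))\,\mathrm d\mu(u).$$ ''Bi-Lipschitz'' means that $\Phi$ is Lipschitz in each of its two arguments, uniformly in the other one. Discretization: $\mathcal U^N\subset\mathcal U$ is an $N$-dimensional linear subspace, $P^N_{\mathcal U}:\mathcal U\to\mathcal U^N$ a projection map, $\mu^N=P^N_{\mathcal U}\#\mu$, and $\nu^N$ is the law of $(F(u,\xi),u)$ with independent $u\sim\mu^N$, $\xi\sim\gamma$; its posteriors are $$\frac{\mathrm d\nu^N(\cdot\mid y)}{\mathrm d\mu^N}(u)=\frac1{Z^N(y)}\exp(-\Phi(u;y)),\quad Z^N(y)=\int_{\mathcal U}\exp(-\Phi(u;y))\,\mathrm d\mu^N(u).$$ $T^\star(z,v)=(z,T^\star_{\mathcal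 U}(z,v))$ is the solution of $$\inf_T\int_{\mathcal Y\times\mathcal U}\|v-T_{\mathcal U}(z,v)\|_2^2\,\mathrm d\eta(z,v)\quad\text{s.t.}\quad T\#\eta=\nu,\ T(z,v)=(z,T_{\mathcal U}(z,v)),$$ with $\eta=\nu_{\mathcal Y}\otimes\mu$, so that $T^\star_{\mathcal U}(y,\cdot)\#\mu=\nu(\cdot\mid y)$. Likewise $T^N(z,v)=(z,T^N_{\mathcal U}(z,v))$ is the solution of the same problem with $\nu$ replaced by $\nu^N$ and $\eta$ replaced by $\nu^N_{\mathcal Y}\otimes\mu$, so that $T^N_{\mathcal U}(y,\cdot)\#\mu=\nu^N(\cdot\mid y)$. Finally $\|G\|_{L^2(\mu)}=\left(\int\|G(u)\|_2^2\,\mathrm d\mu(u)\right)^{1/2}$ for a map $G:\mathbb R^d\to\mathbb R^d$.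
   Formalization: The projection map P^N onto the N-dimensional subspace U^N is taken to be the orthogonal projection; for arbitrary oblique projections no constant C_1 depending only on d, A, Φ and μ can exist. *)

(* Defs.v *)
From HB Require Import structures.
From mathcomp Require Import all_boot all_order all_algebra.
From mathcomp Require Import all_classical all_reals all_analysis.
Set Implicit Arguments.
Unset Strict Implicit.
Unset Printing Implicit Defensive.
Import Order.TTheory GRing.Theory Num.Theory.
Import numFieldNormedType.Exports.

Local Open Scope classical_set_scope.
Local Open Scope ring_scope.
Local Open Scope ereal_scope.

(* [T] with its Borel sigma-algebra.  On a product of two separable metrizable
   spaces the product sigma-algebra used below is the Borel one. *)
Notation borel T := (g_sigma_algebraType (@open T)).

Section Euclidean.
Context (R : realType) (d : nat).
Implicit Types u v : 'rV[R]_d.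

Definition edot u v : R := (\sum_(i < d) u 0 i * v 0 i)%R.

(* MathComp's norm on ['rV[R]_d] is the maximum norm. *)
Definition enorm u : R := Num.sqrt (edot u u).

Definition orthogonal_projection (W : {vspace 'rV[R]_d})
    (P : 'rV[R]_d -> 'rV[R]_d) : Prop :=
  forall u, P u \in W /\ (forall w, w \in W -> edot (u - P u)%R w = 0%R).

Definition L2norm (mu : set (borel 'rV[R]_d) -> \bar R)
    (G : 'rV[R]_d -> 'rV[R]_d) : \bar R :=
  (\int[mu]_u (enorm (G u) ^+ 2)%:E) `^ 2^-1.

End Euclidean.

(* [R^(n+1)] is [R * R^n], the first coordinate being the entry of index 0. *)
Fixpoint lebesgue_rV (R : realType) (n : nat) :
    set (borel 'rV[R]_n) -> \bar R :=
  match n with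
  | 0%N => \d_(0%R : borel 'rV[R]_0)
  | m.+1 => pushforward (lebesgue_measure \x lebesgue_rV (n := m))
      (fun p : measurableTypeR R * borel 'rV[R]_m =>
         row_mx (p.1)%:M p.2 : borel 'rV[R]_m.+1)
  end.

Lemma lebesgue_rV_set0 (R : realType) (n : nat) :
  lebesgue_rV (set0 : set (borel 'rV[R]_n)) = 0.
Proof.
elim: n => [|n IH] /=; first by rewrite dirac0.
rewrite /pushforward /product_measure1 preimage_set0.
by apply: integral0_eq => x _ /=; rewrite xsection0.
Qed.

Lemma lebesgue_rV_box (R : realType) (n : nat) (a b : 'I_n -> R) :
  (forall i, a i <= b i)%R ->
  lebesgue_rV [set v : borel 'rV[R]_n | forall i, (a i <= v 0 i <= b i)%R] =
  (\prod_(i < n) (b i - a i))%:E.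
Proof.
elim: n a b => [|n IH] a b ab /=.
  by rewrite big_ord0 diracE mem_set// => -[].
rewrite /pushforward /product_measure1 big_ord_recl.
have rowE (x : R) (v : 'rV[R]_n) :
    (forall i, (a i <= (row_mx x%:M v : 'rV_n.+1) 0 i <= b i)%R) <->
    (a ord0 <= x <= b ord0)%R /\
    (forall i, (a (lift ord0 i) <= v ord0 i <= b (lift ord0 i))%R).
  have E0 : (row_mx x%:M v : 'rV_n.+1) ord0 ord0 = x.
    have -> : (ord0 : 'I_n.+1) = lshift n (ord0 : 'I_1) by exact/val_inj.
    by apply: (etrans (row_mxEl _ _ _ _)); rewrite mxE.
  have ES i : (row_mx x%:M v : 'rV_n.+1) ord0 (lift ord0 i) = v ord0 i.
    have -> : lift (ord0 : 'I_n.+1) i = rshift 1 i by exact/val_inj.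
    exact: row_mxEr.
  split=> [H|[H0 HS] i].
    split=> [|i]; first by have := H ord0; rewrite E0.
    by have := H (lift ord0 i); rewrite ES.
  have [j|] := unliftP ord0 i => ->; rewrite ?ES ?E0//; exact: HS.
transitivity (\int[lebesgue_measure]_x ((\1_(`[a ord0, b ord0]) x)%:E *
    (\prod_(i < n) (b (lift ord0 i) - a (lift ord0 i)))%:E)).
  apply: eq_integral => x _ /=; rewrite indicE.
  have [xab|xab] := boolP (x \in `[a ord0, b ord0]%classic).
    rewrite mul1e -(IH (a \o lift ord0) (b \o lift ord0)) => [|i]; last exact: ab.
    move: xab; rewrite inE/= in_itv/= => xab.
    congr lebesgue_rV; apply/seteqP; split => v /=.
      by move=> /xsectionP/rowE[].
    by move=> H; apply/xsectionP/rowE.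
  rewrite mul0e (_ : xsection _ _ = set0) ?lebesgue_rV_set0//.
  apply/seteqP; split => // v /xsectionP/rowE[xab' _].
  by move/negP: xab; apply; rewrite inE/= in_itv/=.
have p0 : (0 <= \prod_(i < n) (b (lift ord0 i) - a (lift ord0 i)))%R.
  by apply: prodr_ge0 => i _; rewrite subr_ge0; exact: ab.
rewrite ge0_integralZr//=.
- rewrite integral_indic//= setIT lebesgue_measure_itv/= lte_fin.
  have [_|ba] := ltP (a ord0) (b ord0); first by rewrite -EFinB -EFinM.
  have /eqP-> : b ord0 == a ord0 by rewrite eq_le ba ab.
  by rewrite subrr mul0e mul0r.
- exact/measurable_realfun.measurable_EFinP/measurable_realfun.measurable_indic.
Qed.

Section BayesianInverseProblem.
Context (R : realType) (d : nat) (Y : completeNormedModType R).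
Local Notation U := ('rV[R]_d).
Implicit Types (mu : set (borel U) -> \bar R) (gamma : set (borel Y) -> \bar R).
Implicit Types (eta nu : set (borel Y * borel U) -> \bar R).
Implicit Types (F : U * Y -> Y) (Phi : U -> Y -> R) (T : Y -> U -> U).

(* The law of [(F (u, xi), u)] for independent [u ~ mu] and [xi ~ gamma]. *)
Definition joint_law mu gamma F : set (borel Y * borel U) -> \bar R :=
  pushforward (mu \x gamma)
    (fun p : borel U * borel Y => (F p, p.1) : borel Y * borel U).

Definition marginalY nu : set (borel Y) -> \bar R := pushforward nu fst.

(* [F (u, xi)] given [u] has density [c y * exp (- Phi u y)] with respect to
   [gamma]: as a function of [u], [exp (- Phi u y)] is proportional to the
   likelihood, the factor being allowed to depend on [y]. *)
Definition negative_log_likelihood gamma F Phi : Prop :=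
  exists c : borel Y -> R,
    [/\ measurable_fun setT c, (forall y, 0 <= c y)%R &
      forall u (B : set (borel Y)), measurable B ->
        pushforward gamma (fun xi : borel Y => F (u, xi) : borel Y) B =
        \int[gamma]_(y in B) (c y * expR (- Phi u y))%:E].

Definition evidence mu Phi (y : Y) : \bar R :=
  \int[mu]_u (expR (- Phi u y))%:E.

Definition gibbs_posterior mu Phi (y : Y) (B : set (borel U)) : \bar R :=
  ((fine (evidence mu Phi y))^-1)%:E * \int[mu]_(u in B) (expR (- Phi u y))%:E.

(* [kappa] is a version of the conditionals [nu (. | y)]. *)
Definition is_conditional nu (kappa : Y -> set (borel U) -> \bar R) : Prop :=
  forall (C : set (borel Y)) (B : set (borel U)), measurable C -> measurable B ->
    nu (C `*` B) = \int[marginalY nu]_(y in C) kappa y B.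

Definition bayes_rule mu gamma F Phi : Prop :=
  is_conditional (joint_law mu gamma F) (gibbs_posterior mu Phi).

Definition triangular_map T (p : borel Y * borel U) : borel Y * borel U :=
  (p.1, T p.1 p.2).

Definition transport_constraint eta nu T : Prop :=
  measurable_fun setT (triangular_map T) /\
  forall B, measurable B -> pushforward eta (triangular_map T) B = nu B.

Definition transport_cost eta T : \bar R :=
  \int[eta]_p (enorm ((p.2 : U) - T p.1 p.2)%R ^+ 2)%:E.

Definition conditional_OT_map eta nu T : Prop :=
  transport_constraint eta nu T /\
  forall S, transport_constraint eta nu S ->
    transport_cost eta T <= transport_cost eta S.

End BayesianInverseProblem.

(* Main.v *)
(* The potentials of optimal maps are convex and [r]-Lipschitz, so the integral
   of the second difference [phi (x + t e_i) + phi (x - t e_i) - 2 phi x]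
   against a measure with bounded density is [O (t^2)].  Testing the duality
   inequality at [x + t e_i] and [x - t e_i] bounds [t |v - S x|] by the duality
   gap of [v] at [x] plus these second differences.  Taking for [v] the value of
   another optimal map and integrating, the gaps are controlled by the
   1-Wasserstein distance [e] of the targets, so [t |S - S'|_1 <= C (e + t^2)]
   for [0 < t <= 1]; the choice [t = e^(1/3)] gives [|S - S'|_1 <= C e^(1/3)],
   hence the exponent 1/6 in the [L^2] norm of the bounded difference.

   Optimal maps come from semi-discrete transport.  By the estimate above, those
   onto discretised posteriors converge in [L^1], uniformly in [y], and over a
   dense sequence of data the limit is jointly measurable in [(y, x)].  The same
   estimate, integrated over [y], shows that every optimal triangular map agrees
   with this limit for almost all data. *)
Require Import Defs.
From HB Require Import structures.
From mathcomp Require Import all_boot all_order all_algebra.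
From mathcomp Require Import all_classical all_reals all_analysis.
From mathcomp Require Import finmap measurable_realfun.
From mathcomp Require Import lra ring.
Set Implicit Arguments.
Unset Strict Implicit.
Unset Printing Implicit Defensive.
Import Order.TTheory GRing.Theory Num.Theory.
Import numFieldNormedType.Exports.

Local Open Scope classical_set_scope.
Local Open Scope ring_scope.

(** * Borel sets of products and of row vectors *)

(** Every target is presented as the image, under a map [X], of a density times [mu]. The posterior
    for the prior [P # mu] is the image under [P] of [posterior_density mu A Phi P y] times [mu], so
    changing the subspace and changing the datum are two cases of one perturbation, and [data_dist]
    replaces the Wasserstein distance. Rounding [X] to a grid makes the target finitely supported:
    dual minimisers then exist by compactness in finite dimension, and the second-difference bound,
    needed for stability anyway, also removes the ties, so that the optimal plan is a map. Limits
    are taken of maps only; whenever a potential is needed, the argument returns to the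
    approximants. Two facts shape the measurability part. The given maps minimise among jointly
    measurable triangular maps, so a competitor must be measurable in both variables. They are
    determined only up to null sets of their own data laws, so these null sets must be shown to be
    the same for different priors. *)

Section BorelMeasurability.
Context {R : realType}.

(** Over a countable dense [D] this union is countable, which reduces Borel measurability in a
    separable space to balls. A radius below [e / 2] keeps a ball about a nearby centre inside
    [O]. *)
Lemma open_bigcup_ball (T : pseudoMetricType R) (D O : set T) :
  dense D -> open O ->
  O = \bigcup_(p in [set p : T * nat | D p.1 /\
        ball p.1 p.2.+1%:R^-1 `<=` O]) ball p.1 (p.2.+1%:R^-1 : R).
Proof.
move=> dD oO; apply/seteqP; split=> [x Ox|x [p [_ pO] px]]; last exact: pO.
have /nbhs_ballP[e /= e0 eO] : nbhs x O by exact: open_nbhs_nbhs.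
have [n] := ltr_add_invr (divr_gt0 e0 (ltr0Sn R 1)); rewrite add0r => ne.
have [c [/interior_subset xc Dc]] : (ball x (n.+1%:R^-1 : R))^° `&` D !=set0.
  apply: dD; last exact: open_interior.
  by exists x; apply: nbhsx_ballx; rewrite invr_gt0.
exists (c, n) => /=; last exact: ball_sym.
split=> // z cz; apply: eO; rewrite (splitr e).
apply: (@ball_triangle _ _ c); first exact: (le_ball (ltW ne)).
exact: (le_ball (ltW ne)).
Qed.

Lemma countable_bigcup_measurable d (T : measurableType d) (I : Type)
    (F : I -> set T) (P : set I) :
  countable P -> (forall i, P i -> measurable (F i)) ->
  measurable (\bigcup_(i in P) F i).
Proof.
move=> /countable_injP[f finj] mF.
have -> : \bigcup_(i in P) F i =
    \bigcup_n \bigcup_(i in [set i | P i /\ f i = n]) F i.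
  apply/seteqP; split=> [x [i Pi Fi]|x [n _ [i [Pi _] Fi]]]; last by exists i.
  by exists (f i) => //; exists i.
apply: bigcupT_measurable => n.
have [->|/set0P[i [Pi fin]]] := eqVneq [set i | P i /\ f i = n] set0.
  by rewrite bigcup_set0.
rewrite (_ : \bigcup_(i in _) _ = F i); first exact: mF.
apply/seteqP; split=> [x [j [Pj fjn] Fj]|x Fx]; last by exists i.
by rewrite (_ : i = j)//; apply: finj; rewrite ?mem_set// fin fjn.
Qed.

Lemma measurable_fun_borel d (T : measurableType d) (V : normedModType R)
    (D : set V) (f : T -> V) :
  dense D -> countable D ->
  (forall c (n : nat), D c -> measurable (f @^-1` ball c (n.+1%:R^-1 : R))) ->
  measurable_fun setT (f : T -> borel V).
Proof.
move=> dD cD mf; apply: (@measurability _ _ _ (borel V) _ _ (@open V)) => //.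
move=> _ [B oO <-]; rewrite setTI (open_bigcup_ball dD oO) preimage_bigcup.
apply: countable_bigcup_measurable => [|p [Dp _]]; last exact: mf.
apply: (@sub_countable _ _ _ (D `*` setT)); last exact: countableX.
by apply: subset_card_le => p [].
Qed.

(** A ball of the product is a product of balls, so an open set is a countable union of measurable
    rectangles. This makes the continuous forward map [F] jointly measurable. *)
Lemma measurable_prod_open (V W : normedModType R) (D1 : set V) (D2 : set W)
    (O : set (V * W)) :
  dense D1 -> countable D1 -> dense D2 -> countable D2 -> open O ->
  measurable (O : set (borel V * borel W)).
Proof.
move=> dD1 cD1 dD2 cD2 oO.
have dD : dense (D1 `*` D2).
  move=> A [[x1 x2] Ax] oA.
  have /nbhs_ballP[e /= e0 eA] : nbhs (x1, x2) A by exact: open_nbhs_nbhs.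
  have ne (X : pseudoMetricType R) (x : X) : (ball x e)^° !=set0.
    by exists x; exact: nbhsx_ballx.
  have [c1 [/interior_subset x1c1 D1c1]] := dD1 _ (ne _ x1) (open_interior _).
  have [c2 [/interior_subset x2c2 D2c2]] := dD2 _ (ne _ x2) (open_interior _).
  by exists (c1, c2); split=> //; apply: eA.
rewrite (open_bigcup_ball dD oO); apply: countable_bigcup_measurable.
  apply: (@sub_countable _ _ _ ((D1 `*` D2) `*` setT)).
    by apply: subset_card_le => p [].
  by apply: countableX => //; exact: countableX.
move=> [[c1 c2] n] /= _.
have -> : ball (c1, c2) (n.+1%:R^-1 : R) = ball c1 n.+1%:R^-1 `*` ball c2 n.+1%:R^-1.
  by [].
apply: (@measurableX _ _ (borel V) (borel W)); apply: sub_sigma_algebra; apply: ball_open;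
  by rewrite invr_gt0.
Qed.

Lemma continuous_borelR (V : ptopologicalType) (f : V -> R) :
  continuous f -> measurable_fun setT (f : borel V -> R).
Proof.
move=> /continuousP cf; apply: (@measurability _ _ _ _ _ _ (@RGenOInfty.G R)).
  exact: RGenOInfty.measurableE.
move=> _ [_ [x ->] <-]; rewrite setTI; apply: sub_sigma_algebra.
by apply: cf; exact: interval_open.
Qed.

Lemma coord_measurable n (i : 'I_n) :
  measurable_fun setT (fun u : borel 'rV[R]_n => (u : 'rV[R]_n) 0 i).
Proof. by apply: continuous_borelR => u; exact: coord_continuous. Qed.

Definition ratrow n : set 'rV[R]_n := range (fun u : 'rV[rat]_n => map_mx ratr u).
Arguments ratrow : clear implicits.

Lemma countable_ratrow n : countable (ratrow n).
Proof. exact: (card_le_trans (card_image_le _ _) (countableP _)). Qed.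

Lemma dense_ratrow n : dense (ratrow n).
Proof.
move=> A [x Ax] oA.
have /nbhs_ballP[e /= e0 eA] : nbhs x A by exact: open_nbhs_nbhs.
have H i : exists q : rat, ball (x 0 i) e (ratr q : R).
  have [|q] := @rat_in_itvoo R (x 0 i - e) (x 0 i + e); first by lra.
  rewrite in_itv/= => xq; exists q.
  by rewrite /ball/= ltr_distl; move: xq => /andP[? ?]; apply/andP; split; lra.
have [q qP] := choice H.
exists (map_mx ratr (\row_i q i) : 'rV[R]_n); split; last by exists (\row_i q i).
by apply: eA; split=> // i j; rewrite ord1 !mxE.
Qed.

Lemma measurable_fun_rV d (T : measurableType d) n (f : T -> 'rV[R]_n) :
  (forall i, measurable_fun setT (fun x => f x 0 i)) ->
  measurable_fun setT (f : T -> borel 'rV[R]_n).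
Proof.
move=> mf; apply: (measurable_fun_borel (@dense_ratrow n) (@countable_ratrow n)).
move=> c k _.
rewrite (_ : _ @^-1` _ = \big[setI/setT]_(i < n)
    ((fun x => f x 0 i) @^-1` ball (c 0 i) (k.+1%:R^-1))).
  apply: bigsetI_measurable => i _; rewrite -[X in measurable X]setTI.
  by apply: mf => //; exact: measurable_ball.
apply/seteqP; split=> [x [_ H]|x H].
  by rewrite -bigcap_seq => i _; exact: H.
split=> [|i j]; first by rewrite invr_gt0.
by rewrite ord1; move: H; rewrite -bigcap_seq => /(_ j); apply; rewrite /= mem_index_enum.
Qed.

Lemma measurable_row_mx n :
  measurable_fun setT (fun p : measurableTypeR R * borel 'rV[R]_n =>
         row_mx (p.1)%:M p.2 : borel 'rV[R]_n.+1).
Proof.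
apply: measurable_fun_rV => i.
have [j|] := unliftP ord0 i => ->.
  have -> : lift (ord0 : 'I_n.+1) j = rshift 1 j by exact/val_inj.
  apply: (eq_measurable_fun (fun p : measurableTypeR R * borel 'rV[R]_n => (p.2 : 'rV[R]_n) 0 j)).
    by move=> p _; apply: (etrans _ (esym (row_mxEr _ _ _ _))).
  exact: (measurableT_comp (@coord_measurable n j)).
have -> : (ord0 : 'I_n.+1) = lshift n (ord0 : 'I_1) by exact/val_inj.
apply: (eq_measurable_fun (fun p : measurableTypeR R * borel 'rV[R]_n => p.1)); last exact: measurable_fst.
by move=> p _; apply: (etrans _ (esym (row_mxEl _ _ _ _))); rewrite mxE.
Qed.

End BorelMeasurability.

(** * Second differences of convex functions against Lebesgue measure *)

Section SecondDifference.
Context {R : realType}.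
Local Notation leb := (@lebesgue_measure R).

(** The integral from [-M] is a primitive only to the right of [-M]; [second_difference_1d] takes
    [M] large enough to contain all shifts of its interval. *)
Lemma primitive_exists (g : R -> R) (M : R) : continuous g ->
  exists G : R -> R, forall x, x \in `]-M, M[ -> is_derive x 1 G (g x).
Proof.
move=> cg; exists (fun x => \int[leb]_(t in [set` Interval (BLeft (-M)) (BRight x)]) g t).
move=> x; rewrite in_itv/= => /andP[Mx xM].
have [] := @continuous_FTC1 R g (BLeft (-M)) x M xM.
- apply: continuous_compact_integrable; first exact: segment_compact.
  exact: continuous_subspaceT.
- by rewrite lte_fin.
- exact: cg.
by move=> dG <-; rewrite derive1E; exact: derivableP.
Qed.

(* With a primitive [G] of [g] the integral telescopes to the difference of
   [G (s + t) + G (s - t) - 2 G s] between the endpoints. *)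
Lemma second_difference_1d (g : R -> R) (K r t : R) :
  (forall a b, `|g a - g b| <= K * `|a - b|) -> 0 < r -> 0 < t ->
  (\int[leb]_(s in `[(-r)%R, r]) (g (s + t) + g (s - t) - 2 * g s)%:E
     <= (4 * K * t ^+ 2)%:E)%E.
Proof.
move=> gK r0 t0.
have K0 : 0 <= K.
  by have := gK 1 0; rewrite subr0 normr1 mulr1; apply: le_trans.
have cg : continuous g.
  move=> x; apply/cvgrPdist_le => /= e e0; near=> y.
  apply: (le_trans (gK x y)); apply: (@le_trans _ _ ((K + 1) * `|x - y|)).
    by apply: ler_wpM2r => //; lra.
  rewrite mulrC -ler_pdivlMr; last by lra.
  near: y; apply: cvgr_dist_le; first exact: cvg_id.
  by apply: divr_gt0 => //; lra.
pose M := r + t + 1.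
have [G GP] := primitive_exists M cg.
pose H s := G (s + t) + G (s - t) - 2 * G s.
have dH s : s \in `[-r, r] -> is_derive s 1 H (g (s + t) + g (s - t) - 2 * g s).
  rewrite in_itv/= => /andP[rs sr].
  have dp : is_derive s 1 (fun s => G (s + t)) (g (s + t)).
    have d1 : is_derive (s + t) 1 G (g (s + t)).
      by apply: GP; rewrite in_itv/= /M; apply/andP; split; lra.
    have := @is_derive1_comp R G (fun s => s + t) s _ 1 d1 _.
    by rewrite mulr1; apply; rewrite -[X in is_derive _ _ _ X]addr0; apply: is_deriveD.
  have dm : is_derive s 1 (fun s => G (s - t)) (g (s - t)).
    have d1 : is_derive (s - t) 1 G (g (s - t)).
      by apply: GP; rewrite in_itv/= /M; apply/andP; split; lra.
    have := @is_derive1_comp R G (fun s => s - t) s _ 1 d1 _.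
    by rewrite mulr1; apply; rewrite -[X in is_derive _ _ _ X]addr0; apply: is_deriveD.
  have d0 : is_derive s 1 G (g s).
    by apply: GP; rewrite in_itv/= /M; apply/andP; split; lra.
  by apply: is_deriveB.
have ch : continuous (fun s => g (s + t) + g (s - t) - 2 * g s).
  move=> x; apply: cvgB; last by apply: cvgM; [exact: cvg_cst|exact: cg].
  apply: cvgD; apply: continuous_cvg; try exact: cg.
    by apply: cvgD; [exact: cvg_id|exact: cvg_cst].
  by apply: cvgB; [exact: cvg_id|exact: cvg_cst].
rewrite (@continuous_FTC2 R _ H); first last.
- move=> x xr; rewrite derive1E; have /dH h : x \in `[-r, r] by exact: subset_itv_oo_cc.
  by rewrite derive_val.
- have cH s : s \in `[-r, r] -> {for s, continuous H}.
    by move=> /dH h; apply: differentiable_continuous; apply/derivable1_diffP.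
  split.
  + by move=> x xr; have /dH h : x \in `[-r, r] by exact: subset_itv_oo_cc.
  + by apply: cvg_at_right_filter; apply: cH; rewrite in_itv/=; apply/andP; split; lra.
  + by apply: cvg_at_left_filter; apply: cH; rewrite in_itv/=; apply/andP; split; lra.
- exact: continuous_subspaceT.
- lra.
(* [H s] is the increment of [G] over [[s, s + t]] minus that over [[s - t, s]]. The mean value
   theorem turns it into [t] times a difference of [g] at points at most [2 * t] apart; the two
   endpoints together give the factor 4. *)
have Hb s : s \in `[-r, r] -> `|H s| <= 2 * K * t ^+ 2.
  rewrite in_itv/= => /andP[rs sr].
  have mvt a b : -M < a -> a < b -> b < M -> exists2 c, c \in `[a, b] & G b - G a = g c * (b - a).
    move=> Ma ab bM.
    have dGi x : x \in `]a, b[%R -> is_derive x 1 G (g x).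
      by rewrite in_itv/= => /andP[? ?]; apply: GP; rewrite in_itv/=; apply/andP; split; lra.
    have cG : {within `[a, b], continuous G}.
      apply/continuous_in_subspaceT => x /set_mem; rewrite /= in_itv/= => /andP[? ?].
      have h : is_derive x 1 G (g x) by apply: GP; rewrite in_itv/=; apply/andP; split; lra.
      by apply: differentiable_continuous; apply/derivable1_diffP.
    have [c cab cE] := MVT_segment (ltW ab) dGi cG.
    by exists c.
  have [||| c1 c1P E1] := mvt s (s + t); rewrite /M; try lra.
  have [||| c2 c2P E2] := mvt (s - t) s; rewrite /M; try lra.
  have -> : H s = t * (g c1 - g c2) by rewrite /H; lra.
  rewrite normrM gtr0_norm// (_ : 2 * K * _ = t * (K * (2 * t))); last by ring.
  apply: ler_wpM2l; first exact: ltW.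
  apply: (le_trans (gK _ _)); apply: ler_wpM2l => //.
  move: c1P c2P; rewrite !in_itv/= => /andP[? ?] /andP[? ?].
  by rewrite ler_norml; apply/andP; split; lra.
rewrite -EFinB lee_fin.
have /Hb/ler_normlP[_ h1] : r \in `[-r, r] by rewrite in_itv/=; apply/andP; split; lra.
have /Hb/ler_normlP[h2 _] : -r \in `[-r, r] by rewrite in_itv/=; apply/andP; split; lra.
lra.
Unshelve. all: by end_near. Qed.

End SecondDifference.

Section LebesgueRow.
Context {R : realType}.
Local Notation leb := (@lebesgue_measure R).

Definition cube n (r : R) : set 'rV[R]_n := [set v | forall i, -r <= v 0 i <= r].

Lemma cube_measurable n r : measurable (@cube n r : set (borel 'rV[R]_n)).
Proof.
have -> : @cube n r = \big[setI/setT]_(i < n)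
    ((fun v : borel 'rV[R]_n => (v : 'rV[R]_n) 0 i) @^-1` `[-r, r]).
  apply/seteqP; split=> [x H|x].
    by rewrite -bigcap_seq => i _ /=; rewrite in_itv/=; exact: H.
  rewrite -bigcap_seq => H i.
  by have := H i (mem_index_enum i); rewrite /= in_itv.
apply: bigsetI_measurable => i _; rewrite -[X in measurable X]setTI.
by apply: coord_measurable => //; exact: measurable_itv.
Qed.

Lemma lebesgue_cube n (r : R) : 0 <= r ->
  (lebesgue_rV (@cube n r) = ((2 * r) ^+ n)%:E)%E.
Proof.
move=> r0; rewrite (lebesgue_rV_box (a := fun=> -r) (b := fun=> r)); last by move=> _; lra.
by rewrite prodr_const card_ord (_ : r - - r = 2 * r)//; ring.
Qed.

(** [lebesgue_rV] is a bare set function. The sigma-finite structure, exhausted by cubes of integer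
    half-side, is carried through the recursion because the next product measure and Tonelli require
    it. *)
Lemma lebesgue_rV_measure n : exists m : {sigma_finite_measure set (borel 'rV[R]_n) -> \bar R},
  (m : set _ -> \bar R) = @lebesgue_rV R n.
Proof.
elim: n => [|n [m mE]].
  by exists [the {sigma_finite_measure set _ -> \bar R} of dirac (0 : borel 'rV[R]_0)].
pose p : {measure set (borel 'rV[R]_n.+1) -> \bar R} :=
  measure_function_pushforward__canonical__measure_function_Measure
    [the {measure set _ -> \bar R} of (leb \x m)%E] (@measurable_row_mx R n).
have pE : (p : set _ -> \bar R) = @lebesgue_rV R n.+1 by rewrite /= -mE.
have sf : sigma_finite setT p.
  exists (fun k => @cube n.+1 k%:R).
    apply/seteqP; split=> // x _.
    have [k xk] : exists k : nat, forall i, `|x 0 i| <= k%:R.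
      exists (Num.truncn (\sum_i `|x 0 i|)).+1 => i.
      apply: (@le_trans _ _ (\sum_i `|x 0 i|)).
        by rewrite (bigD1 i)//= lerDl sumr_ge0.
      by rewrite ltW// truncnS_gt.
    by exists k => // i; rewrite -ler_norml.
  move=> k; split; first exact: cube_measurable.
  by rewrite pE lebesgue_cube// ltry.
pose H2 := isSFinite.Build _ _ _ _ (sfinite_measure_sigma_finite sf).
pose H3 := isSigmaFinite.Build _ _ _ _ sf.
by exists (HB.pack_for (SigmaFiniteMeasure.type (borel 'rV[R]_n.+1) R) (Measure.sort p) H2 H3).
Qed.

(** The duality estimates are made one coordinate at a time and then summed, which produces the l1
    norm. *)
Definition norm1 n (u : 'rV[R]_n) : R := \sum_i `|u 0 i|.

Definition lipschitz1 n (K : R) (f : 'rV[R]_n -> R) :=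
  forall u v, `|f u - f v| <= K * norm1 (u - v).

Definition second_difference n (f : 'rV[R]_n -> R) (t : R) i v : R :=
  f (v + t *: delta_mx 0 i) + f (v - t *: delta_mx 0 i) - 2 * f v.

Lemma norm1_ge0 n (u : 'rV[R]_n) : 0 <= norm1 u. Proof. exact: sumr_ge0. Qed.

Lemma ler_norm1 n (u : 'rV[R]_n) : norm1 u <= n%:R * `|u|.
Proof.
apply: (@le_trans _ _ (\sum_(i < n) `|u|)); last by rewrite sumr_const card_ord mulr_natl.
apply: ler_sum => i _; rewrite [leRHS]mx_normrE; exact: (le_bigmax _ _ (0, i)).
Qed.

Lemma lipschitz1_continuous n K (f : 'rV[R]_n -> R) : lipschitz1 K f -> continuous f.
Proof.
move=> fK x; apply/(@cvgrPdist_le _ _ _ (nbhs (x : 'rV[R]_n))) => /= e e0; near=> y.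
have K0 : 0 < `|K| * n%:R + 1 by apply: ltr_wpDl => //; exact: mulr_ge0.
apply: (le_trans (fK x y)); apply: (@le_trans _ _ ((`|K| * n%:R + 1) * `|x - y|)).
  apply: (@le_trans _ _ (`|K| * norm1 (x - y))).
    by apply: ler_wpM2r; [exact: norm1_ge0|exact: ler_norm].
  rewrite mulrDl mul1r -mulrA; apply: ler_wpDr => //.
  by apply: ler_wpM2l => //; exact: ler_norm1.
rewrite mulrC -ler_pdivlMr//.
near: y; apply: cvgr_dist_le; first exact: cvg_id.
exact: divr_gt0.
Unshelve. all: by end_near. Qed.

Lemma lipschitz1_measurable n K (f : 'rV[R]_n -> R) : lipschitz1 K f ->
  measurable_fun setT (f : borel 'rV[R]_n -> R).
Proof. by move=> /lipschitz1_continuous/continuous_borelR. Qed.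

Lemma second_difference_measurable n K (f : 'rV[R]_n -> R) t i : lipschitz1 K f ->
  measurable_fun setT (second_difference f t i : borel 'rV[R]_n -> R).
Proof.
move=> fK; apply: measurable_funB; last first.
  by apply: measurable_funM => //; exact: (lipschitz1_measurable fK).
by apply: measurable_funD; apply: (@lipschitz1_measurable _ K) => u v;
  apply: (le_trans (fK _ _)); rewrite opprD addrACA subrr addr0.
Qed.

Definition row_cons n (x : R) (v : 'rV[R]_n) : 'rV[R]_n.+1 := row_mx x%:M v.

Lemma row_cons0 n x (v : 'rV[R]_n) : row_cons x v 0 ord0 = x.
Proof.
have -> : (ord0 : 'I_n.+1) = lshift n (ord0 : 'I_1) by exact/val_inj.
by apply: (etrans (row_mxEl _ _ _ _)); rewrite mxE.
Qed.

Lemma row_consS n x (v : 'rV[R]_n) i : row_cons x v 0 (lift ord0 i) = v 0 i.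
Proof.
have -> : lift (ord0 : 'I_n.+1) i = rshift 1 i by exact/val_inj.
exact: row_mxEr.
Qed.

Lemma add_deltaE n (u : 'rV[R]_n) t i j :
  (u + t *: delta_mx 0 i) 0 j = u 0 j + t * (j == i)%:R.
Proof. by rewrite !mxE. Qed.

Lemma row_consD0 n x (v : 'rV[R]_n) t :
  row_cons x v + t *: delta_mx 0 ord0 = row_cons (x + t) v.
Proof.
apply/rowP => j; rewrite add_deltaE.
have [k|] := unliftP ord0 j => ->; first by rewrite !row_consS mulr0 addr0.
by rewrite !row_cons0 eqxx mulr1.
Qed.

Lemma row_consDS n x (v : 'rV[R]_n) t i :
  row_cons x v + t *: delta_mx 0 (lift ord0 i) = row_cons x (v + t *: delta_mx 0 i).
Proof.
apply/rowP => j; rewrite add_deltaE.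
have [k|] := unliftP ord0 j => ->; last by rewrite !row_cons0 mulr0 addr0.
by rewrite !row_consS add_deltaE (inj_eq lift_inj).
Qed.

Lemma norm1_row_cons n x (v : 'rV[R]_n) : norm1 (row_cons x v) = `|x| + norm1 v.
Proof.
rewrite /norm1 big_ord_recl row_cons0; congr (_ + _).
by apply: eq_bigr => i _; rewrite row_consS.
Qed.

Lemma row_consB n x y (v w : 'rV[R]_n) : row_cons x v - row_cons y w = row_cons (x - y) (v - w).
Proof.
apply/rowP => j; rewrite [LHS]mxE [X in _ + X]mxE.
have [k|] := unliftP ord0 j => ->; last by rewrite !row_cons0.
by rewrite !row_consS !mxE.
Qed.

Lemma cube_row_cons n r x (v : 'rV[R]_n) :
  cube r (row_cons x v) <-> (-r <= x <= r) /\ cube r v.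
Proof.
split=> [H|[Hx Hv] j].
  by split=> [|i]; [have := H ord0; rewrite row_cons0|have := H (lift ord0 i); rewrite row_consS].
by have [k|] := unliftP ord0 j => ->; rewrite ?row_cons0 ?row_consS.
Qed.

End LebesgueRow.

Section SecondDifferenceRow.
Context {R : realType}.
Local Notation leb := (@lebesgue_measure R).

(** Midpoint convexity along the coordinate axes. The nonnegativity gives access to Tonelli and
    allows enlarging the domain of integration from [A] to a cube. *)
Definition midconvex n (f : 'rV[R]_n -> R) :=
  forall t i v, 0 <= second_difference f t i v.

(** On each line in direction [i] the one-dimensional bound holds, and the other [n - 1] coordinates
    contribute the volume [(2 * r) ^+ n.-1]. The induction follows the recursion of
    [lebesgue_rV]. *)
Lemma second_difference_lebesgue n (f : 'rV[R]_n -> R) (K r t : R) i :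
  lipschitz1 K f -> midconvex f -> 0 < r -> 0 < t ->
  (\int[@lebesgue_rV R n]_(v in @cube R n r) (second_difference f t i v)%:E
     <= (4 * K * t ^+ 2 * (2 * r) ^+ n.-1)%:E)%E.
Proof.
move=> + + r0 t0.
elim: n f i => [f []//|n IH f i fK fc] /=.
have K0 : 0 <= K.
  have := fK (delta_mx 0 ord0) 0; rewrite subr0 => /(le_trans (normr_ge0 _)).
  rewrite pmulr_lge0// /norm1 (bigD1 ord0)//= mxE !eqxx normr1 ltr_wpDr//.
  exact: sumr_ge0.
have [m mE] := @lebesgue_rV_measure R n.
rewrite -mE ge0_integral_pushforward; first last.
- by move=> v _; rewrite lee_fin; exact: fc.
- apply/measurable_EFinP/measurable_funTS.
  exact: (second_difference_measurable _ _ fK).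
- exact: cube_measurable.
- exact: measurable_row_mx.
pose D : set (measurableTypeR R * borel 'rV[R]_n) := `[-r, r] `*` @cube R n r.
have mD : measurable D by apply: measurableX => //; exact: cube_measurable.
have -> : (fun p : measurableTypeR R * borel 'rV[R]_n =>
         row_mx (p.1)%:M p.2 : borel 'rV[R]_n.+1) @^-1` (@cube R n.+1 r) = D.
  apply/seteqP; split=> -[s v] /=.
    by move=> /cube_row_cons[h1 h2]; split=> //=; rewrite in_itv.
  by move=> [/=]; rewrite in_itv/= => h1 h2; apply/cube_row_cons.
pose h (p : measurableTypeR R * borel 'rV[R]_n) : \bar R :=
  (((\1_(`[(-r)%R, r]%classic) p.1 : R) * (\1_(@cube R n r) p.2 : R)) *
    second_difference f t i (row_cons p.1 p.2))%:E.
rewrite integral_mkcond (_ : _ \_ D = h); last first.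
  apply/funext => -[s v]; rewrite patchE /h /=.
  have -> : ((s, v) \in D) = (s \in `[(-r)%R, r]%classic) && (v \in @cube R n r).
    by rewrite in_setX.
  rewrite !indicE; case: (_ \in _); case: (_ \in _) => /=; by rewrite ?mul1r ?mul0r.
have mI1 : measurable_fun setT (\1_(`[(-r)%R, r]%classic) : measurableTypeR R -> R).
  exact: measurable_indic.
have mI2 : measurable_fun setT (\1_(@cube R n r) : borel 'rV[R]_n -> R).
  by apply: measurable_indic; exact: cube_measurable.
have mh : measurable_fun setT h.
  apply/measurable_EFinP; apply: measurable_funM.
    by apply: measurable_funM; apply: measurableT_comp.
  apply: (measurableT_comp (f := second_difference f t i : borel 'rV[R]_n.+1 -> R)).
    exact: second_difference_measurable fK.
  exact: measurable_row_mx.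
have h0 p : (0 <= h p)%E by rewrite lee_fin !mulr_ge0// fc.
have slice s : lipschitz1 K (fun v => f (row_cons s v)) /\ midconvex (fun v => f (row_cons s v)).
  split=> [u v|t' j v].
    by apply: (le_trans (fK _ _)); rewrite row_consB subrr norm1_row_cons normr0 add0r.
  have := fc t' (lift ord0 j) (row_cons s v).
  by rewrite /second_difference -!scaleNr !row_consDS !scaleNr.
have r20 : (0 <= 2 * r)%R by lra.
(* A direction other than the first is handled on slices by the induction hypothesis. For the first
   direction the order of integration is exchanged and the one-dimensional bound applies for a fixed
   tail [v]. *)
case: (unliftP ord0 i) => [j|] iE; rewrite iE in h mh h0 *.
  rewrite fubini_tonelli1//.
  pose C := (4 * K * t ^+ 2 * (2 * r) ^+ n.-1)%R.
  have C0 : 0 <= C by rewrite /C !mulr_ge0 ?exprn_ge0// ltW.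
  apply: (@le_trans _ _ (\int[leb]_s (C%:E * (\1_(`[(-r)%R, r]%classic) s)%:E))%E).
    apply: ge0_le_integral => //=.
    - by move=> s _; apply: integral_ge0 => v _.
    - exact: measurable_fun_fubini_tonelli_F.
    - by apply/measurable_EFinP; apply: measurable_funM.
    - move=> s _; rewrite /fubini_F /h /=.
      rewrite indicE; case: (_ \in _) => /=; last first.
        by rewrite integral0_eq ?mule0// => v _; rewrite mul0r mul0r.
      rewrite mule1; have [sK sc] := slice s.
      have := IH _ j sK sc; rewrite -mE; apply: le_trans.
      rewrite [leRHS]integral_mkcond le_eqVlt; apply/orP; left; apply/eqP.
      apply: eq_integral => v _; rewrite patchE indicE mul1r.
      case: (_ \in _); rewrite ?mul1r ?mul0r//.
      by rewrite /second_difference -!scaleNr !row_consDS.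
  rewrite ge0_integralZl//=; [|by apply/measurable_EFinP].
  rewrite integral_indic//= setIT lebesgue_measure_itv/= lte_fin.
  rewrite (_ : (- r < r)%R); last by lra.
  rewrite -EFinB -EFinM lee_fin /C (_ : r - - r = 2 * r)%R; last by ring.
  rewrite -(mulrA (4 * K * t ^+ 2)%R) -exprSr prednK//.
  by apply: leq_ltn_trans (ltn_ord j).
rewrite fubini_tonelli2//.
pose C := (4 * K * t ^+ 2)%R.
have C0 : 0 <= C by rewrite /C !mulr_ge0 ?exprn_ge0// ltW.
apply: (@le_trans _ _ (\int[m]_v (C%:E * (\1_(@cube R n r) v)%:E))%E).
  apply: ge0_le_integral => //=.
  - by move=> s _; apply: integral_ge0 => v _.
  - exact: measurable_fun_fubini_tonelli_G.
  - by apply/measurable_EFinP; apply: measurable_funM.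
  - move=> v _; rewrite /fubini_G /h /=.
    rewrite indicE; case: (_ \in _) => /=; last first.
      by rewrite integral0_eq ?mule0// => s _; rewrite mulr0 mul0r.
    rewrite mule1.
    have gK a b : `|f (row_cons a v) - f (row_cons b v)| <= K * `|a - b|.
      by apply: (le_trans (fK _ _)); rewrite row_consB subrr norm1_row_cons /norm1 big1 ?addr0// => j _; rewrite mxE normr0.
    have := second_difference_1d gK r0 t0; apply: le_trans.
    rewrite [leRHS]integral_mkcond le_eqVlt; apply/orP; left; apply/eqP.
    apply: eq_integral => s _; rewrite patchE indicE mulr1.
    case: (_ \in _); rewrite ?mul1r ?mul0r//.
    by rewrite /second_difference -!scaleNr !row_consD0.
rewrite ge0_integralZl//=; [|by apply/measurable_EFinP].
rewrite integral_indic//=; last exact: cube_measurable.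
by rewrite setIT mE lebesgue_cube ?(ltW r0)// -EFinM.
Qed.

End SecondDifferenceRow.

(** * Bounded measurable functions on a set of full measure *)

Section BoundedFunctions.
Context d (T : measurableType d) (R : realType).

(** Boundedness is asked on [D] only: potentials may grow linearly on the whole space but are
    bounded on the compact support. The class is closed under sums and products, so integrability
    can be read off the shape of an integrand. *)
Definition bfun (D : set T) (f : T -> R) :=
  measurable_fun setT f /\ exists K, forall x, D x -> `|f x| <= K.

Implicit Types (D : set T) (f g : T -> R).

Lemma bfun_cst D c : bfun D (fun=> c).
Proof. by split; [exact: measurable_cst|exists `|c|]. Qed.

Lemma bfunD D f g : bfun D f -> bfun D g -> bfun D (fun x => f x + g x).
Proof.
move=> [mf [K fK]] [mg [L gL]]; split; first exact: measurable_funD.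
exists (K + L) => x Dx; apply: (le_trans (ler_normD _ _)).
by apply: lerD; [exact: fK|exact: gL].
Qed.

Lemma bfunN D f : bfun D f -> bfun D (fun x => - f x).
Proof.
move=> [mf [K fK]]; split; first exact: measurable_funN.
by exists K => x Dx; rewrite normrN; exact: fK.
Qed.

Lemma bfunB D f g : bfun D f -> bfun D g -> bfun D (fun x => f x - g x).
Proof. by move=> bf bg; apply: bfunD => //; exact: bfunN. Qed.

Lemma bfunM D f g : bfun D f -> bfun D g -> bfun D (fun x => f x * g x).
Proof.
move=> [mf [K fK]] [mg [L gL]]; split; first exact: measurable_funM.
exists (K * L) => x Dx; rewrite normrM.
by apply: ler_pM => //; [exact: fK|exact: gL].
Qed.

Lemma bfun_norm D f : bfun D f -> bfun D (fun x => `|f x|).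
Proof.
move=> [mf [K fK]]; split; first exact: measurableT_comp.
by exists K => x Dx; rewrite normr_id; exact: fK.
Qed.

Lemma bfun_sum D (I : Type) (s : seq I) (F : I -> T -> R) :
  (forall i, bfun D (F i)) -> bfun D (fun x => \sum_(i <- s) F i x).
Proof.
move=> bF; elim: s => [|i s IH].
  by under [X in bfun _ X]funext do rewrite big_nil; exact: bfun_cst.
by under [X in bfun _ X]funext do rewrite big_cons; exact: bfunD.
Qed.

Lemma bfun_indic D (B : set T) : measurable B -> bfun D (\1_B : T -> R).
Proof.
move=> mB; split; first exact: measurable_indic.
by exists 1 => x _; rewrite indicE; case: (_ \in _); rewrite ?normr1 ?normr0.
Qed.

Variables (P : probability T R) (D : set T).
Hypothesis mD : measurable D.
Notation E f := (\int[P]_(x in D) f x).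

Lemma bfun_integrable f : bfun D f -> P.-integrable D (EFin \o f).
Proof.
move=> [mf [K fK]]; apply: measurable_bounded_integrable => //.
- by rewrite (le_lt_trans (probability_le1 _ mD))// ltry.
- exact: measurable_funTS.
- exists K; split; first exact: num_real.
  by move=> M KM x Dx; exact: (le_trans (fK _ Dx) (ltW KM)).
Qed.

Lemma integral_bfun f : bfun D f -> (\int[P]_(x in D) (f x)%:E)%E = (E f)%:E.
Proof. by move=> /bfun_integrable/integrable_fin_num => /(_ mD) /fineK ->. Qed.

Lemma Rint_add f g : bfun D f -> bfun D g -> E (fun x => f x + g x) = E f + E g.
Proof. by move=> /bfun_integrable ? /bfun_integrable ?; exact: RintegralD. Qed.

Lemma Rint_sub f g : bfun D f -> bfun D g -> E (fun x => f x - g x) = E f - E g.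
Proof. by move=> /bfun_integrable ? /bfun_integrable ?; exact: RintegralB. Qed.

Lemma Rint_scale c f : bfun D f -> E (fun x => c * f x) = c * E f.
Proof. by move=> /bfun_integrable ?; exact: RintegralZl. Qed.

Lemma Rint_le f g : bfun D f -> bfun D g -> (forall x, D x -> f x <= g x) -> E f <= E g.
Proof. by move=> /bfun_integrable ? /bfun_integrable ? ?; exact: le_Rintegral. Qed.

Lemma Rint_norm f : bfun D f -> `|E f| <= E (fun x => `|f x|).
Proof. by move=> /bfun_integrable ?; exact: le_normr_Rintegral. Qed.

Lemma Rint_sum (I : Type) (s : seq I) (F : I -> T -> R) :
  (forall i, bfun D (F i)) ->
  E (fun x => \sum_(i <- s) F i x) = \sum_(i <- s) E (F i).
Proof.
move=> bF; elim: s => [|i s IH].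
  rewrite big_nil; under eq_Rintegral do rewrite big_nil.
  by rewrite Rintegral_cst// mul0r.
rewrite big_cons -IH -Rint_add//; last exact: bfun_sum.
by under eq_Rintegral do rewrite big_cons.
Qed.

Lemma Rint_indic (B : set T) : measurable B -> (E (\1_B))%:E = P (D `&` B).
Proof. by move=> mB; rewrite -integral_bfun ?integral_indic 1?setIC//; exact: bfun_indic. Qed.

Hypothesis PD : P (~` D) = 0%E.

Lemma probability_full : P D = 1%E.
Proof. by have := probability_setC P mD; rewrite PD => /eqP; rewrite eq_sym sube_eq ?fin_num_measure// add0e => /eqP. Qed.

Lemma Rint_cst c : E (fun=> c) = c.
Proof. by rewrite Rintegral_cst// -[RHS]mulr1; congr (_ * _); exact: (congr1 fine probability_full). Qed.

Lemma integral_full (f : T -> \bar R) : measurable_fun setT f -> (forall x, 0 <= f x)%E ->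
  (\int[P]_x f x = \int[P]_(x in D) f x)%E.
Proof.
move=> mf f0; rewrite -(setUv D) ge0_integral_setU//; first last.
- exact/disj_setPCl.
- by rewrite setUv.
- exact: measurableC.
rewrite [X in (_ + X)%E](_ : _ = 0%E) ?adde0//.
apply: null_set_integral => //; [exact: measurableC|exact: measurable_funTS].
Qed.

End BoundedFunctions.

(** * Comparison of integrals under a domination of measures *)

Section MeasureComparison.
Local Open Scope ereal_scope.
Context d (T : measurableType d) (R : realType).
Import HBNNSimple.

(** The comparison is made on simple functions below the restriction of [f] to [A]. Such a function
    takes nonzero values only inside [A], where the hypothesis on the two measures applies. *)
Lemma le_integral_measure (m1 m2 : {measure set T -> \bar R}) (M : R) (A : set T)
    (f : T -> \bar R) : (0 <= M)%R -> measurable A ->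
  (forall B, measurable B -> B `<=` A -> m1 B <= M%:E * m2 B) ->
  (forall x, 0 <= f x) ->
  \int[m1]_(x in A) f x <= M%:E * \int[m2]_(x in A) f x.
Proof.
move=> M0 mA m12 f0.
rewrite !(integral_mkcond A) !ge0_integralTE; last 2 first.
- by move=> x; rewrite patchE; case: ifP.
- by move=> x; rewrite patchE; case: ifP.
apply: ge_ereal_sup => _ [h hf <-].
apply: (@le_trans _ _ (M%:E * sintegral m2 h)); last first.
  apply: lee_wpmul2l; first by rewrite lee_fin.
  by apply: ereal_sup_ubound; exists h.
have h0 x : (0 <= h x)%R by exact: fun_ge0.
rewrite !sintegralE ge0_mule_fsumr; last first.
  move=> x; have [|/preimage10 ->] := pselect (range h x); last by rewrite measure0 mule0.
  by move=> [y _ <-]; rewrite mule_ge0// lee_fin.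
apply: lee_fsum => [|_ [y _ <-]]; first exact: fimfunP.
rewrite muleCA; have [->|hy0] := eqVneq (h y) 0%R; first by rewrite !mul0e.
apply: lee_wpmul2l; first by rewrite lee_fin.
apply: m12 => [|z /= hz]; first by rewrite -[X in measurable X]setTI; exact: measurable_funP.
have := hf z; rewrite patchE; case: ifPn => [/set_mem//|_].
by rewrite hz lee_fin leNgt lt_neqAle eq_sym hy0 h0.
Qed.

End MeasureComparison.

(** * The second-difference bound for measures with bounded density *)

Section SecondDifferenceBound.
Context {R : realType} (d : nat).
Local Notation U := ('rV[R]_d).

Lemma ler_norm1_cube r (u : U) : cube r u -> norm1 u <= d%:R * r.
Proof.
move=> ru; apply: (@le_trans _ _ (\sum_(i < d) r)); last by rewrite sumr_const card_ord mulr_natl.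
by apply: ler_sum => i _; rewrite ler_norml; exact: ru.
Qed.

Lemma norm1N (u : U) : norm1 (- u) = norm1 u.
Proof. by rewrite /norm1; apply: eq_bigr => i _; rewrite mxE normrN. Qed.

Lemma ler_norm1D (u v : U) : norm1 (u + v) <= norm1 u + norm1 v.
Proof. by rewrite /norm1 -big_split; apply: ler_sum => i _; rewrite mxE ler_normD. Qed.

Lemma norm1B (u v : U) : norm1 (u - v) = norm1 (v - u).
Proof. by rewrite -norm1N opprB. Qed.

Lemma ler_norm1_dist (u v w : U) : norm1 (u - w) <= norm1 (u - v) + norm1 (v - w).
Proof. by rewrite (_ : u - w = (u - v) + (v - w)) ?ler_norm1D// addrA subrK. Qed.

Lemma lipschitz1_bfun K r (f : U -> R) (A : set (borel U)) :
  A `<=` @cube R d r -> lipschitz1 K f -> bfun A (f : borel U -> R).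
Proof.
move=> Ar fK; split; first exact: lipschitz1_measurable fK.
exists (`|f 0| + `|K| * (d%:R * r)) => x Ax.
rewrite -[X in `|X|](subrK (f 0)) addrC; apply: (le_trans (ler_normD _ _)).
rewrite lerD2l; apply: (le_trans (fK _ _)); rewrite subr0.
apply: (@le_trans _ _ (`|K| * norm1 x)); first by apply: ler_wpM2r; [exact: norm1_ge0|exact: ler_norm].
by apply: ler_wpM2l => //; apply: ler_norm1_cube; exact: Ar.
Qed.

Lemma lipschitz1_shift K (f : U -> R) h : lipschitz1 K f -> lipschitz1 K (fun x => f (x + h)).
Proof.
by move=> fK u v; apply: (le_trans (fK _ _)); rewrite opprD addrACA subrr addr0.
Qed.

Lemma second_difference_bfun K r (f : U -> R) t i (A : set (borel U)) :
  A `<=` @cube R d r -> lipschitz1 K f ->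
  bfun A (second_difference f t i : borel U -> R).
Proof.
move=> Ar fK; apply: bfunB; last first.
  by apply: bfunM; [exact: bfun_cst|exact: (lipschitz1_bfun Ar fK)].
by apply: bfunD; exact: (lipschitz1_bfun Ar (lipschitz1_shift _ fK)).
Qed.

(* The only property of the source measure that the stability argument uses. *)
Definition second_difference_bound (mu : probability (borel U) R) A C :=
  forall K (f : U -> R) t i, lipschitz1 K f -> midconvex f -> 0 < t ->
    \int[mu]_(x in A) second_difference f t i x <= C * K * t ^+ 2.

(** On subsets of [A] the measure is at most [|M|] times Lebesgue measure, and nonnegative second
    differences allow passing from [A] to the cube, where [second_difference_lebesgue] applies. *)
Lemma bounded_density_second_difference (mu : probability (borel U) R)
    (A : set (borel U)) (rho : borel U -> R) (M r : R) :
  0 < r -> measurable A -> A `<=` @cube R d r ->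
  measurable_fun setT rho -> (forall u, 0 <= rho u) ->
  (forall B : set (borel U), measurable B ->
     mu B = (\int[lebesgue_rV (n := d)]_(u in B) (rho u)%:E)%E) ->
  (forall u, A u -> rho u <= M) ->
  exists2 C, 0 <= C & second_difference_bound mu A C.
Proof.
move=> r0 mA Ar mrho rho0 muE rhoM.
have [m mE] := @lebesgue_rV_measure R d.
exists (`|M| * (4 * (2 * r) ^+ d.-1)).
  by rewrite !mulr_ge0// exprn_ge0//; lra.
move=> K f t i fK fc t0.
have bf := second_difference_bfun t i Ar fK.
rewrite -lee_fin -integral_bfun//.
apply: (@le_trans _ _ (`|M|%:E * \int[m]_(x in A) (second_difference f t i x)%:E)%E).
  apply: le_integral_measure => //.
  - move=> B mB BA; rewrite [leLHS](muE _ mB) -mE -integral_cst//.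
    apply: ge0_le_integral => //.
    + by move=> x _; rewrite lee_fin.
    + by apply/measurable_EFinP; exact: measurable_funTS.
    + by move=> x Bx; rewrite lee_fin; apply: (le_trans (rhoM _ (BA _ Bx))); exact: ler_norm.
  - by move=> x; rewrite lee_fin.
have -> : `|M| * (4 * (2 * r) ^+ d.-1) * K * t ^+ 2 = `|M| * (4 * K * t ^+ 2 * (2 * r) ^+ d.-1).
  by ring.
rewrite EFinM; apply: lee_wpmul2l; first by rewrite lee_fin.
have := second_difference_lebesgue i fK fc r0 t0; rewrite -mE; apply: le_trans.
apply: ge0_subset_integral => //; first exact: cube_measurable.
- by apply/measurable_EFinP/measurable_funTS; case: bf.
- by move=> x _; rewrite lee_fin.
Qed.

(** The set depends on [x] only through finitely many memberships, hence is a finite union of atoms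
    of the algebra generated by the [V i]. It makes selections by [pick] measurable. *)
Lemma finite_factor_measurable dT (T : measurableType dT) (I : finType) (J : Type)
    (V : I -> set T) (g : {ffun I -> bool} -> J) (B : set J) :
  (forall i, measurable (V i)) ->
  measurable [set x | B (g [ffun i => x \in V i])].
Proof.
move=> mV.
have -> : [set x | B (g [ffun i => x \in V i])] =
    \bigcup_(b in [set b : {ffun I -> bool} | B (g b)])
      \bigcap_(i in [set: I]) (if b i then V i else ~` V i).
  apply/seteqP; split=> [x Bx|x [b Bb H]] /=.
    exists [ffun i => x \in V i] => // i _; rewrite ffunE.
    by case: ifPn => [/set_mem|/negP xV] //; rewrite /setC /=; move: xV; apply: contra_not; exact: mem_set.
  rewrite (_ : [ffun i => _] = b)//; apply/ffunP => i; rewrite ffunE.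
  by have := H i Logic.I; case: (b i) => [/mem_set|nV] //; apply/negbTE/negP => /set_mem.
apply: countable_bigcup_measurable => [|b _]; first exact: countableP.
apply: fin_bigcap_measurable => // i _.
by case: (b i) => //; exact: measurableC.
Qed.

End SecondDifferenceBound.

(** * Inner product and maxima of finitely many affine functions *)

Section Edot.
Context {R : realType} (d : nat).
Local Notation U := ('rV[R]_d).
Implicit Types u v w : U.

Lemma edotC u v : edot u v = edot v u.
Proof. by apply: eq_bigr => i _; rewrite mulrC. Qed.

Lemma edotDl u v w : edot (u + v) w = edot u w + edot v w.
Proof. by rewrite /edot -big_split; apply: eq_bigr => i _; rewrite mxE mulrDl. Qed.

Lemma edotZl a u w : edot (a *: u) w = a * edot u w.
Proof. by rewrite /edot mulr_sumr; apply: eq_bigr => i _; rewrite mxE mulrA. Qed.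

Lemma edotNl u w : edot (- u) w = - edot u w.
Proof. by rewrite -scaleN1r edotZl mulN1r. Qed.

Lemma edotBl u v w : edot (u - v) w = edot u w - edot v w.
Proof. by rewrite edotDl edotNl. Qed.

Lemma edotBr u v w : edot w (u - v) = edot w u - edot w v.
Proof. by rewrite edotC edotBl !(edotC w). Qed.

Lemma edot_delta i w : edot (delta_mx 0 i) w = w 0 i.
Proof.
rewrite /edot (bigD1 i)//= mxE !eqxx mul1r big1 ?addr0// => j ji.
by rewrite mxE (negPf ji) andbF mul0r.
Qed.

Lemma ler_norm_edot r u v : cube r v -> `|edot u v| <= r * norm1 u.
Proof.
move=> rv; apply: (le_trans (ler_norm_sum _ _ _)); rewrite /norm1 mulr_sumr.
apply: ler_sum => i _; rewrite normrM mulrC; apply: ler_wpM2r => //.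
by rewrite ler_norml; exact: rv.
Qed.

Lemma edot_lipschitz r v : cube r v -> lipschitz1 r (fun u : U => edot u v).
Proof. by move=> rv u w; rewrite -edotBl; exact: ler_norm_edot. Qed.

End Edot.

Section MaxAffine.
Context {R : realType} (d m : nat) (p : 'I_m.+1 -> 'rV[R]_d).
Local Notation U := ('rV[R]_d).
Implicit Types (psi : 'I_m.+1 -> R) (x : U).

(** The convex conjugate of a potential [psi] that lives on the points [p j]. *)
Definition maxaff psi x : R :=
  let F j := edot x (p j) - psi j in F [arg max_(j > ord0) F j]%O.

Lemma maxaff_ge psi x j : edot x (p j) - psi j <= maxaff psi x.
Proof. by rewrite /maxaff; case: arg_maxP => //= i _; exact. Qed.

Lemma maxaff_ex psi x : exists j, maxaff psi x = edot x (p j) - psi j.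
Proof. by exists [arg max_(j > ord0) (edot x (p j) - psi j)]%O. Qed.

Lemma maxaff_le psi x c : (forall j, edot x (p j) - psi j <= c) -> maxaff psi x <= c.
Proof. by have [j ->] := maxaff_ex psi x. Qed.

Lemma maxaff_lipschitz r psi : (forall j, cube r (p j)) -> lipschitz1 r (maxaff psi).
Proof.
move=> pr u v; wlog uv : u v / maxaff psi v <= maxaff psi u.
  move=> H; have [|/ltW] := leP (maxaff psi v) (maxaff psi u); first exact: H.
  by rewrite distrC norm1B; exact: H.
rewrite ger0_norm ?subr_ge0//; have [j uE] := maxaff_ex psi u.
have vj := maxaff_ge psi v j.
have := edot_lipschitz (pr j) u v => /ler_normlP[_]; rewrite uE; lra.
Qed.

Lemma maxaff_midconvex psi : midconvex (maxaff psi).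
Proof.
move=> t i v; have [j vE] := maxaff_ex psi v.
have := maxaff_ge psi (v + t *: delta_mx 0 i) j.
have := maxaff_ge psi (v - t *: delta_mx 0 i) j.
by rewrite /second_difference vE !edotDl !edotNl; lra.
Qed.

(* Where two affine pieces tie, [maxaff psi] has a kink. *)
Lemma maxaff_tie psi x t l i j : 0 <= t ->
  maxaff psi x = edot x (p i) - psi i -> maxaff psi x = edot x (p j) - psi j ->
  t * (p i 0 l - p j 0 l) <= second_difference (maxaff psi) t l x.
Proof.
move=> t0 xi xj.
have := maxaff_ge psi (x + t *: delta_mx 0 l) i.
have := maxaff_ge psi (x - t *: delta_mx 0 l) j.
rewrite /second_difference !edotDl !edotNl !edotZl !edot_delta; lra.
Qed.

End MaxAffine.

(** * Semi-discrete optimal transport *)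

Section SemiDiscreteTransport.
Context {R : realType} (d : nat).
Local Notation U := ('rV[R]_d).
Variables (mu : probability (borel U) R) (A : set (borel U)) (r C : R).
Hypotheses (mA : measurable A) (muA : mu (~` A) = 0%E) (r0 : 0 < r)
  (Ar : A `<=` @cube R d r) (C0 : 0 <= C) (HC : second_difference_bound mu A C).
Variables (m : nat) (p : 'I_m.+1 -> U) (w : 'I_m.+1 -> R).
Hypotheses (p_inj : injective p) (pr : forall j, cube r (p j))
  (w_ge0 : forall j, 0 <= w j) (w_sum : \sum_j w j = 1).

(** The Kantorovich dual functional, with the potential on the source eliminated as the conjugate of
    [psi]. *)
Let dual (psi : 'I_m.+1 -> R) : R := \int[mu]_(x in A) maxaff p psi x + \sum_j w j * psi j.

Let maxaff_bfun psi : bfun A (maxaff p psi : borel U -> R).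
Proof. exact: (lipschitz1_bfun Ar (maxaff_lipschitz _ pr)). Qed.

Lemma maxaff_shift psi psi' e x : (forall j, psi' j - e <= psi j) ->
  maxaff p psi x <= maxaff p psi' x + e.
Proof.
move=> H; apply: maxaff_le => j.
have := maxaff_ge p psi' x j; have := H j; lra.
Qed.

Let dual_lipschitz psi psi' e : (forall j, `|psi j - psi' j| <= e) ->
  `|dual psi - dual psi'| <= 2 * e.
Proof.
suff H (f g : 'I_m.+1 -> R) : (forall j, `|f j - g j| <= e) -> dual f - dual g <= 2 * e.
  move=> he; rewrite ler_norml lerNl opprB; apply/andP; split; apply: H => // j.
  by rewrite distrC.
move=> he; rewrite /dual.
have : \int[mu]_(x in A) maxaff p f x <= \int[mu]_(x in A) (maxaff p g x + e).
  apply: (@Rint_le _ _ _ mu A mA) => // [|x _]; first by apply: bfunD => //; exact: bfun_cst.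
  by apply: maxaff_shift => j; have /ler_normlP[] := he j; lra.
rewrite (@Rint_add _ _ _ mu A mA)//; last exact: bfun_cst.
rewrite (Rint_cst mA muA).
have : \sum_j w j * f j <= \sum_j w j * g j + e.
  rewrite -[X in _ + X]mul1r -w_sum mulr_suml -big_split/=; apply: ler_sum => j _.
  by rewrite -mulrDr; apply: ler_wpM2l => //; have /ler_normlP[] := he j; lra.
lra.
Qed.

(** The functional is invariant under adding constants, so the least [psi i] may be taken to be 0.
    Capping at [L] does not increase it either: on [A] the products [edot x (p j)] differ by at most
    [L], so a piece with [psi j] above [L] stays below the piece of the least value. Hence a
    minimiser over the compact box is global. *)
Let dual_min : exists psi, forall psi', dual psi <= dual psi'.
Proof.
pose L := 2 * (r * (d%:R * r)).
have L0 : 0 <= L by rewrite /L !mulr_ge0 // ltW.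
pose box : set 'rV[R]_m.+1 := [set v | forall j, v ord0 j \in `[0, L]].
have cbox : compact box by apply: (@rV_compact R _ (fun=> `[0, L]%classic)) => j; exact: segment_compact.
have cdual : continuous (fun v : 'rV[R]_m.+1 => dual (v 0)).
  move=> x; apply/(@cvgrPdist_le _ _ _ (nbhs (x : 'rV[R]_m.+1))) => /= e e0; near=> y.
  apply: (le_trans (@dual_lipschitz _ _ `|x - y| _)).
    move=> j; rewrite [leRHS]mx_normrE.
    by have := le_bigmax (0:R) (fun ij : 'I_1 * 'I_m.+1 => `|(x - y) ij.1 ij.2|) (0, j); rewrite !mxE.
  rewrite mulrC -ler_pdivlMr//.
  near: y; apply: cvgr_dist_le; first exact: cvg_id.
  exact: divr_gt0.
have [|c cb cmin] := EVT_min_rV _ cbox (continuous_subspaceT cdual).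
  by exists 0 => j; rewrite mxE in_itv/= lexx L0.
exists (c 0) => psi.
pose i0 := [arg min_(i < ord0) psi i]%O.
have i0P j : psi i0 <= psi j by rewrite /i0; case: arg_minP => //= i _; exact.
pose psi' : 'rV[R]_m.+1 := \row_j Num.min (psi j - psi i0) L.
apply: (@le_trans _ _ (dual (psi' 0))).
  apply: cmin; apply/mem_set => j; rewrite mxE in_itv/= le_min ge_min lexx orbT L0 andbT.
  by rewrite subr_ge0 i0P.
have h1 : \int[mu]_(x in A) maxaff p (psi' 0) x <= \int[mu]_(x in A) (maxaff p psi x + psi i0).
  apply: (@Rint_le _ _ _ mu A mA) => // [|x Ax]; first by apply: bfunD => //; exact: bfun_cst.
  apply: maxaff_le => j; rewrite mxE.
  have [_|_] := leP (psi j - psi i0) L; first by have := maxaff_ge p psi x j; lra.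
  have := maxaff_ge p psi x i0.
  have hx k : `|edot x (p k)| <= r * (d%:R * r).
    apply: (le_trans (ler_norm_edot _ (pr k))); apply: ler_wpM2l; first exact: ltW.
    exact/ler_norm1_cube/Ar.
  have /ler_normlP[_ ?] := hx j; have /ler_normlP[? _] := hx i0; rewrite /L; lra.
rewrite (@Rint_add _ _ _ mu A mA) ?(Rint_cst mA muA)// in h1; last exact: bfun_cst.
have : \sum_j w j * psi' 0 j + psi i0 <= \sum_j w j * psi j.
  rewrite -[X in _ + X]mul1r -w_sum mulr_suml -big_split/=; apply: ler_sum => j _.
  rewrite -mulrDr; apply: ler_wpM2l => //; rewrite mxE.
  have : Num.min (psi j - psi i0) L <= psi j - psi i0 by rewrite ge_min lexx.
  lra.
rewrite /dual; lra.
Unshelve. all: by end_near. Qed.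

Let gap psi j x := maxaff p psi x - (edot x (p j) - psi j).

Let gap_measurable psi j : measurable_fun setT (gap psi j : borel U -> R).
Proof.
apply: measurable_funB; first by case: (maxaff_bfun psi).
apply: measurable_funB => //; exact: (lipschitz1_measurable (edot_lipschitz (pr j))).
Qed.

Let gap_le_measurable psi j t : measurable ([set x | gap psi j x <= t] : set (borel U)).
Proof.
have := @gap_measurable psi j measurableT _ (@measurable_itv R `]-oo, t]).
by rewrite setTI; congr measurable; apply/seteqP; split=> x /=; rewrite in_itv.
Qed.

(** Lowering [psi j] by [t] lowers the linear term by [t * w j], and raises [maxaff] by at most [t]
    and only where the piece [j] is within [t] of the maximum. *)
Let first_variation psi j t : 0 < t -> (forall psi', dual psi <= dual psi') ->
  ((w j)%:E <= mu (A `&` [set x : borel U | (gap psi j x <= t)%R]))%E.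
Proof.
move=> t0 psi_min.
pose psit i := psi i - t * (i == j)%:R.
have mG := gap_le_measurable psi j t.
have bI := bfun_indic R A mG.
rewrite -(Rint_indic _ mA mG) lee_fin.
have h1 : \int[mu]_(x in A) maxaff p psit x <=
    \int[mu]_(x in A) (maxaff p psi x + t * \1_([set x : borel U | gap psi j x <= t]) x).
  have bt : bfun A (fun x : borel U => t * \1_([set x : borel U | gap psi j x <= t]) x).
    by apply: bfunM => //; exact: bfun_cst.
  apply: (@Rint_le _ _ _ mu A mA) => // [|x Ax]; first exact: bfunD.
  apply: maxaff_le => i; rewrite /psit indicE.
  have xi := maxaff_ge p psi x i.
  have [ij|ij] := eqVneq i j; last by rewrite mulr0 subr0; case: (_ \in _); rewrite ?mulr1 ?mulr0; lra.
  have [xt|xt] := boolP (gap psi j x <= t); first by rewrite mem_set// !mulr1; lra.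
  rewrite memNset; last exact/negP.
  by move: xt; rewrite -ltNge /gap mulr1 mulr0 ij; lra.
have := psi_min psit; rewrite /dual.
have -> : \sum_i w i * psit i = \sum_i w i * psi i - t * w j.
  rewrite [in LHS](bigD1 j)//= [in RHS](bigD1 j)//= /psit eqxx mulr1.
  rewrite (eq_bigr (fun i => w i * psi i)) => [|i /negPf ->]; last by rewrite mulr0 subr0.
  ring.
rewrite (@Rint_add _ _ _ mu A mA)// in h1; last by apply: bfunM => //; exact: bfun_cst.
rewrite (@Rint_scale _ _ _ mu A mA)// in h1.
move=> h2; rewrite -(ler_pM2l t0); lra.
Qed.

(** The closed Laguerre cell of [p j]; cells of different points may overlap. *)
Let cell psi j : set (borel U) := [set x | gap psi j x <= 0].

Let cell_measurable psi j : measurable (cell psi j).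
Proof. exact: gap_le_measurable. Qed.

(** The sets where the gap is at most [1 / (n + 1)] decrease to the cell, so continuity from above
    lets [t] tend to 0 in [first_variation]. *)
Let cell_mass psi j : (forall psi', dual psi <= dual psi') ->
  ((w j)%:E <= mu (A `&` cell psi j))%E.
Proof.
move=> psi_min.
pose F n := A `&` [set x : borel U | gap psi j x <= n.+1%:R^-1].
have mF n : measurable (F n) by apply: measurableI.
have -> : A `&` cell psi j = \bigcap_n F n.
  apply/seteqP; split=> [x [Ax xj] n _|x Fx].
    by split=> //=; apply: (le_trans xj); rewrite invr_ge0.
  split; first by case: (Fx 0%N).
  rewrite /cell /= leNgt; apply/negP => /ltr_add_invr[n]; rewrite add0r.
  by have [_ /=] := Fx n I; rewrite leNgt => /negP.
have := @nonincreasing_cvg_mu _ _ R mu F.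
have : (mu (F 0%N) < +oo)%E by rewrite (le_lt_trans (probability_le1 _ _))// ltry.
move=> /[swap] /[apply] /(_ mF (bigcapT_measurable mF)) => H.
have niF : nonincreasing_seq F.
  move=> a b ab; apply/subsetPset => x [Ax /= xb]; split=> //=.
  by apply: (le_trans xb); rewrite lef_pV2 ?posrE// ler_nat.
apply: (cvge_to_ge (H niF)).
by apply: nearW => n; apply: first_variation => //; rewrite invr_gt0.
Qed.

(** Distinct points differ in some coordinate [l]. On a tie the kink makes the second difference in
    direction [l] at least linear in [t], while its integral is quadratic in [t]. *)
Let ties_null psi i j : i != j -> mu (A `&` (cell psi i `&` cell psi j)) = 0%E.
Proof.
move=> ij; have [l] : exists l, p i 0 l != p j 0 l.
  apply: contrapT => /forallNP H; move/negP: ij; apply; apply/eqP/p_inj/rowP => l.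
  by apply/eqP/negPn/negP; exact: H.
wlog plt : i j ij / p j 0 l < p i 0 l.
  move=> H plij; have [pl|pl|pl] := ltgtP (p i 0 l) (p j 0 l).
  - by rewrite setIA setIAC -setIA; apply: H => //; rewrite eq_sym.
  - exact: H.
  - by rewrite pl eqxx in plij.
move=> _.
have mT : measurable (cell psi i `&` cell psi j).
  by apply: measurableI; exact: cell_measurable.
rewrite -(Rint_indic _ mA mT); congr (_%:E); apply/eqP; rewrite eq_le.
set a := \int[mu]_(x in A) _; have a0 : 0 <= a by apply: Rintegral_ge0.
rewrite a0 andbT; apply/ler_addgt0Pr => e e0; rewrite add0r.
pose D := p i 0 l - p j 0 l; have D0 : 0 < D by rewrite /D subr_gt0.
(* Chosen so that [C * r * t <= D * e]. *)
pose t := e * D / (C * r + 1).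
have Cr : 0 < C * r + 1 by apply: ltr_wpDl => //; rewrite mulr_ge0// ltW.
have t0 : 0 < t by rewrite /t divr_gt0// mulr_gt0.
have := HC l (maxaff_lipschitz psi pr) (maxaff_midconvex p psi) t0.
have : t * D * a <= \int[mu]_(x in A) second_difference (maxaff p psi) t l x.
  rewrite /a -(@Rint_scale _ _ _ mu A mA); last exact: bfun_indic.
  apply: (@Rint_le _ _ _ mu A mA).
  - by apply: bfunM; [exact: bfun_cst|exact: bfun_indic].
  - exact: (second_difference_bfun _ _ Ar (maxaff_lipschitz psi pr)).
  move=> x Ax; rewrite indicE; have [/set_mem[xi xj]|_] := boolP (x \in _); last first.
    by rewrite mulr0; exact: maxaff_midconvex.
  rewrite mulr1; apply: maxaff_tie; first exact: ltW.
    by apply/eqP; rewrite eq_le maxaff_ge andbT; move: xi; rewrite /cell /gap /=; lra.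
  by apply/eqP; rewrite eq_le maxaff_ge andbT; move: xj; rewrite /cell /gap /=; lra.
move=> /le_trans/[apply].
rewrite -[t * D * a]mulrA (_ : C * r * t ^+ 2 = t * (C * r * t)); last by ring.
rewrite ler_pM2l// => h.
have : D * a <= D * e; last by rewrite ler_pM2l.
apply: (le_trans h); rewrite /t mulrC mulrAC ler_pdivrMr//; nra.
Qed.

(* At a minimiser of the dual functional, lowering [psi j] shows that [w j] is
   at most the mass of the set where the piece [j] is maximal.  Ties have
   measure zero because of the kinks of [maxaff psi], so these sets partition
   [A] up to a null set; both families having total mass 1, they agree. *)
Lemma semidiscrete_map : exists psi (jx : U -> 'I_m.+1),
  [/\ forall B, measurable (jx @^-1` B : set (borel U)),
      forall x i, edot x (p i) - psi i <= edot x (p (jx x)) - psi (jx x)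
    & forall j, mu (A `&` jx @^-1` [set j]) = (w j)%:E].
Proof.
have [psi psi_min] := dual_min.
(* One of the cells containing [x] is picked. Factoring the choice through the membership vector
   makes it measurable; the default [ord0] is never taken, because some piece attains the
   maximum. *)
pose g (b : {ffun 'I_m.+1 -> bool}) := odflt ord0 [pick j | b j].
pose jx (x : borel U) := g [ffun j => x \in cell psi j].
have mjx B : measurable (jx @^-1` B).
  by apply: (finite_factor_measurable g B (V := cell psi)) => j.
have jxP x : cell psi (jx x) x.
  rewrite /jx /g; case: pickP => [j /=|nj] /=; first by rewrite ffunE => /set_mem.
  have [j xj] := maxaff_ex p psi x; have := nj j; rewrite ffunE mem_set//.
  by rewrite /cell /gap /= xj subrr.
have mV j := cell_measurable psi j.
have bW j : bfun A (\1_(jx @^-1` [set j]) : borel U -> R) by exact: bfun_indic.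
have W_ge j : w j <= \int[mu]_(x in A) \1_(jx @^-1` [set j]) x.
  have := cell_mass j psi_min; rewrite -(Rint_indic _ mA (mV j)) lee_fin => /le_trans; apply.
  (* A point of the cell [j] that was assigned to another index lies in a tie. The functions [T i]
     cover these points and have integral 0, so adding them does not change the right-hand side. *)
  pose T i : borel U -> R := fun x => (i != j)%:R * \1_(cell psi i `&` cell psi j) x.
  have bT i : bfun A (T i).
    by apply: bfunM; [exact: bfun_cst|apply: bfun_indic; exact: measurableI].
  have T0 i : \int[mu]_(x in A) T i x = 0.
    have mI : measurable (cell psi i `&` cell psi j) by exact: measurableI.
    rewrite (@Rint_scale _ _ _ mu A mA); last exact: bfun_indic.
    have [_|ij] := eqVneq i j; first by rewrite mul0r.
    by rewrite mul1r; apply/EFin_inj; rewrite (Rint_indic _ mA mI) ties_null.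
  have -> : \int[mu]_(x in A) \1_(jx @^-1` [set j]) x =
      \int[mu]_(x in A) (\1_(jx @^-1` [set j]) x + \sum_i T i x).
    rewrite (@Rint_add _ _ _ mu A mA)//; last exact: bfun_sum.
    by rewrite (@Rint_sum _ _ _ mu A mA)// (eq_bigr (fun=> 0)) ?sumr_const ?mul0rn ?addr0.
  apply: (@Rint_le _ _ _ mu A mA).
  - exact: bfun_indic.
  - by apply: bfunD => //; exact: bfun_sum.
  move=> x Ax; rewrite !indicE.
  have T_ge0 i : 0 <= T i x by rewrite mulr_ge0.
  have sT : 0 <= \sum_i T i x by exact: sumr_ge0.
  have [/set_mem xj|_] := boolP (x \in cell psi j); last by rewrite addr_ge0.
  have [xj'|xj'] := eqVneq (jx x) j; first by rewrite mem_set// lerDl.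
  apply: (@le_trans _ _ (T (jx x) x)).
    by rewrite /T xj' mul1r indicE mem_set//; split.
  by rewrite (bigD1 (jx x))//= addrCA lerDl addr_ge0// sumr_ge0.
have W_sum : \sum_j \int[mu]_(x in A) \1_(jx @^-1` [set j]) x = 1.
  rewrite -(@Rint_sum _ _ _ mu A mA)// -[RHS](Rint_cst mA muA).
  apply: eq_Rintegral => x _; rewrite (bigD1 (jx x))//= indicE mem_set// big1 ?addr0// => i ij.
  by rewrite indicE memNset//= => /esym/eqP; rewrite (negPf ij).
exists psi, jx; split=> // [x i|j].
  by have := jxP x; have := maxaff_ge p psi x i; rewrite /cell /gap /=; lra.
rewrite -(Rint_indic _ mA (mjx _)); congr (_%:E); apply/eqP.
rewrite eq_le W_ge andbT; have WE := W_sum.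
rewrite -w_sum [in LHS](bigD1 j)//= [in RHS](bigD1 j)//= in WE.
have : \sum_(i < m.+1 | i != j) w i <= \sum_(i < m.+1 | i != j) \int[mu]_(x in A) \1_(jx @^-1` [set i]) x.
  by apply: ler_sum => i _; exact: W_ge.
move: WE; set a := \int[mu]_(x in A) _; set b := \sum_(i < _ | _) _; set c := \sum_(i < _ | _) _.
lra.
Qed.

End SemiDiscreteTransport.

(** * Kantorovich potentials on cubes *)

Section Kantorovich.
Context {R : realType} (d : nat).
Local Notation U := ('rV[R]_d).

(** The points are centres of a finite cover of the cube. They are distinct because
    [semidiscrete_map] rules out ties only between different points, and the quantiser [q] is
    measurable because it factors through finitely many memberships. *)
Lemma finite_grid (r e : R) : 0 < r -> 0 < e ->
  exists m (p : 'I_m.+1 -> U) (q : borel U -> 'I_m.+1),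
  [/\ injective p, forall j, cube r (p j), forall B, measurable (q @^-1` B)
    & forall v, cube r v -> norm1 (v - p (q v)) <= e].
Proof.
move=> r0 e0.
(* Balls are those of the maximum norm, and [norm1] is at most [d] times it; the [+ 1] covers
   [d = 0]. *)
have de : 0 < e / (d%:R + 1) by rewrite divr_gt0// ltr_wpDl.
have : compact (@cube R d r).
  have := @rV_compact R d (fun=> `[-r, r]%classic) (fun=> @segment_compact R (-r) r).
  by congr compact; apply/seteqP; split=> v /= H i; have := H i; rewrite /= in_itv.
rewrite compact_cover => /(_ U (@cube R d r) (fun c => ball c (e / (d%:R + 1)))).
move=> [c _|v rv|s sr scov]; first exact: ball_open.
  by exists v => //; exact: ballxx.
have r0v : @cube R d r 0 by move=> i; rewrite mxE; lra.
have [m sm] : exists m, size (enum_fset s) = m.+1.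
  have [c cs _] := scov _ r0v.
  by move: (cs : c \in enum_fset s); case: (enum_fset s) => // a l _; exists (size l).
pose p (j : 'I_m.+1) : U := nth 0 (enum_fset s) j.
have ps j : p j \in s by apply: mem_nth; rewrite sm.
have p_inj : injective p.
  move=> i j /eqP; rewrite /p nth_uniq ?sm//; first by move=> /eqP/val_inj.
  exact: fset_uniq.
pose V j : set (borel U) := [set v | norm1 (v - p j) <= e].
have mV j : measurable (V j).
  have : lipschitz1 1 (fun v : U => norm1 (v - p j)).
    move=> u v; rewrite mul1r ler_norml.
    have := ler_norm1_dist u v (p j); have := ler_norm1_dist v u (p j).
    by rewrite (norm1B v u); lra.
  move=> /lipschitz1_measurable /(_ measurableT _ (@measurable_itv R `]-oo, e])).
  by rewrite setTI; congr measurable; apply/seteqP; split=> x /=; rewrite in_itv.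
pose g (b : {ffun 'I_m.+1 -> bool}) := odflt ord0 [pick j | b j].
exists m, p, (fun v => g [ffun j => v \in V j]); split=> //.
- by move=> j; apply/set_mem/sr; exact: ps.
- by move=> B; exact: (finite_factor_measurable g B mV).
move=> v rv; rewrite /g; case: pickP => [j /=|]; first by rewrite ffunE => /set_mem.
have [c cs vc] := scov _ rv.
have cm : (index c (enum_fset s) < m.+1)%N by rewrite -sm index_mem.
move=> /(_ (Ordinal cm)); rewrite ffunE mem_set//.
rewrite /V /= /p /= nth_index//; apply: (le_trans (ler_norm1 _)).
have := vc; rewrite -ball_normE/= distrC => /ltW h.
apply: (@le_trans _ _ (d%:R * (e / (d%:R + 1)))); first exact: ler_wpM2l.
rewrite mulrA ler_pdivrMr ?ltr_wpDl// mulrC mulrDr mulr1 lerDl; exact: ltW.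
Qed.

(* [S] maps [mu] to the image under [X] of the measure of density [g], and is
   optimal for the potentials [phi] and [psi].  The duality inequality is
   required on a cube larger by 1, as it is tested at [x +/- t e_i], [t <= 1];
   [v] ranges over the cube that contains the targets. *)
Record kantorovich (mu : probability (borel U) R) (A : set (borel U)) (r : R)
    (S : U -> U) (phi psi : U -> R) (X : U -> U) (g : U -> R) : Prop := Kantorovich {
  kant_measurable : measurable_fun setT (S : borel U -> borel U);
  kant_cube : forall x, cube r (S x);
  kant_phi_lip : lipschitz1 r phi;
  kant_phi_conv : midconvex phi;
  kant_psi_lip : lipschitz1 (r + 1) psi;
  kant_dual : forall x v, cube (r + 1) x -> cube r v -> edot x v <= phi x + psi v;
  kant_eq : forall x, A x -> phi x + psi (S x) = edot x (S x);
  kant_push : forall K f, lipschitz1 K f ->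
    \int[mu]_(x in A) f (S x) = \int[mu]_(x in A) (f (X x) * g x)
}.

Section ConjugateOnCube.
Variables (r : R) (phi : U -> R).
Hypotheses (r0 : 0 < r) (phi_lip : lipschitz1 r phi).

(** The dual weights of the semi-discrete problem live on the support points only. The conjugate
    replaces them by a function of all [v], so that the potential of one target can be evaluated at
    the values of another map. The supremum runs over the enlarged cube on which the duality
    inequality is tested. *)
Definition conjugate (v : U) : R :=
  sup [set edot x v - phi x | x in @cube R d (r + 1)].

Let conjugate_has_sup v : has_sup [set edot x v - phi x | x in @cube R d (r + 1)].
Proof.
split; first by exists (edot 0 v - phi 0), 0 => // i; rewrite mxE; have := r0; lra.
exists ((r + 1) * norm1 v + (`|phi 0| + r * (d%:R * (r + 1)))) => _ [x rx <-].
apply: lerD.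
  by rewrite edotC; apply: (le_trans (ler_norm _)); exact: ler_norm_edot.
have /ler_normlP[h _] := phi_lip x 0; rewrite subr0 in h.
have /ler_normlP[_ ?] : `|phi 0| <= `|phi 0| by [].
have /ler_normlP[? _] : `|phi 0| <= `|phi 0| by [].
have : r * norm1 x <= r * (d%:R * (r + 1)).
  by apply: ler_wpM2l; [exact: ltW|exact: ler_norm1_cube].
lra.
Qed.

Lemma conjugate_ge x v : cube (r + 1) x -> edot x v - phi x <= conjugate v.
Proof. by move=> rx; apply: ub_le_sup; [case: (conjugate_has_sup v)|exists x]. Qed.

Lemma conjugate_le v c : (forall x, cube (r + 1) x -> edot x v - phi x <= c) ->
  conjugate v <= c.
Proof.
move=> H; apply: ge_sup; first by case: (conjugate_has_sup v).
by move=> _ [x rx <-]; exact: H.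
Qed.

Lemma conjugate_lipschitz : lipschitz1 (r + 1) conjugate.
Proof.
suff H u v : conjugate u - conjugate v <= (r + 1) * norm1 (u - v).
  by move=> u v; rewrite ler_norml lerNl opprB H norm1B H.
rewrite lerBlDr; apply: conjugate_le => x rx.
have := conjugate_ge v rx.
have := ler_norm_edot (u - v) rx => /ler_normlP[_]; rewrite edotBl !(edotC _ x).
lra.
Qed.

End ConjugateOnCube.
End Kantorovich.

(** * Existence and stability of optimal maps with potentials *)

Section KantorovichStability.
Context {R : realType} (d : nat).
Local Notation U := ('rV[R]_d).
Variables (mu : probability (borel U) R) (A : set (borel U)) (r C : R).
Hypotheses (mA : measurable A) (muA : mu (~` A) = 0%E) (r0 : 0 < r)
  (Ar : A `<=` @cube R d r) (C0 : 0 <= C) (HC : second_difference_bound mu A C).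
Notation E f := (\int[mu]_(x in A) f x).

Lemma cubeW (s t : R) (u : U) : s <= t -> cube s u -> cube t u.
Proof. by move=> st su i; have /andP[? ?] := su i; apply/andP; split; lra. Qed.

Lemma finite_valued_sum (I : finType) (F : I -> R) (q : U -> I) x :
  F (q x) = \sum_j F j * \1_(q @^-1` [set j]) x.
Proof.
rewrite (bigD1 (q x))//= indicE mem_set// mulr1 big1 ?addr0// => j jx.
by rewrite indicE memNset ?mulr0//= => /esym/eqP; rewrite (negPf jx).
Qed.

Lemma measurable_finite_valued dT (T : measurableType dT) dV (V : measurableType dV)
    (I : Type) (F : I -> V) (q : T -> I) :
  (forall B, measurable (q @^-1` B)) -> measurable_fun setT (F \o q).
Proof. by move=> mq _ B mB; rewrite setTI comp_preimage; exact: mq. Qed.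

(** [X] is rounded to a finite grid and each grid point receives the [g]-mass of its preimage; the
    semi-discrete map onto these weights is [S]. The rounding error [e] later enters through
    [posterior_data_dist]. *)
Lemma kantorovich_exists (X : borel U -> borel U) (g : borel U -> R) e :
  measurable_fun setT X -> (forall x, A x -> cube r (X x : U)) ->
  bfun A g -> (forall x, 0 <= g x) -> E g = 1 -> 0 < e ->
  exists S phi psi X', [/\ kantorovich mu A r S phi psi X' g,
    measurable_fun setT (X' : borel U -> borel U), forall x, cube r (X' x : U)
    & forall x, A x -> norm1 ((X x : U) - X' x) <= e].
Proof.
move=> mX rX bg g0 Eg e0.
have [m [p [q [p_inj pr mq pq]]]] := @finite_grid R d r e r0 e0.
have mqX B : measurable ((q \o X) @^-1` B).
  by rewrite comp_preimage -[X in measurable X]setTI; exact: mX.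
pose w j := E (fun x => \1_((q \o X) @^-1` [set j]) x * g x).
have bI j : bfun A (\1_((q \o X) @^-1` [set j]) : borel U -> R) by exact: bfun_indic.
have w0 j : 0 <= w j by apply: Rintegral_ge0 => x _; rewrite mulr_ge0.
have wE (F : 'I_m.+1 -> R) : E (fun x => F (q (X x)) * g x) = \sum_j F j * w j.
  under [RHS]eq_bigr => j _ do rewrite -(@Rint_scale _ _ _ mu A mA _ _ (bfunM (bI j) bg)).
  rewrite -(@Rint_sum _ _ _ mu A mA); last first.
    by move=> j; apply: bfunM; [exact: bfun_cst|exact: bfunM].
  apply: eq_Rintegral => x _; rewrite (finite_valued_sum F (q \o X)) mulr_suml.
  by apply: eq_bigr => j _; rewrite mulrA.
have w1 : \sum_j w j = 1.
  rewrite -[RHS]Eg -[LHS](eq_bigr _ (fun j _ => mul1r (w j))) -(wE (fun=> 1)).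
  by apply: eq_Rintegral => x _; rewrite mul1r.
have [psid [jx [mjx jxP jxw]]] := semidiscrete_map mA muA r0 Ar C0 HC p_inj pr w0 w1.
pose phi := maxaff p psid.
have phi_lip : lipschitz1 r phi by exact: maxaff_lipschitz.
have phiE x : phi x = edot x (p (jx x)) - psid (jx x).
  by apply/eqP; rewrite eq_le maxaff_ge andbT; apply: maxaff_le => j; exact: jxP.
exists (p \o jx), phi, (conjugate r phi), (p \o q \o X); split.
- split.
  + exact: (measurable_finite_valued (V := borel U) p mjx).
  + by move=> x; exact: pr.
  + by [].
  + exact: maxaff_midconvex.
  + exact: conjugate_lipschitz.
  + by move=> x v rx _; have := conjugate_ge r0 phi_lip v rx; lra.
  (* One inequality holds because the conjugate at a support point is at most its dual weight
     [psid]; the other is the supremum evaluated at [x]. *)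
  + move=> x Ax; apply/eqP; rewrite eq_le; apply/andP; split.
      suff : conjugate r phi (p (jx x)) <= psid (jx x) by rewrite phiE /=; lra.
      apply: conjugate_le => // z _; have := maxaff_ge p psid z (jx x); rewrite /phi; lra.
    have rx : cube (r + 1) x by apply: cubeW (Ar Ax); lra.
    by have := conjugate_ge r0 phi_lip (p (jx x)) rx; rewrite /=; lra.
  + move=> K f fK; rewrite (wE (f \o p)).
    have bJ j : bfun A (\1_(jx @^-1` [set j]) : borel U -> R) by exact: bfun_indic.
    transitivity (E (fun x => \sum_j f (p j) * \1_(jx @^-1` [set j]) x)).
      by apply: eq_Rintegral => x _; exact: (finite_valued_sum (f \o p)).
    rewrite (@Rint_sum _ _ _ mu A mA); last first.
      by move=> j; apply: bfunM => //; exact: bfun_cst.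
    apply: eq_bigr => j _; rewrite (@Rint_scale _ _ _ mu A mA)//; congr (_ * _).
    by apply: EFin_inj; rewrite (Rint_indic _ mA)// jxw.
- exact: (measurable_finite_valued (V := borel U) p mqX).
- by move=> x; exact: pr.
- by move=> x Ax; apply: pq; exact: rX.
Qed.

(* Test the duality inequality at [x + t e_i] and [x - t e_i]: the discrepancy
   between [v] and [S x] is paid for by the duality gap and by the kink of [phi]. *)
Lemma kantorovich_pointwise S phi psi X g x v t :
  kantorovich mu A r S phi psi X g -> A x -> cube r v -> 0 < t -> t <= 1 ->
  t * norm1 (v - S x) <=
    d%:R * (phi x + psi v - edot x v) + \sum_(i < d) second_difference phi t i x.
Proof.
move=> k Ax rv t0 t1; rewrite /norm1 mulr_sumr.
rewrite (_ : d%:R * _ = \sum_(i < d) (phi x + psi v - edot x v)); last first.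
  by rewrite sumr_const card_ord mulr_natl.
rewrite -big_split/=; apply: ler_sum => i _.
have xr (h : R) : `|h| <= 1 -> cube (r + 1) (x + h *: delta_mx 0 i).
  move=> h1 j; rewrite add_deltaE; have /andP[? ?] := Ar Ax j.
  have /ler_normlP[? ?] : `|h * (j == i)%:R| <= 1.
    by case: (j == i); rewrite ?mulr1// mulr0 normr0.
  by apply/andP; split; lra.
have t1' : `|t| <= 1 by rewrite gtr0_norm.
have t1'' : `|- t| <= 1 by rewrite normrN.
have rS := kant_cube k x.
have H1 := kant_dual k (xr _ t1') rv; have H2 := kant_dual k (xr _ t1'') rS.
have H3 := kant_dual k (xr _ t1') rS; have H4 := kant_dual k (xr _ t1'') rv.
have H5 := kant_eq k Ax.
rewrite !edotDl !edotZl !edot_delta in H1 H2 H3 H4.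
rewrite /second_difference -scaleNr mxE [X in v 0 i + X]mxE.
have [h|h] := leP 0 (v 0 i - S x 0 i); first by rewrite ger0_norm//; lra.
by rewrite ltr0_norm//; lra.
Qed.

Lemma measurable_norm1 : measurable_fun setT (@norm1 R d : borel U -> R).
Proof.
apply: (@lipschitz1_measurable _ _ 1) => u v; rewrite mul1r ler_norml.
have := ler_norm1_dist u v 0; have := ler_norm1_dist v u 0.
by rewrite !subr0 (norm1B v u); lra.
Qed.

Lemma measurable_subU dT (T : measurableType dT) (f g : T -> borel U) :
  measurable_fun setT f -> measurable_fun setT g ->
  measurable_fun setT (fun x => (f x : U) - g x : borel U).
Proof.
move=> mf mg; apply: measurable_fun_rV => i.
apply: (eq_measurable_fun (fun x => (f x : U) 0 i - (g x : U) 0 i)).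
  by move=> x _; rewrite !mxE.
by apply: measurable_funB; apply: (measurableT_comp (@coord_measurable R d i)).
Qed.

Lemma measurable_edot dT (T : measurableType dT) (f g : T -> borel U) :
  measurable_fun setT f -> measurable_fun setT g ->
  measurable_fun setT (fun x => edot (f x : U) (g x)).
Proof.
move=> mf mg; apply: measurable_sum => i.
by apply: measurable_funM; apply: (measurableT_comp (@coord_measurable R d i)).
Qed.

Lemma bfun_dist dT (T : measurableType dT) (D : set T) (f g : T -> borel U) :
  measurable_fun setT f -> measurable_fun setT g ->
  (forall x, D x -> cube r (f x : U)) -> (forall x, D x -> cube r (g x : U)) ->
  bfun D (fun x => norm1 ((f x : U) - g x)).
Proof.
move=> mf mg rf rg; split.
  by apply: (measurableT_comp measurable_norm1); exact: measurable_subU.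
exists (d%:R * r + d%:R * r) => x Dx; rewrite ger0_norm ?norm1_ge0//.
apply: (le_trans (ler_norm1D _ _)); rewrite norm1N; apply: lerD; apply: ler_norm1_cube.
  exact: rf.
exact: rg.
Qed.

Lemma bfun_lipschitz_comp dT (T : measurableType dT) (D : set T) K (f : U -> R) (S : T -> borel U) :
  lipschitz1 K f -> measurable_fun setT S -> (forall x, D x -> cube r (S x : U)) ->
  bfun D (fun x => f (S x)).
Proof.
move=> fK mS rS; split; first exact: (measurableT_comp (lipschitz1_measurable fK)).
have [_ [M fM]] := @lipschitz1_bfun R d K r f (@cube R d r) (@subset_refl _ _) fK.
by exists M => x Dx; apply: fM; exact: rS.
Qed.

(* Bounds the difference of the integrals of a 1-Lipschitz function against the
   images under [X0], [X1] of the measures of densities [g0], [g1]. *)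
Definition data_dist (X0 : U -> U) (g0 : U -> R) X1 g1 : R :=
  E (fun x => norm1 (X0 x - X1 x) * g0 x) + d%:R * r * E (fun x => `|g0 x - g1 x|).

Lemma lipschitz1_data_dist K f (X0 X1 : borel U -> borel U) (g0 g1 : borel U -> R) :
  lipschitz1 K f -> 0 <= K -> measurable_fun setT X0 -> measurable_fun setT X1 ->
  (forall x, A x -> cube r (X0 x : U)) -> (forall x, A x -> cube r (X1 x : U)) ->
  bfun A g0 -> bfun A g1 -> (forall x, 0 <= g0 x) -> E g0 = E g1 ->
  E (fun x => f (X0 x) * g0 x) - E (fun x => f (X1 x) * g1 x) <= K * data_dist X0 g0 X1 g1.
Proof.
move=> fK K0 mX0 mX1 rX0 rX1 bg0 bg1 g00 Eg.
have bf X : measurable_fun setT (X : borel U -> borel U) -> (forall x, A x -> cube r (X x : U)) ->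
    bfun A (fun x => f (X x)).
  by move=> mX rX; exact: (bfun_lipschitz_comp fK).
have bf0 := bf _ mX0 rX0; have bf1 := bf _ mX1 rX1.
have bd := bfun_dist mX0 mX1 rX0 rX1.
have bg : bfun A (fun x => g0 x - g1 x) by exact: bfunB.
have bag := bfun_norm bg.
rewrite -(@Rint_sub _ _ _ mu A mA); [|exact: bfunM..].
rewrite /data_dist mulrDr mulrA -(@Rint_scale _ _ _ mu A mA); last exact: bfunM.
rewrite -(@Rint_scale _ _ _ mu A mA)//.
rewrite -(@Rint_add _ _ _ mu A mA); last 2 first.
- by apply: bfunM; [exact: bfun_cst|exact: bfunM].
- by apply: bfunM; [exact: bfun_cst|].
(* The masses agree, so [f 0 * (E g0 - E g1)] can be subtracted for free. The density difference is
   then multiplied by [f (X1 x) - f 0], which the Lipschitz bound controls on the cube. *)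
rewrite -[leLHS]subr0 -(mulr0 (f 0)) -[X in f 0 * X](subrr (E g1)) -[X in X - E g1]Eg.
rewrite -(@Rint_sub _ _ _ mu A mA)// -(@Rint_scale _ _ _ mu A mA)// -(@Rint_sub _ _ _ mu A mA); last 2 first.
- by apply: bfunB; exact: bfunM.
- by apply: bfunM; [exact: bfun_cst|].
apply: (@Rint_le _ _ _ mu A mA).
- apply: bfunB; first by apply: bfunB; exact: bfunM.
  by apply: bfunM; [exact: bfun_cst|].
- by apply: bfunD; (apply: bfunM; [exact: bfun_cst|]) => //; exact: bfunM.
move=> x Ax.
rewrite (_ : _ - _ = (f (X0 x) - f (X1 x)) * g0 x + (f (X1 x) - f 0) * (g0 x - g1 x)); last by ring.
apply: lerD.
  rewrite mulrA; apply: ler_wpM2r => //; have /ler_normlP[_] := fK (X0 x) (X1 x); exact.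
apply: (le_trans (ler_norm _)); rewrite normrM; apply: ler_wpM2r => //.
apply: (le_trans (fK _ _)); apply: ler_wpM2l => //; rewrite subr0.
by apply: ler_norm1_cube; exact: rX1.
Qed.

(* In the sum of the two inequalities of [kantorovich_pointwise] at [v = S1 x]
   and [v = S0 x], the duality gaps integrate to differences of integrals of the
   Lipschitz potentials against the two target measures. *)
Lemma kantorovich_stability S0 phi0 psi0 X0 g0 S1 phi1 psi1 X1 g1 t :
  kantorovich mu A r S0 phi0 psi0 X0 g0 -> kantorovich mu A r S1 phi1 psi1 X1 g1 ->
  measurable_fun setT (X0 : borel U -> borel U) -> measurable_fun setT (X1 : borel U -> borel U) ->
  (forall x, A x -> cube r (X0 x : U)) -> (forall x, A x -> cube r (X1 x : U)) ->
  bfun A (g0 : borel U -> R) -> bfun A (g1 : borel U -> R) ->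
  (forall x, 0 <= g0 x) -> (forall x, 0 <= g1 x) -> E g0 = E g1 -> 0 < t -> t <= 1 ->
  t * E (fun x => norm1 (S0 x - S1 x)) <=
    d%:R * ((r + 1) * (data_dist X0 g0 X1 g1 + data_dist X1 g1 X0 g0) + C * r * t ^+ 2).
Proof.
move=> k0 k1 mX0 mX1 rX0 rX1 bg0 bg1 g00 g10 Eg t0 t1.
have r10 : 0 <= r + 1 by have := r0; lra.
have := lipschitz1_data_dist (kant_psi_lip k1) r10 mX0 mX1 rX0 rX1 bg0 bg1 g00 Eg.
have := lipschitz1_data_dist (kant_psi_lip k0) r10 mX1 mX0 rX1 rX0 bg1 bg0 g10 (esym Eg).
rewrite -(kant_push k0 (kant_psi_lip k0)) -(kant_push k0 (kant_psi_lip k1)).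
rewrite -(kant_push k1 (kant_psi_lip k0)) -(kant_push k1 (kant_psi_lip k1)).
have mS0 := kant_measurable k0; have mS1 := kant_measurable k1.
have rS0 x : A x -> cube r (S0 x) by move=> _; exact: kant_cube k0 x.
have rS1 x : A x -> cube r (S1 x) by move=> _; exact: kant_cube k1 x.
have b00 := bfun_lipschitz_comp (kant_psi_lip k0) mS0 rS0.
have b01 := bfun_lipschitz_comp (kant_psi_lip k0) mS1 rS1.
have b10 := bfun_lipschitz_comp (kant_psi_lip k1) mS0 rS0.
have b11 := bfun_lipschitz_comp (kant_psi_lip k1) mS1 rS1.
have bD := bfun_dist mS0 mS1 rS0 rS1.
have bs i := second_difference_bfun t i Ar (kant_phi_lip k1).
(* The gap of [S1 x] for the potentials of [S0] is nonnegative and is added to the gap of [S0 x] for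
   those of [S1]. By the two equalities [kant_eq] the terms in [phi0], [phi1] and [edot] cancel, and
   only [psi0] and [psi1] remain. *)
pose G x := d%:R * ((psi1 (S0 x) - psi1 (S1 x)) + (psi0 (S1 x) - psi0 (S0 x))).
have bG : bfun A (G : borel U -> R).
  by apply: bfunM; [exact: bfun_cst|apply: bfunD; exact: bfunB].
have : t * E (fun x => norm1 (S0 x - S1 x)) <=
    E (fun x => G x + \sum_(i < d) second_difference phi1 t i x).
  rewrite -(@Rint_scale _ _ _ mu A mA)//; apply: (@Rint_le _ _ _ mu A mA).
  - by apply: bfunM => //; exact: bfun_cst.
  - by apply: bfunD => //; exact: bfun_sum.
  move=> x Ax; apply: (le_trans (kantorovich_pointwise k1 Ax (rS0 _ Ax) t0 t1)).
  rewrite lerD2r; apply: ler_wpM2l => //.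
  have xr : cube (r + 1) x by apply: cubeW (Ar Ax); lra.
  have := kant_dual k0 xr (rS1 _ Ax); have := kant_eq k0 Ax; have := kant_eq k1 Ax.
  lra.
rewrite (@Rint_add _ _ _ mu A mA)//; last exact: bfun_sum.
rewrite (@Rint_scale _ _ _ mu A mA); last by apply: bfunD; exact: bfunB.
rewrite (@Rint_add _ _ _ mu A mA); [|exact: bfunB..].
rewrite !(@Rint_sub _ _ _ mu A mA)//.
have : E (fun x => \sum_(i < d) second_difference phi1 t i x) <= d%:R * (C * r * t ^+ 2).
  rewrite (@Rint_sum _ _ _ mu A mA)//.
  apply: (@le_trans _ _ (\sum_(i < d) C * r * t ^+ 2)); last by rewrite sumr_const card_ord mulr_natl.
  by apply: ler_sum => i _; exact: (HC _ (kant_phi_lip k1) (kant_phi_conv k1)).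
have d0 : (0 : R) <= d%:R by [].
move=> h1 h2 h3 h4; apply: (le_trans h2); rewrite [leRHS]mulrDr; apply: lerD; last exact: h1.
by apply: ler_wpM2l => //; lra.
Qed.

End KantorovichStability.

(** * Optimal maps onto the discretised posteriors *)

Section Approximants.
Context {R : realType} (d : nat) (Y : normedModType R).
Local Notation U := ('rV[R]_d).
Variables (mu : probability (borel U) R) (A : set (borel U)) (r C : R).
Hypotheses (mA : measurable A) (muA : mu (~` A) = 0%E) (r0 : 0 < r)
  (Ar : A `<=` @cube R d r) (C0 : 0 <= C) (HC : second_difference_bound mu A C).
Variables (Phi : U -> Y -> R) (K L : R).
Hypotheses (Phi_gt0 : forall u y, 0 < Phi u y) (Phi_le : forall u y, Phi u y <= K)
  (L0 : 0 <= L) (PhiL1 : forall u u' y, `|Phi u y - Phi u' y| <= L * enorm (u - u'))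
  (PhiL2 : forall u y y', `|Phi u y - Phi u y'| <= L * `|y - y'|).
Notation E f := (\int[mu]_(x in A) f x).

Lemma enorm_ge0 (u : U) : 0 <= enorm u. Proof. exact: sqrtr_ge0. Qed.

Lemma enorm_sq (u : U) : enorm u ^+ 2 = edot u u.
Proof. by rewrite sqr_sqrtr// sumr_ge0// => i _; rewrite -expr2 sqr_ge0. Qed.

Lemma enorm_le_norm1 (u : U) : enorm u <= norm1 u.
Proof.
rewrite -(ler_pXn2r (ltn0Sn 1)) ?nnegrE ?enorm_ge0 ?norm1_ge0// enorm_sq expr2.
rewrite {1}/norm1 mulr_suml; apply: ler_sum => i _.
rewrite -expr2 -real_normK ?num_real// expr2; apply: ler_wpM2l => //.
by rewrite /norm1 (bigD1 i)//= lerDl sumr_ge0.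
Qed.

Lemma expRN_lipschitz (a b : R) : 0 <= a -> 0 <= b -> `|expR (- a) - expR (- b)| <= `|a - b|.
Proof.
wlog ab : a b / a <= b.
  move=> H a0 b0; have [|/ltW] := leP a b; first by move=> ?; exact: H.
  by move=> ba; rewrite distrC [leRHS]distrC; exact: H.
move=> a0 b0; rewrite ger0_norm ?subr_ge0 ?ler_expR; last by lra.
rewrite distrC ger0_norm ?subr_ge0//.
have -> : - b = - a + (a - b) by ring.
rewrite expRD -[X in X - _]mulr1 -mulrBr.
have h1 := expR_ge1Dx (a - b).
apply: (@le_trans _ _ (1 * (b - a))); last by rewrite mul1r.
apply: ler_pM.
- exact: expR_ge0.
- by rewrite subr_ge0 -expR0 ler_expR; lra.
- by rewrite -expR0 ler_expR; lra.
- by lra.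
Qed.

(** The difference splits as [(a - b) / z + b * (z' - z) / (z * z')]; two inverse normalisations in
    the last term give [c * c]. *)
Lemma ratio_dist (a b z z' c D : R) : 0 <= b <= 1 -> 0 < z -> 0 < z' ->
  z^-1 <= c -> z'^-1 <= c -> `|z' - z| <= D ->
  `|a / z - b / z'| <= c * `|a - b| + c * c * D.
Proof.
move=> /andP[b0 b1] z0 z0' zc zc' zD.
have i0 : 0 <= z^-1 by rewrite invr_ge0 ltW.
have i0' : 0 <= z'^-1 by rewrite invr_ge0 ltW.
have -> : a / z - b / z' = (a - b) * z^-1 + z^-1 * z'^-1 * (b * (z' - z)).
  rewrite (_ : z^-1 * z'^-1 * _ = b * (z^-1 * (z'^-1 * z') - z'^-1 * (z^-1 * z))); last by ring.
  by rewrite !mulVf ?gt_eqF//; ring.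
apply: (le_trans (ler_normD _ _)); apply: lerD.
  by rewrite normrM mulrC (ger0_norm i0); exact: ler_wpM2r.
rewrite normrM ger0_norm ?mulr_ge0//; apply: ler_pM; rewrite ?mulr_ge0//.
  exact: ler_pM.
rewrite normrM (ger0_norm b0); apply: (le_trans _ zD).
by rewrite ler_piMl.
Qed.

Definition likelihood (P : U -> U) y x := expR (- Phi (P x) y).

(** A density with respect to [mu] and not to the image prior: the posterior for the prior [P # mu]
    is its image under [P]. All posteriors thus share the source [mu]. *)
Definition posterior_density (P : U -> U) y x := likelihood P y x / E (likelihood P y).

(** Covers both the identity, for the full posterior, and the orthogonal projections. *)
Definition admissible (P : U -> U) :=
  measurable_fun setT (P : borel U -> borel U) /\ forall x, A x -> cube r (P x).

Lemma Phi_lipschitz1 y : lipschitz1 L (Phi^~ y).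
Proof.
by move=> u v; apply: (le_trans (PhiL1 _ _ _)); apply: ler_wpM2l => //; exact: enorm_le_norm1.
Qed.

Lemma likelihood_le1 P y x : likelihood P y x <= 1.
Proof. by rewrite -expR0 ler_expR; have := Phi_gt0 (P x) y; lra. Qed.

Lemma likelihood_ge P y x : expR (- K) <= likelihood P y x.
Proof. by rewrite ler_expR; have := Phi_le (P x) y; lra. Qed.

Lemma likelihood_bfun P y : measurable_fun setT (P : borel U -> borel U) ->
  bfun A (likelihood P y : borel U -> R).
Proof.
move=> mP; split.
  apply: measurableT_comp => //; apply: measurable_funN.
  exact: (measurableT_comp (lipschitz1_measurable (Phi_lipschitz1 y)) mP).
exists 1 => x _; rewrite ger0_norm ?expR_ge0//; exact: likelihood_le1.
Qed.

Lemma evidence_bounds P y : measurable_fun setT (P : borel U -> borel U) ->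
  [/\ expR (- K) <= E (likelihood P y), E (likelihood P y) <= 1 & 0 < E (likelihood P y)].
Proof.
move=> mP; have b := likelihood_bfun y mP.
have h : expR (- K) <= E (likelihood P y).
  rewrite -[leLHS](Rint_cst mA muA); apply: (@Rint_le _ _ _ mu A mA) => //; first exact: bfun_cst.
  by move=> x _; exact: likelihood_ge.
split=> //; last exact: lt_le_trans (expR_gt0 _) h.
rewrite -[leRHS](Rint_cst mA muA); apply: (@Rint_le _ _ _ mu A mA) => //; first exact: bfun_cst.
by move=> x _; exact: likelihood_le1.
Qed.

Lemma posterior_density_bfun P y : measurable_fun setT (P : borel U -> borel U) ->
  bfun A (posterior_density P y : borel U -> R).
Proof. by move=> mP; apply: bfunM; [exact: likelihood_bfun|exact: bfun_cst]. Qed.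

Lemma posterior_density_ge0 P y x : measurable_fun setT (P : borel U -> borel U) ->
  0 <= posterior_density P y x.
Proof. by move=> mP; have [_ _ h] := evidence_bounds y mP; rewrite mulr_ge0 ?expR_ge0// invr_ge0 ltW. Qed.

Lemma evidence_inv_le P y : measurable_fun setT (P : borel U -> borel U) ->
  (E (likelihood P y))^-1 <= expR K.
Proof.
move=> mP; have [h _ h0] := evidence_bounds y mP.
by rewrite -[K]opprK expRN lef_pV2 ?posrE ?expR_gt0.
Qed.

Lemma posterior_density_le P y x : measurable_fun setT (P : borel U -> borel U) ->
  posterior_density P y x <= expR K.
Proof.
move=> mP; have [_ _ h0] := evidence_bounds y mP.
rewrite -[leRHS]mul1r; apply: ler_pM; rewrite ?expR_ge0 ?invr_ge0 ?(ltW h0)//.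
  exact: likelihood_le1.
exact: evidence_inv_le.
Qed.

Lemma posterior_density_int P y : measurable_fun setT (P : borel U -> borel U) ->
  E (posterior_density P y) = 1.
Proof.
move=> mP; have [_ _ h0] := evidence_bounds y mP.
transitivity (E (fun x => (E (likelihood P y))^-1 * likelihood P y x)).
  by apply: eq_Rintegral => x _; rewrite mulrC.
rewrite (@Rint_scale _ _ _ mu A mA); last exact: likelihood_bfun.
by rewrite mulVf// gt_eqF.
Qed.

Definition proj_dist (P P' : U -> U) := E (fun x => norm1 (P x - P' x)).

Lemma likelihood_dist P P' y y' : admissible P -> admissible P' ->
  E (fun x => `|likelihood P y x - likelihood P' y' x|) <=
    L * (proj_dist P P' + `|y - y'|).
Proof.
move=> [mP rP] [mP' rP'].
have bd := bfun_dist mP mP' rP rP'.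
have b1 := likelihood_bfun y mP; have b2 := likelihood_bfun y' mP'.
have -> : L * (proj_dist P P' + `|y - y'|) =
    E (fun x => L * (norm1 (P x - P' x) + `|y - y'|)).
  rewrite (@Rint_scale _ _ _ mu A mA); last by apply: bfunD => //; exact: bfun_cst.
  by rewrite (@Rint_add _ _ _ mu A mA) ?(Rint_cst mA muA)//; exact: bfun_cst.
apply: (@Rint_le _ _ _ mu A mA).
- by apply: bfun_norm; exact: bfunB.
- by apply: bfunM; [exact: bfun_cst|apply: bfunD => //; exact: bfun_cst].
move=> x _; apply: (le_trans (expRN_lipschitz (ltW (Phi_gt0 _ _)) (ltW (Phi_gt0 _ _)))).
have := Phi_lipschitz1 y (P x) (P' x) => /= h1; have h2 := PhiL2 (P' x) y y'.
have -> : Phi (P x) y - Phi (P' x) y' =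
  (Phi (P x) y - Phi (P' x) y) + (Phi (P' x) y - Phi (P' x) y') by ring.
by apply: (le_trans (ler_normD _ _)); rewrite mulrDr; apply: lerD.
Qed.

Lemma posterior_density_dist P P' y y' : admissible P -> admissible P' ->
  E (fun x => `|posterior_density P y x - posterior_density P' y' x|) <=
    (expR K + expR K * expR K) * L * (proj_dist P P' + `|y - y'|).
Proof.
move=> aP aP'; have D := likelihood_dist y y' aP aP'.
have [mP _] := aP; have [mP' _] := aP'.
have b1 := likelihood_bfun y mP; have b2 := likelihood_bfun y' mP'.
have bn : bfun A (fun x : borel U => `|likelihood P y x - likelihood P' y' x|).
  by apply: bfun_norm; exact: bfunB.
pose D0 := E (fun x => `|likelihood P y x - likelihood P' y' x|).
rewrite -/D0 in D.
have DZ : `|E (likelihood P' y') - E (likelihood P y)| <= D0.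
  rewrite distrC -(@Rint_sub _ _ _ mu A mA)//.
  by apply: (@Rint_norm _ _ _ mu A mA); exact: bfunB.
apply: (@le_trans _ _ ((expR K + expR K * expR K) * D0)); last first.
  by rewrite -mulrA; apply: ler_wpM2l => //; rewrite addr_ge0 ?mulr_ge0 ?expR_ge0.
rewrite mulrDl -(@Rint_scale _ _ _ mu A mA)// -[X in _ + X](Rint_cst mA muA).
rewrite -(@Rint_add _ _ _ mu A mA); last 2 first.
- by apply: bfunM => //; exact: bfun_cst.
- exact: bfun_cst.
apply: (@Rint_le _ _ _ mu A mA).
- by apply: bfun_norm; apply: bfunB; exact: posterior_density_bfun.
- by apply: bfunD; [apply: bfunM => //|]; exact: bfun_cst.
move=> x _; rewrite /posterior_density.
have [_ _ z0] := evidence_bounds y mP; have [_ _ z0'] := evidence_bounds y' mP'.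
have zi := evidence_inv_le y mP; have zi' := evidence_inv_le y' mP'.
have b01 : 0 <= likelihood P' y' x <= 1 by rewrite expR_ge0 likelihood_le1.
exact: (ratio_dist _ b01 z0 z0' zi zi' DZ).
Qed.

Definition approximant (P : U -> U) y e (S : U -> U) (phi psi : U -> R) : Prop :=
  exists X', [/\ kantorovich mu A r S phi psi X' (posterior_density P y),
    measurable_fun setT (X' : borel U -> borel U), forall x, cube r (X' x)
    & forall x, A x -> norm1 (P x - X' x) <= e].

Lemma approximant_exists P y e : admissible P -> 0 < e ->
  exists S phi psi, approximant P y e S phi psi.
Proof.
move=> [mP rP] e0.
have [S [phi [psi [X' [k mX' rX' PX']]]]] := kantorovich_exists mA muA r0 Ar C0 HC mP rP
  (posterior_density_bfun y mP) (fun x => posterior_density_ge0 y x mP)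
  (posterior_density_int y mP) e0.
by exists S, phi, psi, X'.
Qed.

Let radius_ge0 (X X' : U -> U) e : (forall x, A x -> norm1 (X x - X' x) <= e) -> 0 <= e.
Proof.
have [x Ax] : exists x, A x.
  apply: contrapT => /forallNP nA; have := probability_full mA muA.
  rewrite (_ : A = set0) ?measure0; last by apply/seteqP; split=> // x /nA.
  by move=> /eqP; rewrite eq_sym onee_eq0.
by move=> /(_ _ Ax); apply: le_trans; exact: norm1_ge0.
Qed.

(** The displacement is bounded by the triangle inequality through [P x] and [P' x], with weight at
    most [expR K]; the change of density contributes [posterior_density_dist] times the l1 radius
    [d * r]. *)
Lemma posterior_data_dist P P' y y' e e' X X' :
  admissible P -> admissible P' ->
  measurable_fun setT (X : borel U -> borel U) ->
  measurable_fun setT (X' : borel U -> borel U) ->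
  (forall x, A x -> cube r (X x)) -> (forall x, A x -> cube r (X' x)) ->
  (forall x, A x -> norm1 (P x - X x) <= e) -> (forall x, A x -> norm1 (P' x - X' x) <= e') ->
  data_dist mu A r X (posterior_density P y) X' (posterior_density P' y') <=
  (expR K + d%:R * r * ((expR K + expR K * expR K) * L)) *
    (proj_dist P P' + `|y - y'| + e + e').
Proof.
move=> aP aP' mX mX' rX rX' PX PX'.
have [mP rP] := aP; have [mP' rP'] := aP'.
have bd := bfun_dist mP mP' rP rP'.
have bX := bfun_dist mX mX' rX rX'.
have bg := posterior_density_bfun y mP.
have dd := posterior_density_dist y y' aP aP'.
have dr : 0 <= d%:R * r by rewrite mulr_ge0// ltW.
have pd0 : 0 <= proj_dist P P' by apply: Rintegral_ge0 => x _; exact: norm1_ge0.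
have ee : 0 <= e + e' by rewrite addr_ge0// (radius_ge0 PX, radius_ge0 PX').
rewrite /data_dist [leRHS]mulrDl; apply: lerD; last first.
  rewrite -[leRHS]mulrA; apply: ler_wpM2l => //; apply: (le_trans dd).
  rewrite -addrA; apply: ler_wpM2l; last by rewrite lerDl.
  by rewrite mulr_ge0// addr_ge0// ?mulr_ge0// expR_ge0.
apply: (@le_trans _ _ (expR K * (proj_dist P P' + e + e'))); last first.
  by apply: ler_wpM2l; rewrite ?expR_ge0// !lerD2r lerDl.
have bc : bfun A (fun x : borel U => norm1 (P x - P' x) + e + e').
  by do 2 (apply: bfunD; last exact: bfun_cst).
have -> : expR K * (proj_dist P P' + e + e') = E (fun x => expR K * (norm1 (P x - P' x) + e + e')).
  rewrite (@Rint_scale _ _ _ mu A mA)// !(@Rint_add _ _ _ mu A mA) ?(Rint_cst mA muA)//; try exact: bfun_cst.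
  by apply: bfunD => //; exact: bfun_cst.
apply: (@Rint_le _ _ _ mu A mA).
- exact: bfunM.
- by apply: bfunM => //; exact: bfun_cst.
move=> x Ax; rewrite mulrC; apply: ler_pM.
- exact: posterior_density_ge0.
- exact: norm1_ge0.
- exact: posterior_density_le.
have := ler_norm1_dist (X x) (P x) (X' x); have := ler_norm1_dist (P x) (P' x) (X' x).
by have := PX _ Ax; have := PX' _ Ax; rewrite (norm1B (P x) (X x)); lra.
Qed.

(** The factor [d] sums over directions, [r + 1] is the Lipschitz constant of [psi], 2 accounts for
    [data_dist] in both orders, the next factor comes from [posterior_data_dist], and [C * r] bounds
    the kinks of the [r]-Lipschitz [phi]. *)
Definition stability_constant : R :=
  d%:R * (2 * (r + 1) * (expR K + d%:R * r * ((expR K + expR K * expR K) * L)) + C * r).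

Lemma stability_constant_ge0 : 0 <= stability_constant.
Proof.
have r0' := ltW r0; have e0 := expR_ge0 K; have r1 : 0 <= r + 1 by rewrite addr_ge0.
apply: mulr_ge0 => //; apply: addr_ge0; last exact: mulr_ge0.
apply: mulr_ge0; first exact: mulr_ge0.
by apply: addr_ge0 => //; rewrite !mulr_ge0// addr_ge0// mulr_ge0.
Qed.

Let stability_arith (q c a s D1 D2 t : R) : 0 <= q -> 0 <= c -> 0 <= a ->
  D1 <= a * s -> D2 <= a * s -> 0 <= s ->
  (q + 1) * (D1 + D2) + c * q * t ^+ 2 <= (2 * (q + 1) * a + c * q) * (s + t ^+ 2).
Proof.
move=> q0 c0 a0 h1 h2 s0; have t20 := sqr_ge0 t.
have q1 : (q + 1) * (D1 + D2) <= (q + 1) * (a * s + a * s).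
  by apply: ler_wpM2l; [rewrite addr_ge0|apply: lerD].
have q0' : 0 <= q + 1 by rewrite addr_ge0.
have q2 : 0 <= (q + 1) * a * t ^+ 2 by apply: mulr_ge0 => //; exact: mulr_ge0.
have q3 : 0 <= c * q * s by rewrite !mulr_ge0.
lra.
Qed.

Lemma approximant_stability P P' y y' e e' S S' phi phi' psi psi' t :
  admissible P -> admissible P' ->
  approximant P y e S phi psi -> approximant P' y' e' S' phi' psi' -> 0 < t -> t <= 1 ->
  t * E (fun x => norm1 (S x - S' x)) <=
    stability_constant * (proj_dist P P' + `|y - y'| + e + e' + t ^+ 2).
Proof.
move=> aP aP' [X [k mX rX PX]] [X' [k' mX' rX' PX']] t0 t1.
have [mP _] := aP; have [mP' _] := aP'.
have := kantorovich_stability mA r0 Ar HC k k' mX mX' (fun x (_ : A x) => rX x) (fun x (_ : A x) => rX' x)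
  (posterior_density_bfun y mP) (posterior_density_bfun y' mP')
  (fun x => posterior_density_ge0 y x mP) (fun x => posterior_density_ge0 y' x mP') _ t0 t1.
move=> /(_ (etrans (posterior_density_int y mP) (esym (posterior_density_int y' mP')))) H.
apply: (le_trans H); rewrite /stability_constant -[leRHS]mulrA; apply: ler_wpM2l => //.
have rXA x : A x -> cube r (X x) by [].
have rXA' x : A x -> cube r (X' x) by [].
have h1 := posterior_data_dist y y' aP aP' mX mX' rXA rXA' PX PX'.
have h2 := posterior_data_dist y' y aP' aP mX' mX rXA' rXA PX' PX.
have pdC : proj_dist P' P = proj_dist P P' by apply: eq_Rintegral => x _; exact: norm1B.
rewrite pdC (distrC y' y) in h2.
rewrite -!addrA (addrC e' e) !addrA in h2.
have s0 : 0 <= proj_dist P P' by apply: Rintegral_ge0 => x _; exact: norm1_ge0.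
have e0 := radius_ge0 PX; have e0' := radius_ge0 PX'.
have K0 := expR_ge0 K; have r0' := ltW r0; have y0 := normr_ge0 (y - y').
have : 0 <= expR K + d%:R * r * ((expR K + expR K * expR K) * L).
  by apply: addr_ge0 => //; rewrite !mulr_ge0// addr_ge0// mulr_ge0.
move=> a0; have q := stability_arith t r0' C0 a0 h1 h2; apply: q.
by rewrite !addr_ge0.
Qed.

End Approximants.

(** * Limits of rapidly converging sequences of maps *)

Section FastCauchy.
Context {R : realType}.

Lemma cvg_half_pow (c : R) : c * 2^-1 ^+ n @[n --> \oo] --> (0 : R).
Proof.
rewrite -[X in _ --> X](mulr0 c); apply: cvgM; first exact: cvg_cst.
by apply: cvg_expr; rewrite gtr0_norm ?invf_lt1 ?invr_gt0// ltr1n.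
Qed.

Lemma cvg_bigsum (I : Type) (s : seq I) (f : nat -> I -> R) (l : I -> R) :
  (forall i, f n i @[n --> \oo] --> l i) ->
  \sum_(i <- s) f n i @[n --> \oo] --> \sum_(i <- s) l i.
Proof.
move=> fl; elim: s => [|i s IH].
  by rewrite big_nil; under eq_cvg do rewrite big_nil; exact: cvg_cst.
by rewrite big_cons; under eq_cvg do rewrite big_cons; exact: cvgD.
Qed.

Lemma le_half_pow (a b c : R) : (forall n, a <= b + c * 2^-1 ^+ n) -> a <= b.
Proof.
move=> H; have h : b + c * 2^-1 ^+ n @[n --> \oo] --> b.
  rewrite -[X in _ --> X]addr0; apply: cvgD; first exact: cvg_cst.
  exact: cvg_half_pow.
by rewrite -(cvg_lim (@Rhausdorff R) h); apply: limr_ge; [exact: (cvgP _ h)|exact: nearW].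
Qed.

Lemma half_pow_gt0 n : 0 < (2^-1 : R) ^+ n. Proof. by rewrite exprn_gt0// invr_gt0. Qed.

Lemma half_pow_le1 n : (2^-1 : R) ^+ n <= 1.
Proof. by rewrite exprn_ile1 ?invr_ge0// invf_le1 ?ler1n. Qed.

Lemma half_pow_homo m n : (m <= n)%N -> (2^-1 : R) ^+ n <= 2^-1 ^+ m.
Proof. by move=> mn; rewrite ler_wiXn2l ?invr_ge0 ?invf_le1 ?ler1n. Qed.

Context (d : nat).
Local Notation U := ('rV[R]_d).

(** The upper limit exists at every point for bounded sequences and is measurable, and truncation
    keeps it in the cube. Where the coordinates converge in the cube it is the limit. *)
Definition limrow (r : R) (v : nat -> U) : U :=
  \row_i Num.max (- r) (Num.min r (limn_sup (fun n => v n 0 i))).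

Lemma limrow_cube r v : 0 <= r -> cube r (limrow r v).
Proof. by move=> r0 i; rewrite mxE le_max lexx/= ge_max ge_min lexx/= andbT; lra. Qed.

Lemma limrow_measurable dT (T : measurableType dT) r (u : nat -> T -> borel U) :
  (forall n, measurable_fun setT (u n)) -> (forall n x, cube r (u n x : U)) ->
  measurable_fun setT (fun x => limrow r (fun n => u n x) : borel U).
Proof.
move=> mu ru; apply: measurable_fun_rV => i.
apply: (eq_measurable_fun (fun x => Num.max (- r) (Num.min r (limn_sup (fun n => (u n x : U) 0 i))))).
  by move=> x _; rewrite mxE.
apply: measurable_maxr => //; apply: measurable_minr => //.
apply: measurable_fun_limn_sup.
- by move=> x _; exists r => _ [n _ <-]; have /andP[] := ru n x i.
- by move=> x _; exists (- r) => _ [n _ <-]; have /andP[] := ru n x i.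
- by move=> n; apply: (measurableT_comp (@coord_measurable R d i)).
Qed.

Lemma limrow_cvg r (v : nat -> U) i : (forall n, cube r (v n)) ->
  cvgn (fun n => v n 0 i) -> v n 0 i @[n --> \oo] --> limrow r v 0 i.
Proof.
move=> rv cv; rewrite mxE (cvg_limn_supE cv).
have h1 : limn (fun n => v n 0 i) <= r by apply: limr_le => //; apply: nearW => n; have /andP[] := rv n i.
have h2 : - r <= limn (fun n => v n 0 i) by apply: limr_ge => //; apply: nearW => n; have /andP[] := rv n i.
by rewrite min_r// max_r.
Qed.

Variables (dT : measure_display) (T : measurableType dT) (P : probability T R) (D : set T).
Hypotheses (mD : measurable D).

(** Summable [L^1] distances make the series of distances integrable, so the sequence itself
    converges almost everywhere, and dominated convergence gives the [L^1] limit. No subsequence is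
    extracted, so one formula for the limit serves all data at once, as joint measurability
    requires. *)
Lemma fast_cauchy_limit r c (u : nat -> T -> borel U) : 0 <= r -> 0 <= c ->
  (forall n, measurable_fun setT (u n)) -> (forall n x, cube r (u n x : U)) ->
  (forall n m, (n <= m)%N ->
     \int[P]_(x in D) norm1 ((u n x : U) - u m x) <= c * 2^-1 ^+ n) ->
  forall n, \int[P]_(x in D) norm1 ((u n x : U) - limrow r (fun n => u n x)) <= c * 2^-1 ^+ n.
Proof.
move=> r0 c0 mu ru uc.
pose S x := limrow r (fun n => u n x).
have mS : measurable_fun setT (S : T -> borel U) by exact: limrow_measurable.
have rS x : cube r (S x) by exact: limrow_cube.
pose F n x : R := norm1 ((u n x : U) - u n.+1 x).
have bF n : bfun D (F n) by apply: (@bfun_dist _ _ r).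
pose G n x : R := norm1 ((u n x : U) - S x).
have bG n : bfun D (G n) by apply: (@bfun_dist _ _ r).
have mF n : measurable_fun D (fun x => (F n x)%:E).
  by apply/measurable_EFinP/measurable_funTS; case: (bF n).
have F0 n x : 0 <= F n x by exact: norm1_ge0.
have sF_lty : (\int[P]_(x in D) \sum_(0 <= n <oo) (F n x)%:E < +oo)%E.
  rewrite integral_nneseries//; last by move=> n x _; rewrite lee_fin.
  apply: (@le_lt_trans _ _ (2 * c)%:E); last exact: ltry.
  apply: lime_le.
    by apply: is_cvg_nneseries => n _ _; apply: integral_ge0 => x _; rewrite lee_fin.
  apply: nearW => n.
  apply: (@le_trans _ _ (\sum_(0 <= k < n) (c * 2^-1 ^+ k))%:E).
    rewrite -sumEFin; apply: lee_sum => k _.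
    by rewrite (integral_bfun P mD (bF k)) lee_fin; exact: uc.
  rewrite lee_fin -mulr_sumr mulrC; apply: ler_wpM2r => //.
  suff -> : \sum_(0 <= k < n) (2^-1 : R) ^+ k = 2 - 2 * 2^-1 ^+ n.
    by have := half_pow_gt0 n; lra.
  elim: n => [|n IH]; first by rewrite big_nil expr0; ring.
  by rewrite big_nat_recr//= IH exprS; field.
have isF : P.-integrable D (fun x => (\sum_(0 <= n <oo) (F n x)%:E)%E).
  apply/integrableP; split.
    by apply: ge0_emeasurable_sum => // n x _ _; rewrite lee_fin.
  rewrite (eq_integral (fun x => \sum_(0 <= n <oo) (F n x)%:E)%E); first exact: sF_lty.
  move=> x _.
  by rewrite gee0_abs//; apply: nneseries_ge0 => n _ _; rewrite lee_fin.
have ae_cvg : {ae P, forall x, D x -> G ^~ x @ \oo --> (0 : R)}.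
  have := integrable_ae mD isF; apply: filterS => x /[apply] fin.
  have cF : cvgn (series (F^~ x)).
    apply: nondecreasing_is_cvgn.
      by apply: nondecreasing_series => n _ _; exact: F0.
    exists (fine (\sum_(0 <= n <oo) (F n x)%:E)%E) => _ [n _ <-].
    rewrite -lee_fin fineK// /series/= -sumEFin.
    by apply: nneseries_lim_ge => k _ _; rewrite lee_fin.
  have cu i : u n x 0 i @[n --> \oo] --> S x 0 i.
    apply: (@limrow_cvg r (fun n => u n x) i) => //.
    pose w n := (u n.+1 x : U) 0 i - (u n x : U) 0 i.
    have : cvgn (series w).
      apply: normed_cvg; apply: (series_le_cvg _ _ _ cF) => n; [exact: normr_ge0|exact: F0|].
      rewrite /= distrC /F /norm1 (bigD1 i)//= !mxE lerDl; exact: sumr_ge0.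
    move=> cw; rewrite (_ : (fun n => _) = (fun n => (u 0%N x : U) 0 i + series w n)).
      by apply: is_cvgD => //; exact: is_cvg_cst.
    by apply/funext => n; rewrite /series/= telescope_sumr// addrC subrK.
  rewrite (_ : G^~ x = fun n => \sum_i `|(u n x : U) 0 i - S x 0 i|); last first.
    by apply/funext => n; apply: eq_bigr => i _; rewrite !mxE.
  rewrite [X in _ --> X](_ : (0 : R) = \sum_(i < d) `|S x 0 i - S x 0 i|); last first.
    by rewrite big1// => i _; rewrite subrr normr0.
  apply: (@cvg_bigsum _ _ (fun n i => `|(u n x : U) 0 i - S x 0 i|) (fun i => `|S x 0 i - S x 0 i|)) => i.
  apply: cvg_norm; apply: cvgB => //; exact: cvg_cst.
have [K GK] : exists K, forall n x, D x -> `|G n x| <= K.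
  exists (d%:R * r + d%:R * r) => n x _; rewrite ger0_norm ?norm1_ge0//.
  apply: (le_trans (ler_norm1D _ _)); rewrite norm1N; apply: lerD; exact: ler_norm1_cube.
have EG : \int[P]_(x in D) G n x @[n --> \oo] --> (0 : R).
  have [|||||_ _] := @dominated_convergence _ _ _ P _ mD (fun n x => (G n x)%:E) (cst 0%E) (cst K%:E).
  - by move=> n; apply/measurable_EFinP/measurable_funTS; case: (bG n).
  - exact: measurable_cst.
  - apply: filterS ae_cvg => x /[apply] cG.
    by apply: cvg_EFin => //; exact: nearW.
  - by apply: (@bfun_integrable _ _ _ P D mD (fun=> K)); exact: bfun_cst.
  - by apply: aeW => x n Dx; rewrite lee_fin; exact: GK.
  rewrite integral0 => /fine_cvg; apply: cvg_trans; apply: near_eq_cvg.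
  by apply: nearW => n.
move=> n; apply/ler_addgt0Pr => e e0.
have /cvgrPdist_le/(_ _ e0)[m _ mP] := EG.
have := mP (maxn n m) (leq_maxr _ _); rewrite sub0r normrN => /ler_normlP[_ h].
have := uc n (maxn n m) (leq_maxl _ _); set k := maxn n m in h * => h2.
apply: (le_trans _ (lerD h2 h)).
have bd : bfun D (fun x => norm1 ((u n x : U) - u k x)) by apply: (@bfun_dist _ _ r).
rewrite -(Rint_add P mD bd (bG k)); apply: (@Rint_le _ _ _ P D mD).
- exact: (bG n).
- exact: (bfunD bd (bG k)).
- by move=> x _; exact: ler_norm1_dist.
Qed.

End FastCauchy.

(** * A jointly measurable family of optimal maps *)

Section OptimalFamily.
Context {R : realType} (d : nat) (Y : normedModType R).
Local Notation U := ('rV[R]_d).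
Variables (mu : probability (borel U) R) (A : set (borel U)) (r C : R).
Hypotheses (mA : measurable A) (muA : mu (~` A) = 0%E) (r0 : 0 < r)
  (Ar : A `<=` @cube R d r) (C0 : 0 <= C) (HC : second_difference_bound mu A C).
Variables (Phi : U -> Y -> R) (K L : R).
Hypotheses (Phi_gt0 : forall u y, 0 < Phi u y) (Phi_le : forall u y, Phi u y <= K)
  (L0 : 0 <= L) (PhiL1 : forall u u' y, `|Phi u y - Phi u' y| <= L * enorm (u - u'))
  (PhiL2 : forall u y y', `|Phi u y - Phi u y'| <= L * `|y - y'|).
Notation E f := (\int[mu]_(x in A) f x).
Let H : R := stability_constant d r C K L.

Lemma separable_sequence (D : set Y) : countable D -> dense D ->
  exists ys : nat -> Y, forall y e, 0 < e -> exists k, `|y - ys k| < e.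
Proof.
move=> /countable_injP[f finj] dD.
(* Numbers that encode no point of [D] are sent to 0. *)
have ysP (n : nat) : exists c : Y, forall c', D c' -> f c' = n -> c = c'.
  have [[c [Dc fc]]|nc] := pselect (exists c, D c /\ f c = n).
    by exists c => c' Dc' fc'; apply: finj; [exact/mem_set|exact/mem_set|rewrite fc fc'].
  by exists 0 => c' Dc' fc'; exfalso; apply: nc; exists c'.
have [ys ysE] := choice ysP; exists ys => y e e0.
have [c [yc Dc]] : ball y e `&` D !=set0.
  by apply: dD; [exists y; exact: ballxx|exact: ball_open].
by exists (f c); rewrite (ysE _ _ Dc erefl); move: yc; rewrite -ball_normE.
Qed.

Lemma measurable_countable_family d1 d2 d3 (T1 : measurableType d1) (T2 : measurableType d2)
    (T3 : measurableType d3) (k : T1 -> nat) (F : nat -> T2 -> T3) :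
  (forall B, measurable (k @^-1` B)) -> (forall n, measurable_fun setT (F n)) ->
  measurable_fun setT (fun p : T1 * T2 => F (k p.1) p.2).
Proof.
move=> mk mF _ B mB; rewrite setTI.
have -> : (fun p : T1 * T2 => F (k p.1) p.2) @^-1` B =
    \bigcup_n ((k @^-1` [set n]) `*` (F n @^-1` B)).
  apply/seteqP; split=> [[a b] /= Fab|[a b] [n _ [/= <-]]//].
  by exists (k a).
apply: bigcupT_measurable => n; apply: measurableX => //.
by rewrite -[X in measurable X]setTI; exact: mF.
Qed.

(* The scale [4^-n] matches [t = 2^-n] in [approximant_stability]: consecutive
   approximants are then at distance [O (2^-n)], which is summable. *)
Definition grid_scale n : R := (2^-1 ^+ n) ^+ 2.

(* [Sn n y] is an approximant for a point of a dense sequence close to [y],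
   chosen measurably in [y]; it is measurable because the sequence is countable. *)
Record optimal_family (P : U -> U) (S : Y -> U -> U) (Sn : nat -> Y -> U -> U)
    (phin psin : nat -> Y -> U -> R) : Prop := OptimalFamily {
  family_measurable : measurable_fun setT (fun p : borel Y * borel U => S p.1 p.2 : borel U);
  family_cube : forall y x, cube r (S y x);
  family_approximant : forall n y, exists2 y', `|y - y'| <= grid_scale n &
    approximant mu A r Phi P y' (grid_scale n) (Sn n y) (phin n y) (psin n y);
  family_Sn : forall n, measurable_fun setT (fun p : borel Y * borel U => Sn n p.1 p.2 : borel U);
  family_phin : forall n, measurable_fun setT (fun p : borel Y * borel U => phin n p.1 p.2);
  family_psin : forall n, measurable_fun setT (fun p : borel Y * borel U => psin n p.1 p.2);
  family_cvg : forall n y, E (fun x => norm1 (Sn n y x - S y x)) <= 5 * H * 2^-1 ^+ n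
}.

Lemma grid_scale_gt0 n : 0 < grid_scale n. Proof. by rewrite exprn_gt0// half_pow_gt0. Qed.

Lemma grid_scale_homo m n : (m <= n)%N -> grid_scale n <= grid_scale m.
Proof.
move=> mn; rewrite /grid_scale; apply: lerXn2r; rewrite ?nnegrE ?(ltW (half_pow_gt0 _))//.
exact: half_pow_homo.
Qed.

(** Of the four errors [grid_scale n], two come from replacing the data by points of the dense
    sequence and two from rounding. *)
Lemma approximant_cauchy P P' y y' n m S S' phi phi' psi psi' y1 y1' :
  admissible A r P -> admissible A r P' ->
  (n <= m)%N -> `|y - y1| <= grid_scale n -> `|y' - y1'| <= grid_scale m ->
  approximant mu A r Phi P y1 (grid_scale n) S phi psi ->
  approximant mu A r Phi P' y1' (grid_scale m) S' phi' psi' ->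
  forall t, 0 < t -> t <= 1 ->
  t * E (fun x => norm1 (S x - S' x)) <=
    H * (proj_dist mu A P P' + `|y - y'| + 4 * grid_scale n + t ^+ 2).
Proof.
move=> aP aP' nm yy1 yy1' ap ap' t t0 t1.
have := approximant_stability mA muA r0 Ar C0 HC Phi_gt0 Phi_le L0 PhiL1 PhiL2 aP aP' ap ap' t0 t1.
move=> /le_trans; apply; apply: ler_wpM2l; first exact: stability_constant_ge0.
have gm := grid_scale_homo nm.
have : `|y1 - y1'| <= `|y - y'| + grid_scale n + grid_scale m.
  have -> : y1 - y1' = (y1 - y) + (y - y') + (y' - y1').
    by rewrite !addrA subrK subrK.
  apply: (le_trans (ler_normD _ _)); apply: lerD => //.
  by rewrite addrC; apply: (le_trans (ler_normD _ _)); apply: lerD => //; rewrite distrC.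
lra.
Qed.

Lemma optimal_family_exists (D : set Y) P : countable D -> dense D -> admissible A r P ->
  exists S Sn phin psin, optimal_family P S Sn phin psin.
Proof.
move=> cD dD aP; have [ys ysP] := separable_sequence cD dD.
have sel (nk : nat * nat) : exists s : (U -> U) * (U -> R) * (U -> R),
    approximant mu A r Phi P (ys nk.2) (grid_scale nk.1) s.1.1 s.1.2 s.2.
  have [S [phi [psi h]]] := approximant_exists mA muA r0 Ar C0 HC Phi_gt0 Phi_le L0 PhiL1
    (ys nk.2) aP (grid_scale_gt0 nk.1).
  by exists (S, phi, psi).
have [s sP] := choice sel.
have yk n y : exists k, `|y - ys k| < grid_scale n by apply: ysP; exact: grid_scale_gt0.
(* Taking the least index makes each level set a ball minus finitely many balls, hence
   measurable. *)
pose idx n y := ex_minn (yk n y).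
have idxP n y : `|y - ys (idx n y)| < grid_scale n by rewrite /idx; case: ex_minnP.
have mball k n : measurable [set y : borel Y | `|(y : Y) - ys k| < grid_scale n].
  apply: sub_sigma_algebra.
  have := @ball_open R Y (ys k) (grid_scale n).
  by congr open; apply/seteqP; split=> y; rewrite -ball_normE/= distrC.
have midx n B : measurable (idx n @^-1` B : set (borel Y)).
  rewrite (_ : _ @^-1` _ = \bigcup_(k in B) ([set y : borel Y | `|(y : Y) - ys k| < grid_scale n] `\`
      \bigcup_(j in `I_k) [set y : borel Y | `|(y : Y) - ys j| < grid_scale n])); last first.
    apply/seteqP; split=> [y By|y [k Bk [yk' nk]]] /=.
      exists (idx n y) => //; split; first exact: idxP.
      move=> [j /= ji yj]; move: ji; rewrite /idx; case: ex_minnP => i _ imin.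
      by rewrite ltnNge imin.
    rewrite (_ : idx n y = k)//; rewrite /idx; case: ex_minnP => i yi imin.
    apply/eqP; rewrite eqn_leq imin//= leqNgt; apply/negP => ik.
    by apply: nk; exists i.
  apply: bigcup_measurable => k _; apply: measurableD => //.
  by apply: bigcup_measurable => j _.
pose Sn n y := (s (n, idx n y)).1.1.
pose phin n y := (s (n, idx n y)).1.2.
pose psin n y := (s (n, idx n y)).2.
have mSn n : measurable_fun setT (fun p : borel Y * borel U => Sn n p.1 p.2 : borel U).
  apply: (@measurable_countable_family _ _ _ (borel Y) (borel U) (borel U) (idx n) (fun k => (s (n, k)).1.1)) => // k.
  by have [X [k0 _ _ _]] := sP (n, k); exact: kant_measurable k0.
have rSn n y x : cube r (Sn n y x).
  by have [X [k0 _ _ _]] := sP (n, idx n y); exact: kant_cube k0 x.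
have mphin n : measurable_fun setT (fun p : borel Y * borel U => phin n p.1 p.2).
  apply: (@measurable_countable_family _ _ _ (borel Y) (borel U) _ (idx n) (fun k => (s (n, k)).1.2)) => // k.
  by have [X [k0 _ _ _]] := sP (n, k); exact: lipschitz1_measurable (kant_phi_lip k0).
have mpsin n : measurable_fun setT (fun p : borel Y * borel U => psin n p.1 p.2).
  apply: (@measurable_countable_family _ _ _ (borel Y) (borel U) _ (idx n) (fun k => (s (n, k)).2)) => // k.
  by have [X [k0 _ _ _]] := sP (n, k); exact: lipschitz1_measurable (kant_psi_lip k0).
exists (fun y x => limrow r (fun n => Sn n y x)), Sn, phin, psin; split=> //.
- apply: (@limrow_measurable _ _ _ _ r (fun n (p : borel Y * borel U) => Sn n p.1 p.2)) => //.
- by move=> y x; apply: limrow_cube; exact: ltW.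
- by move=> n y; exists (ys (idx n y)) => //; [exact: ltW|exact: sP].
move=> n y.
(* With [t = 2^-n] the stability bound is [H * (4 * t ^+ 2 + t ^+ 2)]; division by [t] gives
   [5 * H * t]. *)
have H0 : 0 <= 5 * H by rewrite mulr_ge0// stability_constant_ge0.
apply: (@fast_cauchy_limit _ _ _ _ mu A mA r _ (fun n => Sn n y)) => //; first exact: ltW.
- move=> m; have [X [k0 _ _ _]] := sP (m, idx m y); exact: kant_measurable k0.
- move=> a b ab.
  have := @approximant_cauchy P P y y a b _ _ _ _ _ _ _ _ aP aP ab (ltW (idxP a y)) (ltW (idxP b y))
     (sP (a, idx a y)) (sP (b, idx b y)) _ (half_pow_gt0 a) (half_pow_le1 a).
  rewrite subrr normr0 addr0 (_ : proj_dist _ _ _ _ = 0); last first.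
    rewrite /proj_dist -[RHS](Rint_cst mA muA 0); apply: eq_Rintegral => x _.
    by rewrite subrr /norm1 big1// => i _; rewrite mxE normr0.
  rewrite add0r /grid_scale => h; rewrite -(ler_pM2l (half_pow_gt0 a)); apply: (le_trans h).
  by rewrite le_eqVlt; apply/orP; left; apply/eqP; ring.
Qed.

End OptimalFamily.

(** * Lipschitz test functions and equality of measures *)

Section LipschitzTests.
Context {R : realType} (d : nat).
Local Notation U := ('rV[R]_d).

Lemma Rint_cvg dT (T : measurableType dT) (P : probability T R) (D : set T)
    (F : nat -> T -> R) (G : T -> R) M : measurable D ->
  (forall n, bfun D (F n)) -> bfun D G -> (forall n x, D x -> `|F n x| <= M) ->
  (forall x, D x -> F^~ x @ \oo --> G x) ->
  \int[P]_(x in D) F n x @[n --> \oo] --> \int[P]_(x in D) G x.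
Proof.
move=> mD bF bG FM FG.
have [|||||_ _] := @dominated_convergence _ _ _ P _ mD (fun n x => (F n x)%:E)
    (fun x => (G x)%:E) (cst M%:E).
- by move=> n; apply/measurable_EFinP/measurable_funTS; case: (bF n).
- by apply/measurable_EFinP/measurable_funTS; case: bG.
- by apply: aeW => x Dx; apply: cvg_EFin; [exact: nearW|exact: FG].
- by apply: (@bfun_integrable _ _ _ P D mD (fun=> M)); exact: bfun_cst.
- by apply: aeW => x n Dx; rewrite lee_fin; exact: FM.
rewrite (integral_bfun P mD bG) => /fine_cvg.
by apply: cvg_trans; apply: near_eq_cvg; apply: nearW.
Qed.

Definition dist_compl (B : set U) (u : U) : R := inf [set norm1 (u - v) | v in ~` B].

Lemma dist_compl_lipschitz (B : set U) : ~` B !=set0 -> lipschitz1 1 (dist_compl B).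
Proof.
move=> B0.
have hlb u : has_lbound [set norm1 (u - v) | v in ~` B].
  by exists 0 => _ [v _ <-]; exact: norm1_ge0.
suff H u v : dist_compl B u - dist_compl B v <= norm1 (u - v).
  by move=> u v; rewrite mul1r ler_norml lerNl opprB H norm1B H.
rewrite lerBlDr -lerBlDl; apply: lb_le_inf; first by have [v0 ?] := B0; exists (norm1 (v - v0)), v0.
move=> _ [z Bz <-]; rewrite lerBlDl; apply: (le_trans _ (ler_norm1_dist u v z)).
by apply: ge_inf; [exact: hlb|exists z].
Qed.

Lemma dist_compl_ge0 (B : set U) u : ~` B !=set0 -> 0 <= dist_compl B u.
Proof.
move=> [v0 Bv0]; apply: lb_le_inf; first by exists (norm1 (u - v0)), v0.
by move=> _ [z _ <-]; exact: norm1_ge0.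
Qed.

Lemma dist_compl_out (B : set U) u : (~` B) u -> dist_compl B u <= 0.
Proof.
move=> Bu; apply: ge_inf; first by exists 0 => _ [v _ <-]; exact: norm1_ge0.
by exists u => //; rewrite subrr /norm1 big1// => i _; rewrite mxE normr0.
Qed.

Lemma dist_compl_gt0 (B : set U) u : open B -> ~` B !=set0 -> B u -> 0 < dist_compl B u.
Proof.
move=> oB [v0 Bv0] Bu.
have /nbhs_ballP[e /= e0 eB] : nbhs u B by exact: open_nbhs_nbhs.
apply: (lt_le_trans e0); apply: lb_le_inf; first by exists (norm1 (u - v0)), v0.
move=> _ [z Bz <-]; rewrite leNgt; apply/negP => uz; apply: Bz; apply: eB.
split=> // i j; rewrite ord1 /ball/=; apply: le_lt_trans uz.
by rewrite /norm1 (bigD1 j)//= !mxE lerDl sumr_ge0.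
Qed.

Lemma min_dist (c a b : R) : `|Num.min c a - Num.min c b| <= `|a - b|.
Proof.
wlog ab : a b / a <= b.
  move=> H; have [|/ltW] := leP a b; first exact: H.
  by move=> ?; rewrite distrC [leRHS]distrC; exact: H.
rewrite !ler0_norm ?subr_le0//; last first.
  by rewrite le_min !ge_min lexx/= ab orbT.
have [h|h] := leP c b; have [h'|h'] := leP c a; lra.
Qed.

(** The approximations are [n] times the distance to the complement, cut off at 1. An empty
    complement is treated separately, since the infimum would range over the empty set. *)
Lemma open_indic_lipschitz (B : set U) : open B ->
  exists f : nat -> U -> R, [/\ forall n, lipschitz1 n%:R (f n),
    forall n u, 0 <= f n u <= 1 & forall u, f n u @[n --> \oo] --> (\1_B u : R)].
Proof.
move=> oB; have [BT|/set0P B0] := eqVneq (~` B) set0.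
  exists (fun _ _ => 1); split=> [n u v|n u|u].
  - by rewrite subrr normr0 mulr_ge0// norm1_ge0.
  - by rewrite ler01 lexx.
  - rewrite indicE mem_set; first exact: cvg_cst.
    by apply: contrapT => nBu; have : (~` B) u by []; rewrite BT.
exists (fun n u => Num.min 1 (n%:R * dist_compl B u)); split=> [n u v|n u|u].
- have h := dist_compl_lipschitz B0 u v; rewrite mul1r in h.
  have hn : `|n%:R * dist_compl B u - n%:R * dist_compl B v| <= n%:R * norm1 (u - v).
    by rewrite -mulrBr normrM ger0_norm//; exact: ler_wpM2l.
  apply: le_trans hn.
  exact: min_dist.
- by rewrite le_min ler01 mulr_ge0 ?dist_compl_ge0//= ge_min lexx.
have [Bu|nBu] := boolP (u \in B); last first.
  rewrite indicE (negPf nBu); apply: cvg_near_cst; apply: nearW => n.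
  have -> : dist_compl B u = 0.
    apply/eqP; rewrite eq_le dist_compl_ge0// andbT dist_compl_out//.
    by move/negP: nBu; apply: contra_not => ?; exact: mem_set.
  by rewrite mulr0 min_r.
rewrite indicE Bu; apply: cvg_near_cst; near=> n; apply: min_l.
have d0 := dist_compl_gt0 oB B0 (set_mem Bu).
rewrite -ler_pdivrMr// mul1r; near: n; exact: nbhs_infty_ger.
Unshelve. all: by end_near. Qed.

End LipschitzTests.

Section Pushforward.
Context {R : realType} (d : nat).
Local Notation U := ('rV[R]_d).
Variables (mu : probability (borel U) R) (A : set (borel U)).
Hypotheses (mA : measurable A) (muA : mu (~` A) = 0%E).
Notation E f := (\int[mu]_(x in A) f x).

Lemma probability_indic (B : set (borel U)) : measurable B ->
  mu B = (E (\1_B : borel U -> R))%:E.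
Proof.
move=> mB; rewrite (Rint_indic _ mA mB) -[in LHS](setIT B) -(integral_indic _ measurableT mB).
rewrite (integral_full mA muA); last 2 first.
- by apply/measurable_EFinP; exact: measurable_indic.
- by move=> x; rewrite lee_fin.
by rewrite integral_indic// setIC.
Qed.

Lemma density_indic (g : borel U -> R) (B : set (borel U)) : measurable B ->
  bfun A g -> (forall x, 0 <= g x) ->
  (\int[mu]_(x in B) (g x)%:E = (E (fun x => \1_B x * g x))%:E)%E.
Proof.
move=> mB bg g0; have bI := bfun_indic R A mB.
rewrite -(integral_bfun mu mA (bfunM bI bg)) integral_mkcond (integral_full mA muA); last 2 first.
- by apply/(measurable_restrictT _ mB); apply: measurable_funTS; apply/measurable_EFinP; case: bg.
- by move=> x; rewrite patchE; case: ifP => //; rewrite lee_fin.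
apply: eq_integral => x _; rewrite patchE indicE.
by case: (x \in B); rewrite ?mul1r ?mul0r.
Qed.

(** Lipschitz tests determine both finite measures on open sets by dominated convergence, and the
    open sets are a generating family stable under intersection. *)
Lemma push_measure (S P : borel U -> borel U) (g : borel U -> R) :
  measurable_fun setT S -> measurable_fun setT P -> bfun A g -> (forall x, 0 <= g x) ->
  (forall (K : R) (f : U -> R), lipschitz1 K f -> 0 <= K -> E (fun x => f (S x)) = E (fun x => f (P x) * g x)) ->
  forall B, measurable B -> mu (S @^-1` B) = (\int[mu]_(x in P @^-1` B) (g x)%:E)%E.
Proof.
move=> mS mP bg g0 H.
pose ind (B : set (borel U)) := (\int[mu]_(x in B) (g x)%:E)%E.
have ind0 : ind set0 = 0%E by rewrite /ind integral_set0.
have ind_ge0 B : (0 <= ind B)%E by apply: integral_ge0 => x _; rewrite lee_fin.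
have mg : measurable_fun setT (EFin \o g) by apply/measurable_EFinP; case: bg.
have ind_sigma : semi_sigma_additive ind.
  by apply: semi_sigma_additive_nng_induced => // x; rewrite lee_fin.
pose indm : {measure set (borel U) -> \bar R} :=
  HB.pack_for (Measure.type (borel U) R) ind (isMeasure.Build _ _ _ ind ind0 ind_ge0 ind_sigma).
pose m1 := measure_function_pushforward__canonical__measure_function_Measure mu mS.
pose m2 := measure_function_pushforward__canonical__measure_function_Measure indm mP.
apply: (@measure_unique _ R (borel U) (@open U) (fun=> setT) _ _ _ _ m1 m2) => //.
- by move=> B C oB oC; exact: openI.
- by move=> _; exact: openT.
- by apply: bigcup_const; exists 0%N.
- move=> B oB; have mB : measurable (B : set (borel U)) by exact: sub_sigma_algebra.
  have mSB : measurable (S @^-1` B) by rewrite -[X in measurable X]setTI; exact: (mS measurableT _ mB).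
  have mPB : measurable (P @^-1` B) by rewrite -[X in measurable X]setTI; exact: (mP measurableT _ mB).
  rewrite /= /pushforward/= probability_indic// /ind density_indic//; congr (_%:E).
  have [f [fK f01 fB]] := open_indic_lipschitz oB.
  have bf n (X : borel U -> borel U) : measurable_fun setT X -> bfun A (fun x => f n (X x)).
    move=> mX; split; first exact: (measurableT_comp (lipschitz1_measurable (fK n)) mX).
    by exists 1 => x _; have /andP[h0 h1] := f01 n (X x); rewrite ger0_norm.
  have [M gM] := bg.2.
  have c1 : E (fun x => f n (S x)) @[n --> \oo] --> E (\1_(S @^-1` B) : borel U -> R).
    apply: (@Rint_cvg _ _ _ mu A (fun n x => f n (S x)) _ 1) => //.
    + by move=> n; exact: bf.
    + exact: bfun_indic.
    + by move=> n x _; have /andP[h0 h1] := f01 n (S x); rewrite ger0_norm.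
  have c2 : E (fun x => f n (P x) * g x) @[n --> \oo] --> E (fun x => \1_(P @^-1` B) x * g x).
    apply: (@Rint_cvg _ _ _ mu A (fun n x => f n (P x) * g x) _ M) => //.
    + by move=> n; apply: bfunM => //; exact: bf.
    + by apply: bfunM => //; exact: bfun_indic.
    + move=> n x Ax; rewrite normrM -[leRHS]mul1r; apply: ler_pM => //; last exact: gM.
      by have /andP[h0 h1] := f01 n (P x); rewrite ger0_norm.
    + by move=> x _; apply: cvgM; [exact: fB|exact: cvg_cst].
  have e12 : (fun n => E (fun x => f n (S x))) = (fun n => E (fun x => f n (P x) * g x)).
    by apply/funext => n; apply: (H n%:R).
  by rewrite e12 in c1; exact: (cvg_unique _ c1 c2).
- move=> _; rewrite /= /pushforward preimage_setT.
  by rewrite (le_lt_trans (probability_le1 _ _))// ltry.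
Qed.

End Pushforward.

(** * Target measures and stability of the limit maps *)

Section FamilyProperties.
Context {R : realType} (d : nat) (Y : normedModType R).
Local Notation U := ('rV[R]_d).
Variables (mu : probability (borel U) R) (A : set (borel U)) (r C : R).
Hypotheses (mA : measurable A) (muA : mu (~` A) = 0%E) (r0 : 0 < r)
  (Ar : A `<=` @cube R d r) (C0 : 0 <= C) (HC : second_difference_bound mu A C).
Variables (Phi : U -> Y -> R) (K L : R).
Hypotheses (Phi_gt0 : forall u y, 0 < Phi u y) (Phi_le : forall u y, Phi u y <= K)
  (L0 : 0 <= L) (PhiL1 : forall u u' y, `|Phi u y - Phi u' y| <= L * enorm (u - u'))
  (PhiL2 : forall u y y', `|Phi u y - Phi u y'| <= L * `|y - y'|).
Notation E f := (\int[mu]_(x in A) f x).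
Let H : R := stability_constant d r C K L.
Notation family := (optimal_family mu A r C Phi K L).

Lemma family_slice P S Sn phin psin y : family P S Sn phin psin ->
  measurable_fun setT (S y : borel U -> borel U).
Proof.
move=> fam; exact: (measurableT_comp (family_measurable fam) (@measurable_pair1 _ _ (borel Y) (borel U) y)).
Qed.

Lemma grid_scale_le n : grid_scale n <= (2^-1 : R) ^+ n.
Proof.
rewrite /grid_scale expr2 -[leRHS]mulr1; apply: ler_wpM2l; first exact/ltW/half_pow_gt0.
exact: half_pow_le1.
Qed.

(** The approximant at level [n] has the target of a nearby datum, with [P] rounded. Both
    perturbations of the target and the distance of the approximant to [S] are of order [2^-n], so
    they vanish in the limit. *)
Lemma family_push P S Sn phin psin y k f :
  admissible A r P -> family P S Sn phin psin -> lipschitz1 k f -> 0 <= k ->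
  E (fun x => f (S y x)) = E (fun x => f (P x) * posterior_density mu A Phi P y x).
Proof.
move=> aP fam fk k0; have [mP rP] := aP.
have mS := family_slice y fam.
have rS x : A x -> cube r (S y x) by move=> _; exact: family_cube fam y x.
have bS := bfun_lipschitz_comp fk mS rS.
pose g := posterior_density mu A Phi P.
have bg y0 := posterior_density_bfun mu A Phi_gt0 L0 PhiL1 y0 mP.
have g0 y0 x : 0 <= g y0 x := posterior_density_ge0 mA muA Phi_gt0 Phi_le L0 PhiL1 y0 x mP.
have Eg y0 : E (g y0) = 1 := posterior_density_int mA muA Phi_gt0 Phi_le L0 PhiL1 y0 mP.
have pd0 : proj_dist mu A P P = 0.
  rewrite /proj_dist -[RHS](Rint_cst mA muA 0); apply: eq_Rintegral => x _.
  by rewrite subrr /norm1 big1// => i _; rewrite mxE normr0.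
have P0 x : A x -> norm1 (P x - P x) <= 0 by rewrite subrr /norm1 big1// => i _; rewrite mxE normr0.
pose a := E (fun x => f (S y x)); pose b := E (fun x => f (P x) * g y x).
pose G := expR K + d%:R * r * ((expR K + expR K * expR K) * L).
have G0 : 0 <= G.
  have eK := expR_ge0 K.
  apply: addr_ge0 => //; apply: mulr_ge0; first by apply: mulr_ge0 => //; exact: ltW.
  by apply: mulr_ge0 => //; apply: addr_ge0 => //; exact: mulr_ge0.
have key n : `|a - b| <= k * (5 * H * 2^-1 ^+ n) + k * (G * (2 * 2^-1 ^+ n)).
  have [y' yy' [X' [kt mX' rX' PX']]] := family_approximant fam n y.
  have s0 : `|y - y'| + grid_scale n <= 2 * 2^-1 ^+ n.
    by rewrite mulr_natl mulr2n; apply: lerD; [exact: (le_trans yy' (grid_scale_le n))|exact: grid_scale_le].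
  have s1 : 0 + `|y - y'| + grid_scale n + 0 <= 2 * 2^-1 ^+ n by rewrite add0r addr0.
  have s2 : 0 + `|y - y'| + 0 + grid_scale n <= 2 * 2^-1 ^+ n by rewrite add0r addr0.
  have rX'A x : A x -> cube r (X' x) by [].
  have mSn := kant_measurable kt.
  have rSn x : A x -> cube r (Sn n y x) by move=> _; exact: kant_cube kt x.
  have bSn := bfun_lipschitz_comp fk mSn rSn.
  have h1 : `|a - E (fun x => f (Sn n y x))| <= k * (5 * H * 2^-1 ^+ n).
    rewrite /a -(Rint_sub mu mA bS bSn); apply: (le_trans (Rint_norm mu mA (bfunB bS bSn))).
    have bd := bfun_dist mSn mS rSn rS.
    apply: (@le_trans _ _ (k * E (fun x => norm1 (Sn n y x - S y x)))); last first.
      by apply: ler_wpM2l => //; exact: family_cvg fam n y.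
    rewrite -(Rint_scale mu mA k bd); apply: (@Rint_le _ _ _ mu A mA).
    - by apply: bfun_norm; exact: bfunB.
    - by apply: bfunM => //; exact: bfun_cst.
    by move=> x _; rewrite norm1B.
  have h2 : `|E (fun x => f (Sn n y x)) - b| <= k * (G * (2 * 2^-1 ^+ n)).
    rewrite (kant_push kt fk).
    have e12 : E (g y') = E (g y) by rewrite !Eg.
    have d1 := lipschitz1_data_dist mA fk k0 mX' mP rX'A rP (bg y') (bg y) (g0 y') e12.
    have d2 := lipschitz1_data_dist mA fk k0 mP mX' rP rX'A (bg y) (bg y') (g0 y) (esym e12).
    have p1 := posterior_data_dist mA muA r0 Phi_gt0 Phi_le L0 PhiL1 PhiL2 y' y aP aP mX' mP rX'A rP PX' P0.
    have p2 := posterior_data_dist mA muA r0 Phi_gt0 Phi_le L0 PhiL1 PhiL2 y y' aP aP mP mX' rP rX'A P0 PX'.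
    rewrite pd0 in p1 p2; rewrite distrC in p1.
    have q1 := ler_wpM2l k0 (le_trans p1 (ler_wpM2l G0 s1)).
    have q2 := ler_wpM2l k0 (le_trans p2 (ler_wpM2l G0 s2)).
    rewrite ler_norml lerNl opprB; apply/andP; split.
      exact: (le_trans d2 q2).
    exact: (le_trans d1 q1).
  rewrite (_ : a - b = (a - E (fun x => f (Sn n y x))) + (E (fun x => f (Sn n y x)) - b)); last by ring.
  by apply: (le_trans (ler_normD _ _)); exact: lerD.
apply/eqP; rewrite -subr_eq0 -normr_le0.
apply: (@le_half_pow _ _ _ (k * (5 * H) + k * (G * 2))) => n.
by rewrite add0r; apply: (le_trans (key n)); rewrite le_eqVlt; apply/orP; left; apply/eqP; ring.
Qed.

Let stability_limit_arith (h g p s q : R) : 0 <= h -> g <= p ->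
  h * (s + 4 * g + q) + (5 * h * p + 5 * h * p) <= h * (s + q) + (10 * h + 4 * h) * p.
Proof. by move=> h0 gp; have := ler_wpM2l h0 gp; lra. Qed.

(** Limit of [approximant_cauchy] at fixed [t]. In the excess, [4 * H] stems from rounding and data
    selection and [10 * H] from the two tails of size [5 * H]. *)
Lemma family_stability P P' S S' Sn Sn' phin phin' psin psin' y y' t :
  admissible A r P -> admissible A r P' ->
  family P S Sn phin psin -> family P' S' Sn' phin' psin' -> 0 < t -> t <= 1 ->
  t * E (fun x => norm1 (S y x - S' y' x)) <=
    H * (proj_dist mu A P P' + `|y - y'| + t ^+ 2).
Proof.
move=> aP aP' fam fam' t0 t1.
have H0 : 0 <= H by exact: stability_constant_ge0.
apply: (@le_half_pow _ _ _ (10 * H + 4 * H)) => n.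
have [y1 yy1 ap] := family_approximant fam n y.
have [y1' yy1' ap'] := family_approximant fam' n y'.
have h := approximant_cauchy mA muA r0 Ar C0 HC Phi_gt0 Phi_le L0 PhiL1 PhiL2 aP aP'
  (leqnn n) yy1 yy1' ap ap' t0 t1.
have [X [kt _ _ _]] := ap; have [X' [kt' _ _ _]] := ap'.
have mSn := kant_measurable kt; have mSn' := kant_measurable kt'.
have rSn x : A x -> cube r (Sn n y x) by move=> _; exact: kant_cube kt x.
have rSn' x : A x -> cube r (Sn' n y' x) by move=> _; exact: kant_cube kt' x.
have mS := family_slice y fam; have mS' := family_slice y' fam'.
have rS x : A x -> cube r (S y x) by move=> _; exact: family_cube fam y x.
have rS' x : A x -> cube r (S' y' x) by move=> _; exact: family_cube fam' y' x.
have b1 := bfun_dist mSn mS rSn rS; have b2 := bfun_dist mSn' mS' rSn' rS'.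
have b3 := bfun_dist mSn mSn' rSn rSn'; have b4 := bfun_dist mS mS' rS rS'.
have c1 := family_cvg fam n y; have c2 := family_cvg fam' n y'.
have tri : E (fun x => norm1 (S y x - S' y' x)) <=
    E (fun x => norm1 (Sn n y x - Sn' n y' x)) +
    (E (fun x => norm1 (Sn n y x - S y x)) + E (fun x => norm1 (Sn' n y' x - S' y' x))).
  rewrite -(Rint_add mu mA b1 b2) -(Rint_add mu mA b3 (bfunD b1 b2)).
  apply: (@Rint_le _ _ _ mu A mA) => //; first by apply: bfunD => //; exact: bfunD.
  move=> x _; have := ler_norm1_dist (S y x) (Sn n y x) (S' y' x).
  have := ler_norm1_dist (Sn n y x) (Sn' n y' x) (S' y' x).
  by rewrite (norm1B (S y x) (Sn n y x)); lra.
apply: (le_trans (ler_wpM2l (ltW t0) tri)); rewrite mulrDr.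
have e0 : 0 <= E (fun x => norm1 (Sn n y x - S y x)) + E (fun x => norm1 (Sn' n y' x - S' y' x)).
  by apply: addr_ge0; apply: Rintegral_ge0 => x _; exact: norm1_ge0.
have h3 := le_trans (ler_piMl e0 t1) (lerD c1 c2).
apply: (le_trans (lerD h h3)); exact: (stability_limit_arith _ _ H0 (grid_scale_le n)).
Qed.

End FamilyProperties.

(** * Optimal triangular maps agree with the family *)

Section OptimalUnique.
Context {R : realType} (d : nat) (Y : completeNormedModType R).
Local Notation U := ('rV[R]_d).
Variables (mu : probability (borel U) R) (A : set (borel U)) (r C : R).
Hypotheses (mA : measurable A) (muA : mu (~` A) = 0%E) (r0 : 0 < r)
  (Ar : A `<=` @cube R d r) (C0 : 0 <= C) (HC : second_difference_bound mu A C).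
Variables (Phi : U -> Y -> R) (K L : R).
Hypotheses (Phi_gt0 : forall u y, 0 < Phi u y) (Phi_le : forall u y, Phi u y <= K)
  (L0 : 0 <= L).
Let H : R := stability_constant d r C K L.
Variables (P : U -> U) (S : Y -> U -> U) (Sn : nat -> Y -> U -> U) (phin psin : nat -> Y -> U -> R).
Hypothesis fam : optimal_family mu A r C Phi K L P S Sn phin psin.
Variables (nuY : probability (borel Y) R) (T : Y -> U -> U).
Let eta : probability (borel Y * borel U)%type R := [the probability _ _ of (nuY \x mu)%E].
Let triT : borel Y * borel U -> borel Y * borel U := triangular_map T.
Let triS : borel Y * borel U -> borel Y * borel U := triangular_map S.
Hypotheses (mtriT : measurable_fun setT triT)
  (pushT : forall B, measurable B -> pushforward eta triT B = pushforward eta triS B)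
  (costT : (transport_cost eta T <= transport_cost eta S)%E).

Let mT : measurable_fun setT (fun p : borel Y * borel U => T p.1 p.2 : borel U).
Proof. exact: (measurableT_comp measurable_snd mtriT). Qed.

Let mS : measurable_fun setT (fun p : borel Y * borel U => S p.1 p.2 : borel U).
Proof. exact: family_measurable fam. Qed.

Let mtriS : measurable_fun setT triS.
Proof. by apply: measurable_fun_pair; [exact: measurable_fst|exact: mS]. Qed.

Let mx : measurable_fun setT (fun p : borel Y * borel U => p.2 : borel U).
Proof. exact: measurable_snd. Qed.

(** [T] is not known to stay in the cube. It does so almost everywhere, since it has the same law as
    [S]; all integrals are therefore taken over this set of full measure. *)
Let D : set (borel Y * borel U) := [set p | A p.2 /\ cube r (T p.1 p.2)].

Let mD : measurable D.
Proof.
apply: measurableI.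
  by rewrite -[X in measurable X]setTI; apply: mx.
by rewrite -[X in measurable X]setTI; apply: mT => //; exact: cube_measurable.
Qed.

Let etaD : eta (~` D) = 0%E.
Proof.
have mcu : measurable (setT `*` ~` @cube R d r : set (borel Y * borel U)).
  by apply: measurableX => //; apply: measurableC; exact: cube_measurable.
have mcA : measurable (setT `*` ~` A : set (borel Y * borel U)).
  by apply: measurableX => //; exact: measurableC.
have e1 : eta (setT `*` ~` A) = 0%E.
  by rewrite /eta/= product_measure1E//; [rewrite [X in (_ * X)%E]muA mule0|exact: measurableC].
have mTc : measurable (triT @^-1` (setT `*` ~` @cube R d r)).
  by rewrite -[X in measurable X]setTI; exact: (mtriT measurableT mcu).
have e2 : eta (triT @^-1` (setT `*` ~` @cube R d r)) = 0%E.
  transitivity (pushforward eta triS (setT `*` ~` @cube R d r)); first exact: pushT.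
  rewrite /pushforward (_ : _ @^-1` _ = set0) ?measure0//.
  by apply/seteqP; split=> // -[y x] [_ /=]; apply; exact: family_cube fam y x.
apply/eqP; rewrite eq_le measure_ge0 andbT -[leRHS](adde0 0%E) -[X in (_ <= X + _)%E]e1 -e2.
apply: (le_trans _ (measureU2 _ mcA mTc)).
apply: le_measure; [by apply/mem_set; exact: measurableC|by apply/mem_set; exact: measurableU|].
move=> p /not_andP[nA|nT]; [left|right]; by split.
Qed.

Notation E f := (\int[eta]_(p in D) f p).

Let rT p : D p -> cube r (T p.1 p.2). Proof. by case. Qed.
Let rx p : D p -> cube r (p.2 : U). Proof. by case=> /Ar. Qed.
Let rS p : D p -> cube r (S p.1 p.2). Proof. by move=> _; exact: family_cube fam p.1 p.2. Qed.

Let Rint_full (f : borel Y * borel U -> R) : bfun setT f ->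
  \int[eta]_p f p = E f.
Proof.
move=> bf; rewrite /Rintegral (negligible_integral _ _ _ etaD) ?setTD ?setCK//.
- exact: measurableC.
- exact: bfun_integrable.
Qed.

Let push_eq (g : borel Y * borel U -> R) M : measurable_fun setT g ->
  (forall y u, cube r u -> `|g (y, u)| <= M) ->
  E (fun p => g (p.1, T p.1 p.2)) = E (fun p => g (p.1, S p.1 p.2)).
Proof.
(* [g] is bounded only for arguments in the cube, so it is cut off there; both maps take values in
   the cube on [D], and the integrals are unchanged. *)
move=> mg gM; pose G p : R := g p * \1_(@cube R d r) p.2.
have mG : measurable_fun setT G.
  apply: measurable_funM => //.
  by apply: measurableT_comp => //; apply: measurable_indic; exact: cube_measurable.
have M0 : 0 <= M.
  by apply: (le_trans (normr_ge0 _) (gM point 0 _)) => i; rewrite mxE; have := r0; lra.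
have GM p : `|G p| <= M.
  rewrite /G indicE; have [/set_mem cp|_] := boolP (_ \in _); last by rewrite mulr0 normr0.
  by rewrite mulr1; case: p cp => y u; exact: gM.
have bG (tri : borel Y * borel U -> borel Y * borel U) : measurable_fun setT tri -> bfun setT (G \o tri).
  by move=> mtri; split; [exact: measurableT_comp|exists M => p _; exact: GM].
have GE (tri : borel Y * borel U -> borel Y * borel U) : measurable_fun setT tri ->
    (\int[pushforward eta tri]_p (G p)%:E = \int[eta]_p (G (tri p))%:E)%E.
  move=> mtri; rewrite integral_pushforward//; first by apply/measurable_EFinP.
  by rewrite preimage_setT; exact: bfun_integrable (bG _ mtri).
transitivity (E (G \o triT)).
  apply: eq_Rintegral => p /set_mem Dp; rewrite /G /= indicE mem_set ?mulr1//.
  exact: rT.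
rewrite -(Rint_full (bG _ mtriT)).
transitivity (E (G \o triS)); last first.
  apply: eq_Rintegral => p /set_mem Dp; rewrite /G /= indicE mem_set ?mulr1//.
  exact: rS.
rewrite -(Rint_full (bG _ mtriS)) /Rintegral; congr fine.
rewrite -(GE _ mtriT) -(GE _ mtriS).
pose m1 := measure_function_pushforward__canonical__measure_function_Measure eta mtriT.
pose m2 := measure_function_pushforward__canonical__measure_function_Measure eta mtriS.
by apply: (@eq_measure_integral _ _ _ _ m2 m1) => B mB _; exact: pushT.
Qed.

Let bfun_edot (f g : borel Y * borel U -> borel U) :
  measurable_fun setT f -> measurable_fun setT g ->
  (forall p, D p -> cube r (f p : U)) -> (forall p, D p -> cube r (g p : U)) ->
  bfun D (fun p => edot (f p : U) (g p)).
Proof.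
move=> mf mg rf rg; split; first exact: measurable_edot.
exists (r * (d%:R * r)) => p Dp; apply: (le_trans (ler_norm_edot _ (rg _ Dp))).
by apply: ler_wpM2l; [exact: ltW|apply: ler_norm1_cube; exact: rf].
Qed.

Let bxx := bfun_edot mx mx rx rx.
Let bxT := bfun_edot mx mT rx rT.
Let bxS := bfun_edot mx mS rx rS.
Let bTT := bfun_edot mT mT rT rT.
Let bSS := bfun_edot mS mS rS rS.

Let cost_eq (V : Y -> U -> U) : measurable_fun setT (fun p : borel Y * borel U => V p.1 p.2 : borel U) ->
  (forall p, D p -> cube r (V p.1 p.2)) ->
  transport_cost eta V = (E (fun p => edot (p.2 : U) p.2) -
    2 * E (fun p => edot (p.2 : U) (V p.1 p.2)) + E (fun p => edot (V p.1 p.2) (V p.1 p.2)))%:E.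
Proof.
move=> mV rV; have bxV := bfun_edot mx mV rx rV; have bVV := bfun_edot mV mV rV rV.
rewrite /transport_cost (integral_full mD etaD); last 2 first.
- apply/measurable_EFinP; apply: (eq_measurable_fun (fun p : borel Y * borel U =>
    edot ((p.2 : U) - V p.1 p.2) ((p.2 : U) - V p.1 p.2))).
    by move=> p _; rewrite enorm_sq.
  by apply: measurable_edot; exact: measurable_subU.
- by move=> p; rewrite lee_fin sqr_ge0.
rewrite -(Rint_scale eta mD 2 bxV) -(Rint_sub eta mD bxx); last by apply: bfunM => //; exact: bfun_cst.
rewrite -(Rint_add eta mD) //; last by apply: bfunB => //; apply: bfunM => //; exact: bfun_cst.
rewrite -(integral_bfun eta mD); last first.
  by apply: bfunD => //; apply: bfunB => //; apply: bfunM => //; exact: bfun_cst.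
apply: eq_integral => p _; congr (_%:E).
by rewrite enorm_sq edotBl !edotBr (edotC (V p.1 p.2) p.2); ring.
Qed.

(** Expanding the square, [|x|^2] is common to both costs, and the second moments of [T] and [S]
    agree because their laws do. Smaller cost is thus larger correlation. *)
Let correlation_le : E (fun p => edot (p.2 : U) (S p.1 p.2)) <= E (fun p => edot (p.2 : U) (T p.1 p.2)).
Proof.
have := costT; rewrite (cost_eq mT rT) (cost_eq mS rS) lee_fin.
have -> : E (fun p => edot (T p.1 p.2) (T p.1 p.2)) = E (fun p => edot (S p.1 p.2) (S p.1 p.2)).
  apply: (@push_eq (fun p => edot (p.2 : U) p.2) (r * (d%:R * r))).
    exact: (measurable_edot measurable_snd measurable_snd).
  move=> y u ru /=; apply: (le_trans (ler_norm_edot _ ru)); apply: ler_wpM2l; first exact: ltW.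
  exact: ler_norm1_cube.
lra.
Qed.

(** The bound on slices is uniform in [y] and [nuY] is a probability, so estimates known for each
    datum carry over to the product. *)
Let fubini_le (f : borel Y * borel U -> R) c : bfun D f -> (forall p, 0 <= f p) ->
  (forall y, bfun A (fun x => f (y, x))) ->
  (forall y, \int[mu]_(x in A) f (y, x) <= c) -> E f <= c.
Proof.
move=> bf f0 bfy fc; rewrite -lee_fin -(integral_bfun eta mD bf).
have mf : measurable_fun setT (EFin \o f) by apply/measurable_EFinP; case: bf.
rewrite -(integral_full mD etaD mf); last by move=> p; rewrite lee_fin.
rewrite /eta/= fubini_tonelli1//.
have c0 : 0 <= c by apply: (le_trans _ (fc point)); apply: Rintegral_ge0.
apply: (@le_trans _ _ (\int[nuY]_(y in setT) (c%:E))%E); last first.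
  by rewrite integral_cst// -[leRHS]mule1; apply: lee_wpmul2l; [rewrite lee_fin|exact: probability_le1].
apply: ge0_le_integral => //.
- by move=> y _; apply: integral_ge0 => x _; rewrite lee_fin.
- exact: measurable_fun_fubini_tonelli_F.
move=> y _; rewrite /fubini_F.
have mfy : measurable_fun setT (fun x : borel U => (f (y, x))%:E).
  by apply/measurable_EFinP; case: (bfy y).
rewrite (integral_full mA muA mfy); last by move=> x; rewrite lee_fin.
by rewrite (integral_bfun mu mA (bfy y)) lee_fin.
Qed.

Let approximant_gap n : E (fun p => norm1 (Sn n p.1 p.2 - S p.1 p.2)) <= 5 * H * 2^-1 ^+ n.
Proof.
have rSn y x : cube r (Sn n y x).
  by have [y' _ [X [k _ _ _]]] := family_approximant fam n y; exact: kant_cube k x.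
apply: fubini_le.
- by apply: (bfun_dist (family_Sn fam n) mS _ rS) => p _; exact: rSn.
- by move=> p; exact: norm1_ge0.
- move=> y; have [y' _ [X [k _ _ _]]] := family_approximant fam n y.
  apply: (bfun_dist (kant_measurable k) (family_slice y fam)) => x _ //.
  exact: family_cube fam y x.
- by move=> y; exact: family_cvg fam n y.
Qed.

Let kink_bfun n t i : 0 < t ->
  bfun D (fun p : borel Y * borel U => second_difference (phin n p.1) t i p.2).
Proof.
move=> t0; have ms (h : U) : measurable_fun setT (fun p : borel Y * borel U => phin n p.1 ((p.2 : U) + h)).
  have mh : measurable_fun setT (fun x : borel U => (x : U) + h : borel U).
    apply: measurable_fun_rV => j; apply: (eq_measurable_fun (fun x : borel U => (x : U) 0 j + h 0 j)).
      by move=> x _; rewrite mxE.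
    by apply: measurable_funD => //; exact: coord_measurable.
  have mp : measurable_fun setT (fun p : borel Y * borel U => (p.1, (p.2 : U) + h) : borel Y * borel U).
    by apply: measurable_fun_pair; [exact: measurable_fst|exact: (measurableT_comp mh measurable_snd)].
  exact: (measurableT_comp (family_phin fam n) mp).
split.
  apply: measurable_funB; last by apply: measurable_funM => //; exact: family_phin fam n.
  by apply: measurable_funD; exact: ms.
exists (2 * r * t) => -[y x] _.
have [y' _ [X [k _ _ _]]] := family_approximant fam n y.
have nd : norm1 (t *: delta_mx 0 i : U) = t.
  rewrite /norm1 (bigD1 i)//= !mxE !eqxx mulr1 gtr0_norm// big1 ?addr0// => j ji.
  by rewrite !mxE (negPf ji) andbF mulr0 normr0.
have h1 := kant_phi_lip k (x + t *: delta_mx 0 i) x.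
have h2 := kant_phi_lip k (x - t *: delta_mx 0 i) x.
rewrite addrAC subrr add0r nd in h1; rewrite addrAC subrr add0r norm1N nd in h2.
rewrite (_ : second_difference _ _ _ _ = (phin n y (x + t *: delta_mx 0 i) - phin n y x) +
  (phin n y (x - t *: delta_mx 0 i) - phin n y x)); last by rewrite /second_difference/=; ring.
apply: (le_trans (ler_normD _ _)); apply: (le_trans (lerD h1 h2)).
by rewrite le_eqVlt; apply/orP; left; apply/eqP; ring.
Qed.

Let kink_le n t i : 0 < t ->
  E (fun p => second_difference (phin n p.1) t i p.2) <= C * r * t ^+ 2.
Proof.
move=> t0; apply: fubini_le.
- exact: kink_bfun.
- move=> [y x]; have [y' _ [X [k _ _ _]]] := family_approximant fam n y.
  exact: kant_phi_conv k _ _ _.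
- move=> y; have [y' _ [X [k _ _ _]]] := family_approximant fam n y.
  exact: (second_difference_bfun _ _ Ar (kant_phi_lip k)).
- move=> y; have [y' _ [X [k _ _ _]]] := family_approximant fam n y.
  exact: (HC _ (kant_phi_lip k) (kant_phi_conv k) t0).
Qed.

(** [psin n y] is Lipschitz in [u], but its size need not be bounded uniformly in [y]. Subtracting
    the value at 0 makes it so and leaves differences at equal [y] unchanged. *)
Let potential n (p : borel Y * borel U) : R := psin n p.1 p.2 - psin n p.1 0.

Let potential_measurable n : measurable_fun setT (potential n).
Proof.
apply: measurable_funB; first exact: family_psin fam n.
have m0 : measurable_fun setT (fun p : borel Y * borel U => (p.1, (0 : borel U)) : borel Y * borel U).
  by apply: measurable_fun_pair; [exact: measurable_fst|exact: measurable_cst].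
exact: (measurableT_comp (family_psin fam n) m0).
Qed.

Let potential_le n y u : cube r u -> `|potential n (y, u)| <= (r + 1) * (d%:R * r).
Proof.
move=> ru; have [y' _ [X [k _ _ _]]] := family_approximant fam n y.
have := kant_psi_lip k u 0; rewrite subr0 => /le_trans; apply.
by apply: ler_wpM2l; [rewrite addr_ge0// ltW|exact: ler_norm1_cube].
Qed.

Let potential_bfun n (V : Y -> U -> U) :
  measurable_fun setT (fun p : borel Y * borel U => V p.1 p.2 : borel U) ->
  (forall p, D p -> cube r (V p.1 p.2)) ->
  bfun D (fun p => potential n (p.1, V p.1 p.2)).
Proof.
move=> mV rV; split; last by exists ((r + 1) * (d%:R * r)) => p Dp; apply: potential_le; exact: rV.
have mp : measurable_fun setT (fun p : borel Y * borel U => (p.1, V p.1 p.2) : borel Y * borel U).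
  by apply: measurable_fun_pair; [exact: measurable_fst|exact: mV].
exact: (measurableT_comp (@potential_measurable n) mp).
Qed.

Let approximant_dist n t : 0 < t -> t <= 1 ->
  t * E (fun p => norm1 (T p.1 p.2 - Sn n p.1 p.2)) <=
    d%:R * ((2 * r + 1) * (5 * H * 2^-1 ^+ n)) + d%:R * (C * r * t ^+ 2).
Proof.
move=> t0 t1.
have rSn p : D p -> cube r (Sn n p.1 p.2).
  by have [y' _ [X [k _ _ _]]] := family_approximant fam n p.1; move=> _; exact: kant_cube k p.2.
have mSn := family_Sn fam n.
have bTS := bfun_dist mT mSn rT rSn; have bSS' := bfun_dist mSn mS rSn rS.
have bP := potential_bfun n mT rT; have bQ := potential_bfun n mS rS.
(* The gap at [T y x] is at most [G1 + G2 + G3]. Optimality makes the mean of [G1] nonpositive,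
   equality of laws makes that of [G2] zero, and [G3] pays for replacing [Sn] by [S]: [r] for the
   inner product and [r + 1] for the potential. [G4] is the kink term. *)
pose G1 (p : borel Y * borel U) := edot (p.2 : U) (S p.1 p.2) - edot (p.2 : U) (T p.1 p.2).
pose G2 (p : borel Y * borel U) := potential n (p.1, T p.1 p.2) - potential n (p.1, S p.1 p.2).
pose G3 (p : borel Y * borel U) := (2 * r + 1) * norm1 (Sn n p.1 p.2 - S p.1 p.2).
pose G4 (p : borel Y * borel U) := \sum_(i < d) second_difference (phin n p.1) t i p.2.
have b1 : bfun D G1 by exact: bfunB.
have b2 : bfun D G2 by exact: bfunB.
have b3 : bfun D G3 by apply: bfunM => //; exact: bfun_cst.
have b4 : bfun D G4 by apply: bfun_sum => i; exact: kink_bfun.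
have b123 : bfun D (fun p => G1 p + G2 p + G3 p) by apply: bfunD => //; exact: bfunD.
have bd123 : bfun D (fun p => d%:R * (G1 p + G2 p + G3 p)) by apply: bfunM => //; exact: bfun_cst.
have E1 : E G1 <= 0.
  by rewrite (Rint_sub eta mD bxS bxT) subr_le0; exact: correlation_le.
have E2 : E G2 = 0.
  rewrite (Rint_sub eta mD bP bQ); apply/eqP; rewrite subr_eq0; apply/eqP.
  exact: (push_eq (potential_measurable n) (@potential_le n)).
have E3 : E G3 <= (2 * r + 1) * (5 * H * 2^-1 ^+ n).
  rewrite (Rint_scale eta mD _ bSS'); apply: ler_wpM2l; last exact: approximant_gap.
  by rewrite addr_ge0// mulr_ge0// ltW.
have E4 : E G4 <= d%:R * (C * r * t ^+ 2).
  rewrite (Rint_sum eta mD); last by move=> i; exact: kink_bfun.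
  apply: (@le_trans _ _ (\sum_(i < d) C * r * t ^+ 2)); last by rewrite sumr_const card_ord mulr_natl.
  by apply: ler_sum => i _; exact: kink_le.
apply: (@le_trans _ _ (E (fun p => d%:R * (G1 p + G2 p + G3 p) + G4 p))).
  rewrite -(Rint_scale eta mD t bTS); apply: (@Rint_le _ _ _ eta D mD).
  - by apply: bfunM => //; exact: bfun_cst.
  - exact: bfunD.
  move=> p Dp; have [y' _ [X [k _ _ _]]] := family_approximant fam n p.1.
  have Ap : A p.2 by case: Dp.
  apply: (le_trans (kantorovich_pointwise Ar k Ap (rT Dp) t0 t1)).
  rewrite /G4 lerD2r; apply: ler_wpM2l => //.
  have h1 := kant_eq k Ap.
  have /ler_normlP[_ h2] := ler_norm_edot (Sn n p.1 p.2 - S p.1 p.2) (rx Dp).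
  rewrite edotBl (edotC _ p.2) (edotC (S p.1 p.2) p.2) in h2.
  have /ler_normlP[_ h3] := kant_psi_lip k (S p.1 p.2) (Sn n p.1 p.2).
  rewrite norm1B in h3; rewrite /G1 /G2 /G3 /potential /=; lra.
rewrite (Rint_add eta mD bd123 b4) (Rint_scale eta mD _ b123).
rewrite (Rint_add eta mD (bfunD b1 b2) b3) (Rint_add eta mD b1 b2) E2 addr0.
apply: lerD => //; apply: ler_wpM2l => //.
by rewrite -[leRHS]add0r; exact: lerD.
Qed.

(* [T] and [S] push [eta] to the same measure, so [psi] has the same mean along
   both, and optimality of [T] makes its duality gap nonpositive on average:
   [kantorovich_pointwise] at [v = T y x] then bounds the distance. *)
Let optimal_dist0 : E (fun p => norm1 (T p.1 p.2 - S p.1 p.2)) = 0.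
Proof.
have bTS := bfun_dist mT mS rT rS.
have H0 : 0 <= H by exact: stability_constant_ge0.
have a0 : 0 <= E (fun p => norm1 (T p.1 p.2 - S p.1 p.2)).
  by apply: Rintegral_ge0 => p _; exact: norm1_ge0.
have c0 : 0 <= d%:R * (C * r) by rewrite !mulr_ge0// ltW.
(* Two successive limits: at fixed [t = 2^-m] the level [n] tends to infinity and removes the
   approximation error; after division by [t] the kinks leave a multiple of [t], which vanishes as
   [m] grows. *)
apply/eqP; rewrite eq_le a0 andbT; apply: (@le_half_pow _ _ _ (d%:R * (C * r))) => m.
rewrite add0r -(ler_pM2l (half_pow_gt0 m)).
apply: (@le_half_pow _ _ _ (d%:R * ((2 * r + 1) * (5 * H)) + 5 * H)) => n.
have t0 := half_pow_gt0 (R := R) m; have t1 := half_pow_le1 (R := R) m.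
have rSn p : D p -> cube r (Sn n p.1 p.2).
  by have [y' _ [X [k _ _ _]]] := family_approximant fam n p.1; move=> _; exact: kant_cube k p.2.
have mSn := family_Sn fam n.
have b1 := bfun_dist mT mSn rT rSn; have b2 := bfun_dist mSn mS rSn rS.
have tri : E (fun p => norm1 (T p.1 p.2 - S p.1 p.2)) <=
    E (fun p => norm1 (T p.1 p.2 - Sn n p.1 p.2)) + E (fun p => norm1 (Sn n p.1 p.2 - S p.1 p.2)).
  rewrite -(Rint_add eta mD b1 b2); apply: (@Rint_le _ _ _ eta D mD) => //.
    exact: bfunD.
  by move=> p _; exact: ler_norm1_dist.
apply: (le_trans (ler_wpM2l (ltW t0) tri)); rewrite mulrDr.
have g0 : 0 <= E (fun p => norm1 (Sn n p.1 p.2 - S p.1 p.2)).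
  by apply: Rintegral_ge0 => p _; exact: norm1_ge0.
apply: (le_trans (lerD (approximant_dist n t0 t1) (le_trans (ler_piMl g0 t1) (approximant_gap n)))).
by rewrite le_eqVlt; apply/orP; left; apply/eqP; ring.
Qed.

(** By Tonelli the integral over [x] vanishes for almost all [y]; the good set is measurable because
    this integral is a measurable function of [y]. *)
Lemma optimal_unique : exists B : set (borel Y), [/\ measurable B, nuY (~` B) = 0%E &
  forall y, B y -> (\int[mu]_x (norm1 (T y x - S y x))%:E = 0)%E].
Proof.
pose f (p : borel Y * borel U) : \bar R := (norm1 (T p.1 p.2 - S p.1 p.2))%:E.
have mf : measurable_fun setT f.
  apply/measurable_EFinP; apply: (measurableT_comp (@measurable_norm1 R d)).
  exact: (measurable_subU mT mS).
have f0 p : (0 <= f p)%E by rewrite lee_fin norm1_ge0.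
have f_int : (\int[eta]_p f p = 0)%E.
  rewrite (integral_full mD etaD mf f0) (integral_bfun eta mD (bfun_dist mT mS rT rS)).
  by rewrite optimal_dist0.
pose F y := (\int[mu]_x f (y, x))%E.
have mF : measurable_fun setT (F : borel Y -> \bar R) by exact: measurable_fun_fubini_tonelli_F.
have F0 y : (0 <= F y)%E by exact: integral_ge0.
have F_int : (\int[nuY]_y F y = 0)%E by rewrite -f_int /eta/= fubini_tonelli1.
have mB : measurable ([set y | F y = 0%E] : set (borel Y)).
  by have := mF measurableT _ (emeasurable_set1 (0%E : \bar R)); rewrite setTI.
exists [set y | F y = 0%E]; split=> //.
apply: measure_negligible; first exact: measurableC.
have absF : (\int[nuY]_(y in setT) `|F y| = 0)%E.
  by rewrite -F_int; apply: eq_integral => y _; rewrite gee0_abs.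
have := (ae_eq_integral_abs nuY measurableT mF).1 absF.
by apply: negligibleS => y /= Fy; apply: contra_not Fy; exact.
Qed.

End OptimalUnique.

(** * The family as a conditional transport map *)

Section ConditionalTransport.
Context {R : realType} (d : nat) (Y : completeNormedModType R).
Local Notation U := ('rV[R]_d).
Variables (mu : probability (borel U) R) (A : set (borel U)) (r C : R).
Hypotheses (mA : measurable A) (muA : mu (~` A) = 0%E) (r0 : 0 < r)
  (Ar : A `<=` @cube R d r) (C0 : 0 <= C) (HC : second_difference_bound mu A C).
Variables (Phi : U -> Y -> R) (K L : R).
Hypotheses (Phi_gt0 : forall u y, 0 < Phi u y) (Phi_le : forall u y, Phi u y <= K)
  (L0 : 0 <= L) (PhiL1 : forall u u' y, `|Phi u y - Phi u' y| <= L * enorm (u - u'))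
  (PhiL2 : forall u y y', `|Phi u y - Phi u y'| <= L * `|y - y'|).
Variables (D : set Y) (cD : countable D) (dD : dense D).
Variables (gamma : probability (borel Y) R) (F : U * Y -> Y) (cF : continuous F).

(** The laws in the statement are bare set functions; this recovers their structure as
    probabilities. *)
Lemma push_probability d1 d2 (T1 : measurableType d1) (T2 : measurableType d2)
    (P : probability T1 R) (f : T1 -> T2) : measurable_fun setT f ->
  exists Q : probability T2 R, (Q : set T2 -> \bar R) = pushforward P f.
Proof.
move=> mf; pose f' : {mfun T1 >-> T2} := HB.pack f (isMeasurableFun.Build _ _ _ _ f mf).
by exists [the probability _ _ of distribution P f'].
Qed.

Lemma measurable_forward :
  measurable_fun setT (fun p : borel U * borel Y => (F p, p.1) : borel Y * borel U).
Proof.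
apply: measurable_fun_pair; last exact: measurable_fst.
apply: (@measurability _ _ _ (borel Y) _ _ (@open Y)) => //.
move=> _ [B oB <-]; rewrite setTI.
apply: (measurable_prod_open (@dense_ratrow R d) (@countable_ratrow R d) dD cD).
by move/continuousP: cF; exact.
Qed.

Variables (P : U -> U) (aP : admissible A r P).
Variables (S : Y -> U -> U) (Sn : nat -> Y -> U -> U) (phin psin : nat -> Y -> U -> R).
Hypothesis fam : optimal_family mu A r C Phi K L P S Sn phin psin.
Let muP := pushforward mu (P : borel U -> borel U).
Let nu := joint_law muP gamma F.

(** Change of variables along [P] turns the Gibbs weight against [muP] into [posterior_density]
    against [mu], and [push_measure] identifies its image with the law of [S y]. *)
Lemma gibbs_posterior_family y (B : set (borel U)) : measurable B ->
  gibbs_posterior muP Phi y B = mu (S y @^-1` B).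
Proof.
move=> mB; have [mP rP] := aP.
have mPB : measurable (P @^-1` B : set (borel U)).
  by rewrite -[X in measurable X]setTI; exact: (mP measurableT _ mB).
have blik := likelihood_bfun A Phi_gt0 L0 PhiL1 y mP.
have lik0 x : 0 <= likelihood Phi P y x by exact: expR_ge0.
have mPhi : measurable_fun setT (fun u : borel U => (expR (- Phi u y))%:E).
  apply/measurable_EFinP; apply: measurableT_comp => //; apply: measurable_funN.
  exact: (lipschitz1_measurable (Phi_lipschitz1 L0 PhiL1 y)).
have evE : evidence muP Phi y = (\int[mu]_(x in A) likelihood Phi P y x)%:E.
  rewrite /evidence /muP (ge0_integral_pushforward mP)//.
  rewrite preimage_setT (integral_full mA muA); first by rewrite (integral_bfun mu mA blik).
    by apply/measurable_EFinP; case: blik.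
  by move=> x; rewrite lee_fin.
rewrite /gibbs_posterior evE /= /muP (ge0_integral_pushforward mP)//; last exact: measurable_funTS.
rewrite (push_measure mA muA (family_slice y fam) mP
  (posterior_density_bfun mu A Phi_gt0 L0 PhiL1 y mP)
  (fun x => posterior_density_ge0 mA muA Phi_gt0 Phi_le L0 PhiL1 y x mP) _ mB); last first.
  move=> k f fk k0.
  exact: (family_push mA muA r0 Phi_gt0 Phi_le L0 PhiL1 PhiL2 y aP fam fk k0).
have bpd := posterior_density_bfun mu A Phi_gt0 L0 PhiL1 y mP.
have pd0 x := posterior_density_ge0 mA muA Phi_gt0 Phi_le L0 PhiL1 y x mP.
rewrite [RHS](density_indic mA muA mPB bpd pd0).
rewrite [X in (_ * X)%E](density_indic mA muA mPB blik lik0).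
rewrite -EFinM; congr (_%:E).
rewrite -(Rint_scale mu mA); last by apply: bfunM => //; exact: bfun_indic.
by apply: eq_Rintegral => x _; rewrite /posterior_density mulrCA [X in \1_ _ _ * X]mulrC.
Qed.

(** It suffices to compare rectangles: there Bayes' rule gives an integral of posterior masses,
    which are the [mu]-masses of preimages under the slices of [S]. *)
Lemma family_transport_constraint : bayes_rule muP gamma F Phi ->
  transport_constraint (marginalY nu \x mu)%E nu S.
Proof.
move=> bayes; have [mP rP] := aP.
have [Q QE] := push_probability mu mP.
have [N NE] := push_probability [the probability _ _ of (Q \x gamma)%E] measurable_forward.
have [NY NYE] := push_probability N (@measurable_fst _ _ (borel Y) (borel U)).
have mtri : measurable_fun setT (triangular_map S : borel Y * borel U -> borel Y * borel U).
  by apply: measurable_fun_pair; [exact: measurable_fst|exact: family_measurable fam].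
have nuE : nu = N by rewrite NE /= QE.
have nuYE : marginalY nu = NY by rewrite NYE /marginalY nuE.
split=> //; rewrite nuYE nuE => B mB.
pose eta := [the probability _ _ of (NY \x mu)%E].
pose m1 := measure_function_pushforward__canonical__measure_function_Measure eta mtri.
apply: (@measure_unique _ R (borel Y * borel U)%type
  [set X `*` Z | X in measurable & Z in measurable] (fun=> setT) _ _ _ _ m1 N) => //.
- exact: measurable_prod_measurableType.
- move=> _ _ [X1 mX1 [Z1 mZ1 <-]] [X2 mX2 [Z2 mZ2 <-]].
  by rewrite -setXI; exists (X1 `&` X2); [exact: measurableI|exists (Z1 `&` Z2) => //; exact: measurableI].
- by move=> _; exists setT => //; exists setT => //; rewrite setXTT.
- by apply: bigcup_const; exists 0%N.
- move=> _ [X mX [Z mZ <-]].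
  have NX : N (X `*` Z) = nu (X `*` Z) by rewrite nuE.
  rewrite [RHS]NX [RHS](bayes X Z mX mZ) -/nu nuYE integral_mkcond /= /pushforward /product_measure1/=.
  apply: eq_integral => y _; rewrite patchE.
  case: ifPn => [/set_mem Xy|nXy].
    rewrite /= gibbs_posterior_family//; congr (mu _).
    apply/seteqP; split=> [x /xsectionP[]//|x Sx].
    by apply/xsectionP; split.
  rewrite (_ : xsection _ _ = set0) ?measure0//.
  by apply/seteqP; split=> // x /xsectionP[Xy _]; rewrite mem_set in nXy.
- move=> _; apply: (@le_lt_trans _ _ (eta setT)); first by rewrite /= /pushforward preimage_setT.
  by rewrite (le_lt_trans (probability_le1 eta measurableT))// ltry.
Qed.

(** The family satisfies the constraint and so competes with [T], which supplies the cost inequality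
    for [optimal_unique]. *)
Lemma conditional_OT_map_family T : bayes_rule muP gamma F Phi ->
  conditional_OT_map (marginalY nu \x mu)%E nu T ->
  exists B : set (borel Y), [/\ measurable B, marginalY nu (~` B) = 0%E &
    forall y, B y -> (\int[mu]_x (norm1 (T y x - S y x))%:E = 0)%E].
Proof.
move=> bayes [[mT pushT] minT].
have cS := family_transport_constraint bayes; have [mS pushS] := cS.
have := minT _ cS; move: mT pushT mS pushS.
have [mP rP] := aP.
have [Q QE] := push_probability mu mP.
have [N NE] := push_probability [the probability _ _ of (Q \x gamma)%E] measurable_forward.
have [NY NYE] := push_probability N (@measurable_fst _ _ (borel Y) (borel U)).
have nuE : nu = N by rewrite NE /= QE.
have nuYE : marginalY nu = NY by rewrite NYE /marginalY nuE.
rewrite nuYE nuE => mT pushT mS pushS cost.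
apply: (optimal_unique mA muA r0 Ar C0 HC L0 fam (nuY := NY) mT _ cost) => B mB.
by rewrite [LHS]pushT// [RHS]pushS.
Qed.

End ConditionalTransport.

(** * The rate 1/6 *)

Section Rates.
Context {R : realType} (d : nat).
Local Notation U := ('rV[R]_d).

(* The choice [t = e `^ 3^-1] balances the two terms. *)
Lemma rate_cubic_root (a e h M : R) : 0 <= a -> a <= M -> 0 <= e -> 0 <= h ->
  (forall t, 0 < t -> t <= 1 -> t * a <= h * (e + t ^+ 2)) ->
  a <= (2 * h + M) * e `^ 3^-1.
Proof.
move=> a0 aM e0 h0 H; have M0 := le_trans a0 aM.
(* If [1 <= e], the root is at least 1, the end of the range of [t], and the a priori bound [M] is
   used. For [e = 0] the parameter [t] tends to 0. *)
have [e1|e1] := leP 1 e.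
  have z1 : 1 <= e `^ 3^-1.
    by rewrite -[leLHS](powRr0 e); apply: ler_powR => //; rewrite invr_ge0.
  apply: (le_trans aM); rewrite -[leLHS]mulr1; apply: ler_pM => //.
  by rewrite lerDr mulr_ge0.
have [eE|en0] := eqVneq e 0.
  rewrite eE powR0 ?invr_eq0 ?pnatr_eq0// mulr0.
  apply: (@le_half_pow _ _ _ h) => n; rewrite add0r.
  rewrite -(ler_pM2l (half_pow_gt0 n)); apply: (le_trans (H _ (half_pow_gt0 n) (half_pow_le1 n))).
  by rewrite eE add0r le_eqVlt; apply/orP; left; apply/eqP; ring.
have ep : 0 < e by rewrite lt_def en0.
pose z := e `^ 3^-1.
have z0 : 0 < z by rewrite powR_gt0.
have ez : e = z ^+ 3.
  by rewrite -powR_mulrn ?ltW// /z -powRrM mulVf ?powRr1// pnatr_eq0.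
have z1 : z <= 1.
  by rewrite leNgt; apply/negP => z1; move: e1; rewrite ez ltNge exprn_ege1// ltW.
have := H z z0 z1; rewrite ez -/z => Hz.
have {Hz} : a <= h * (z ^+ 2 + z).
  by rewrite -(ler_pM2l z0); apply: (le_trans Hz); rewrite le_eqVlt; apply/orP; left; apply/eqP; ring.
have zz : z ^+ 2 <= z by rewrite expr2 ler_piMl// ltW.
have h1 := ler_wpM2l h0 zz.
have h2 : 0 <= M * z by rewrite mulr_ge0// ltW.
by rewrite -ez -/z => h3; lra.
Qed.

Lemma powR_sixth (c e : R) : 0 <= c -> 0 <= e ->
  (c * e `^ 3^-1) `^ 2^-1 = c `^ 2^-1 * e `^ 6^-1.
Proof.
move=> c0 e0; rewrite powRM ?powR_ge0// -powRrM; congr (_ * _ `^ _).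
by rewrite -invfM -natrM.
Qed.

Lemma ler_coord_enorm (u : U) i : `|u 0 i| <= enorm u.
Proof.
rewrite -(ler_pXn2r (ltn0Sn 1)) ?nnegrE ?enorm_ge0// enorm_sq real_normK ?num_real//.
rewrite /edot (bigD1 i)//= -expr2 lerDl.
by apply: sumr_ge0 => j _; rewrite -expr2 sqr_ge0.
Qed.

Lemma cube_enorm (s : R) (u : U) : enorm u <= s -> cube s u.
Proof. by move=> us i; rewrite -ler_norml; apply: le_trans us; exact: ler_coord_enorm. Qed.

(** The inequality of arithmetic and geometric means with a free scale [s]. Integrated with [s]
    close to an [L^2] norm it takes the place of Cauchy-Schwarz in [proj_dist_L2norm]. *)
Lemma ler_norm1_enorm (u : U) (s : R) : 0 < s ->
  norm1 u <= d%:R * ((s + enorm u ^+ 2 / s) / 2).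
Proof.
move=> s0; apply: (@le_trans _ _ (\sum_(i < d) (s + enorm u ^+ 2 / s) / 2)); last first.
  by rewrite sumr_const card_ord mulr_natl.
apply: ler_sum => i _; rewrite enorm_sq.
have ui : `|u 0 i| ^+ 2 <= edot u u.
  by rewrite -enorm_sq lerXn2r// ?nnegrE ?enorm_ge0// ler_coord_enorm.
have q : s * (edot u u / s) = edot u u by rewrite mulrC divfK ?gt_eqF.
rewrite ler_pdivlMr// -(ler_pM2l s0) [leRHS]mulrDr q.
have := sqr_ge0 (s - `|u 0 i|); rewrite sqrrB; move: ui; set b := `|u 0 i|.
by rewrite -mulr_natr !expr2; lra.
Qed.

(** By Pythagoras. The first bound gives measurability; the second keeps the image of [A] in the
    Euclidean ball containing [A], a property that cubes do not share. *)
Lemma orthogonal_projection_enorm (W : {vspace U}) (P : U -> U) :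
  orthogonal_projection W P ->
  (forall u v, enorm (P u - P v) <= enorm (u - v)) /\ (forall u, enorm (P u) <= enorm u).
Proof.
move=> oP.
have pyth (x w : U) : edot (x - w) w = 0 -> enorm w <= enorm x.
  rewrite edotBl => /eqP; rewrite subr_eq0 => /eqP xw.
  rewrite -(ler_pXn2r (ltn0Sn 1)) ?nnegrE ?enorm_ge0// !enorm_sq.
  have : 0 <= edot (x - w) (x - w) by rewrite -enorm_sq sqr_ge0.
  by rewrite edotBl !edotBr (edotC w x) xw; lra.
split=> [u v|u]; apply: pyth; last by have [Pu ->] := oP u.
have [Pu Hu] := oP u; have [Pv Hv] := oP v.
have PW : P u - P v \in W by exact: memvB.
have -> : u - v - (P u - P v) = (u - P u) - (v - P v).
  by apply/rowP => i; rewrite !mxE; ring.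
by rewrite edotBl Hu// Hv// subrr.
Qed.

Lemma orthogonal_projection_measurable (W : {vspace U}) (P : U -> U) :
  orthogonal_projection W P -> measurable_fun setT (P : borel U -> borel U).
Proof.
move=> /orthogonal_projection_enorm[Plip _]; apply: measurable_fun_rV => i.
apply: (@lipschitz1_measurable _ _ 1 (fun u => P u 0 i)) => u v; rewrite mul1r.
apply: le_trans (enorm_le_norm1 (u - v)); apply: le_trans (Plip u v).
by have := ler_coord_enorm (P u - P v) i; rewrite !mxE.
Qed.

Variables (mu : probability (borel U) R) (A : set (borel U)) (r : R).
Hypotheses (mA : measurable A) (muA : mu (~` A) = 0%E) (r0 : 0 < r).
Notation E f := (\int[mu]_(x in A) f x).

Lemma measurable_sq_dist (f g : borel U -> borel U) :
  measurable_fun setT f -> measurable_fun setT g ->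
  measurable_fun setT (fun x => enorm ((f x : U) - g x) ^+ 2).
Proof.
move=> mf mg; apply: (eq_measurable_fun (fun x => edot ((f x : U) - g x) ((f x : U) - g x))).
  by move=> x _; rewrite enorm_sq.
by apply: measurable_edot; exact: measurable_subU.
Qed.

Lemma sq_dist_le (u v : U) : cube r u -> cube r v ->
  enorm (u - v) ^+ 2 <= 2 * r * norm1 (u - v).
Proof.
move=> ru rv; rewrite enorm_sq /edot /norm1 mulr_sumr; apply: ler_sum => i _.
rewrite -expr2 -real_normK ?num_real// expr2; apply: ler_wpM2r => //.
rewrite !mxE; have /andP[? ?] := ru i; have /andP[? ?] := rv i.
by rewrite ler_norml; apply/andP; split; lra.
Qed.

Lemma sq_dist_bfun (f g : borel U -> borel U) :
  measurable_fun setT f -> measurable_fun setT g ->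
  (forall x, A x -> cube r (f x : U)) -> (forall x, A x -> cube r (g x : U)) ->
  bfun A (fun x => enorm ((f x : U) - g x) ^+ 2).
Proof.
move=> mf mg rf rg; split; first exact: measurable_sq_dist.
exists (2 * r * (d%:R * r + d%:R * r)) => x Ax; rewrite ger0_norm ?sqr_ge0//.
apply: (le_trans (sq_dist_le (rf _ Ax) (rg _ Ax))); apply: ler_wpM2l.
  by rewrite mulr_ge0// ltW.
apply: (le_trans (ler_norm1D _ _)); rewrite norm1N; apply: lerD; apply: ler_norm1_cube.
  exact: rf.
exact: rg.
Qed.

Lemma norm1_ae_eq (f g : borel U -> borel U) :
  measurable_fun setT f -> measurable_fun setT g ->
  (\int[mu]_x (norm1 ((f x : U) - g x))%:E = 0)%E -> {ae mu, forall x, f x = g x}.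
Proof.
move=> mf mg fg0.
have m : measurable_fun setT (fun x => (norm1 ((f x : U) - g x))%:E).
  by apply/measurable_EFinP; apply: (measurableT_comp (@measurable_norm1 R d)); exact: measurable_subU.
have h : (\int[mu]_(x in setT) `|(norm1 ((f x : U) - g x))%:E| = 0)%E.
  by rewrite -fg0; apply: eq_integral => x _; rewrite gee0_abs// lee_fin norm1_ge0.
have := (ae_eq_integral_abs mu measurableT m).1 h; apply: filterS => x /(_ Logic.I) [].
move=> /eqP; rewrite psumr_eq0// => /allP z; apply/rowP => i.
by have := z i (mem_index_enum i); rewrite /= !mxE normr_eq0 subr_eq0 => /eqP.
Qed.

Lemma L2norm_le (T0 T1 S0 S1 : borel U -> borel U) a :
  measurable_fun setT T0 -> measurable_fun setT T1 ->
  measurable_fun setT S0 -> measurable_fun setT S1 ->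
  (forall x, A x -> cube r (S0 x : U)) -> (forall x, A x -> cube r (S1 x : U)) ->
  (\int[mu]_x (norm1 ((T0 x : U) - S0 x))%:E = 0)%E ->
  (\int[mu]_x (norm1 ((T1 x : U) - S1 x))%:E = 0)%E ->
  E (fun x => norm1 ((S0 x : U) - S1 x)) <= a ->
  (L2norm mu (fun u => (T0 u : U) - T1 u)%R <= ((2 * r * a) `^ 2^-1)%R%:E)%E.
Proof.
move=> mT0 mT1 mS0 mS1 rS0 rS1 TS0 TS1 Sa.
have bd := bfun_dist mS0 mS1 rS0 rS1; have bs := sq_dist_bfun mS0 mS1 rS0 rS1.
have eE : (\int[mu]_u (enorm ((T0 u : U) - T1 u) ^+ 2)%:E =
    (E (fun x => enorm ((S0 x : U) - S1 x) ^+ 2))%:E)%E.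
  rewrite -(integral_bfun mu mA bs) -(integral_full mA muA); last 2 first.
  - by apply/measurable_EFinP; case: bs.
  - by move=> x; rewrite lee_fin sqr_ge0.
  apply: ge0_ae_eq_integral => //.
  - by apply/measurable_EFinP; exact: measurable_sq_dist.
  - by apply/measurable_EFinP; exact: measurable_sq_dist.
  - by move=> x _; rewrite lee_fin sqr_ge0.
  - by move=> x _; rewrite lee_fin sqr_ge0.
  have := norm1_ae_eq mT1 mS1 TS1; have := norm1_ae_eq mT0 mS0 TS0.
  by apply: filterS2 => x -> -> _.
rewrite /L2norm eE poweR_EFin lee_fin; apply: ge0_ler_powR.
- by rewrite invr_ge0.
- by rewrite nnegrE; apply: Rintegral_ge0 => x _; exact: sqr_ge0.
- rewrite nnegrE !mulr_ge0 ?(ltW r0)//; apply: (le_trans _ Sa).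
  by apply: Rintegral_ge0 => x _; exact: norm1_ge0.
apply: (@le_trans _ _ (2 * r * E (fun x => norm1 ((S0 x : U) - S1 x)))); last first.
  by apply: ler_wpM2l => //; rewrite mulr_ge0// ltW.
rewrite -(Rint_scale mu mA _ bd); apply: (@Rint_le _ _ _ mu A mA) => //.
  by apply: bfunM => //; exact: bfun_cst.
by move=> x Ax; apply: sq_dist_le; [exact: rS0|exact: rS1].
Qed.

Lemma proj_dist_L2norm (P : U -> U) :
  admissible A r P -> (forall x, A x -> cube r (x : U)) ->
  exists e : R, [/\ 0 <= e, L2norm mu (fun u => u - P u) = e%:E &
    proj_dist mu A P id <= d%:R * e].
Proof.
move=> [mP rP] rA.
have mid : measurable_fun setT (id : borel U -> borel U) by exact: measurable_id.
have bs := sq_dist_bfun mid mP rA rP; have bd := bfun_dist mP mid rP rA.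
pose q := E (fun x => enorm (x - P x) ^+ 2).
have q0 : 0 <= q by apply: Rintegral_ge0 => x _; exact: sqr_ge0.
exists (Num.sqrt q); split; first exact: sqrtr_ge0.
  rewrite /L2norm (integral_full mA muA); last 2 first.
  - by apply/measurable_EFinP; case: bs.
  - by move=> x; rewrite lee_fin sqr_ge0.
  by rewrite (integral_bfun mu mA bs) poweR_EFin powR12_sqrt.
(* The scale is [s = sqrt q + 2^-n]; the added term keeps it positive when [q = 0] and disappears in
   the limit. *)
apply: (@le_half_pow _ _ _ d%:R) => n; rewrite -mulrDr.
set s := _ + _; have s0 : 0 < s by rewrite ltr_wpDl ?sqrtr_ge0// half_pow_gt0.
have qs : q <= s ^+ 2.
  rewrite -[leLHS]sqr_sqrtr//; apply: lerXn2r; rewrite ?nnegrE ?sqrtr_ge0 ?(ltW s0)//.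
  by rewrite lerDl ltW// half_pow_gt0.
have bq : bfun A (fun x : borel U => d%:R * (2^-1 * (s + s^-1 * enorm (x - P x) ^+ 2))).
  apply: bfunM; first exact: bfun_cst.
  apply: bfunM; first exact: bfun_cst.
  by apply: bfunD; [exact: bfun_cst|apply: bfunM => //; exact: bfun_cst].
apply: (@le_trans _ _ (E (fun x => d%:R * (2^-1 * (s + s^-1 * enorm (x - P x) ^+ 2))))).
  apply: (@Rint_le _ _ _ mu A mA) => // x _.
  by rewrite norm1B [s^-1 * _]mulrC [2^-1 * _]mulrC; exact: ler_norm1_enorm.
have b1 : bfun A (fun x : borel U => s^-1 * enorm (x - P x) ^+ 2) by apply: bfunM => //; exact: bfun_cst.
have b2 : bfun A (fun x : borel U => s + s^-1 * enorm (x - P x) ^+ 2) by apply: bfunD => //; exact: bfun_cst.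
have b3 : bfun A (fun x : borel U => 2^-1 * (s + s^-1 * enorm (x - P x) ^+ 2)) by apply: bfunM => //; exact: bfun_cst.
rewrite (Rint_scale mu mA _ b3); apply: ler_wpM2l => //.
rewrite (Rint_scale mu mA _ b2) (Rint_add mu mA (bfun_cst _ s) b1) (Rint_scale mu mA _ bs).
rewrite (Rint_cst mA muA) -/q.
have : s^-1 * q <= s.
  rewrite -(ler_pM2l s0) mulrA divff ?gt_eqF// mul1r -expr2; exact: qs.
lra.
Qed.

End Rates.

(** * Null sets of the data law under a change of prior *)

Section NullTransfer.
Context {R : realType} (d : nat) (Y : completeNormedModType R).
Local Notation U := ('rV[R]_d).
Variables (Phi : U -> Y -> R) (K L : R).
Hypotheses (Phi_gt0 : forall u y, 0 < Phi u y) (Phi_le : forall u y, Phi u y <= K)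
  (PhiL2 : forall u y y', `|Phi u y - Phi u y'| <= L * `|y - y'|).
Variables (D : set Y) (cD : countable D) (dD : dense D).
Variables (gamma : probability (borel Y) R) (F : U * Y -> Y) (cF : continuous F).
Hypothesis nll : negative_log_likelihood gamma F Phi.

Lemma measurable_potential u : measurable_fun setT (Phi u : borel Y -> R).
Proof.
apply: continuous_borelR => y; apply/cvgrPdist_lt => e e0.
pose k := `|L| + 1; have k0 : 0 < k by rewrite ltr_wpDl.
near=> z; apply: (le_lt_trans (PhiL2 u y z)).
apply: (@le_lt_trans _ _ (k * `|y - z|)).
  by apply: ler_wpM2r => //; rewrite (le_trans (ler_norm L))// lerDl.
rewrite mulrC -ltr_pdivlMr//; near: z; apply: cvgr_dist_lt; first exact: cvg_id.
by rewrite divr_gt0.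
Unshelve. all: by end_near. Qed.

Lemma marginal_joint_law (m : set (borel U) -> \bar R) (B : set (borel Y)) :
  marginalY (joint_law m gamma F) B =
  (\int[m]_u pushforward gamma (fun xi : borel Y => F (u, xi) : borel Y) B)%E.
Proof.
rewrite /marginalY /joint_law /pushforward /product_measure1.
congr (integral _ _ _); apply/funext => u /=; congr (gamma _).
by apply/seteqP; split=> [x /xsectionP|x Bx]; last exact/xsectionP.
Qed.

(** The values [expR (- Phi u y)] lie between [expR (- K)] and 1, and the factor [c y] is common to
    all [u]. *)
Lemma likelihood_comparison (B : set (borel Y)) u u' : measurable B ->
  (pushforward gamma (fun xi : borel Y => F (u, xi) : borel Y) B <=
   (expR K)%:E * pushforward gamma (fun xi : borel Y => F (u', xi) : borel Y) B)%E.
Proof.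
move=> mB; have [c [mc c0 cE]] := nll; rewrite !cE//.
have mlik v : measurable_fun setT (fun y : borel Y => (c y * expR (- Phi v y))%:E).
  apply/measurable_EFinP; apply: measurable_funM => //; apply: measurableT_comp => //.
  by apply: measurable_funN; exact: measurable_potential.
have lik0 v (y : borel Y) : (0 <= (c y * expR (- Phi v y))%:E)%E.
  by rewrite lee_fin mulr_ge0// expR_ge0.
rewrite -ge0_integralZl_EFin ?expR_ge0//; last exact: measurable_funTS.
apply: ge0_le_integral => //.
- exact: measurable_funTS.
- by apply: measurable_funeM; exact: measurable_funTS.
- move=> y _; rewrite -EFinM lee_fin mulrCA; apply: ler_wpM2l => //.
  by rewrite -expRD ler_expR; have := Phi_gt0 u y; have := Phi_le u' y; lra.
Qed.

(* The densities [c y * expR (- Phi u y)] for different [u] are mutually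
   bounded, so the null sets of the data law do not depend on the prior. *)
Lemma marginal_null_transfer (m0 m1 : probability (borel U) R) (B : set (borel Y)) :
  measurable B -> marginalY (joint_law m0 gamma F) B = 0%E ->
  marginalY (joint_law m1 gamma F) B = 0%E.
Proof.
move=> mB; rewrite !marginal_joint_law => z.
set lam := fun u => pushforward gamma (fun xi : borel Y => F (u, xi) : borel Y) B.
have lam0 u : (0 <= lam u)%E by rewrite /lam /pushforward; exact: measure_ge0.
have mlam : measurable_fun setT (lam : borel U -> \bar R).
  have mFB : measurable ([set p : borel U * borel Y | B (F p)]).
    have := measurableT_comp (@measurable_fst _ _ (borel Y) (borel U)) (@measurable_forward R d Y D cD dD F cF).
    by rewrite -[X in measurable X]setTI; exact.
  apply: (eq_measurable_fun _ _ (measurable_fun_xsection gamma mFB)) => u _ /=.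
  by congr (gamma _); apply/seteqP; split=> [x /xsectionP|x Bx]; last exact/xsectionP.
(* Averaging the comparison of [u] with [u'] over [u'] under [m0] bounds [lam u] by a multiple of
   the null mass, for every [u] and not just almost every one. *)
have lamz u : lam u = 0%E.
  apply/eqP; rewrite eq_le lam0 andbT.
  have <- : (\int[m0]_u' lam u = lam u)%E.
    by rewrite integral_cst// [X in (_ * X)%E]probability_setT mule1.
  have <- : ((expR K)%:E * \int[m0]_u' lam u' = 0)%E by rewrite z mule0.
  rewrite -ge0_integralZl_EFin ?expR_ge0//; apply: ge0_le_integral => //.
  - exact: measurable_funeM.
  - by move=> v _; exact: likelihood_comparison.
by apply: integral0_eq => u _; exact: lamz.
Qed.

End NullTransfer.

Section Compact.
Context {R : realType} (d : nat).
Local Notation U := ('rV[R]_d).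

Lemma compact_measurable_rV (A : set U) : compact A -> measurable (A : set (borel U)).
Proof.
move=> cA; have cl : closed A.
  apply: compact_closed => //; exact: norm_hausdorff.
rewrite -[X in measurable X]setCK; apply: measurableC.
by apply: sub_sigma_algebra; exact: closed_openC.
Qed.

Lemma compact_norm1_bounded (A : set U) : compact A ->
  exists2 r : R, 0 < r & forall u, A u -> norm1 u <= r.
Proof.
move=> cA; have cn : continuous (@norm1 R d).
  apply: (@lipschitz1_continuous _ _ 1) => u v; rewrite mul1r ler_distl.
  have := ler_norm1D (u - v) v; have := ler_norm1D (v - u) u.
  by rewrite !subrK [norm1 (v - u)]norm1B; lra.
have [M [_ HM]] := compact_bounded (continuous_compact (continuous_subspaceT cn) cA).
exists (`|M| + 1); first by rewrite ltr_wpDl.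
move=> u Au; apply: le_trans (ler_norm _) _; apply: HM; last by exists u.
by rewrite (le_lt_trans (ler_norm M))// ltrDl.
Qed.

End Compact.

(** * The common Hölder estimate *)

Section Hoelder.
Context {R : realType} (d : nat) (Y : completeNormedModType R).
Local Notation U := ('rV[R]_d).
Variables (mu : probability (borel U) R) (A : set (borel U)) (r C : R).
Hypotheses (mA : measurable A) (muA : mu (~` A) = 0%E) (r0 : 0 < r)
  (Ar : A `<=` @cube R d r) (C0 : 0 <= C) (HC : second_difference_bound mu A C).
Variables (Phi : U -> Y -> R) (K L : R).
Hypotheses (Phi_gt0 : forall u y, 0 < Phi u y) (Phi_le : forall u y, Phi u y <= K)
  (L0 : 0 <= L) (PhiL1 : forall u u' y, `|Phi u y - Phi u' y| <= L * enorm (u - u'))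
  (PhiL2 : forall u y y', `|Phi u y - Phi u y'| <= L * `|y - y'|).

Lemma triangular_slice (T : Y -> U -> U) y :
  measurable_fun setT (triangular_map T : borel Y * borel U -> borel Y * borel U) ->
  measurable_fun setT (T y : borel U -> borel U).
Proof.
move=> mT; have := measurableT_comp (@measurable_snd _ _ (borel Y) (borel U)) mT.
by move=> m; have := measurableT_comp m (@measurable_pair1 _ _ (borel Y) (borel U) y).
Qed.

(* The norm of the difference squared is at most [2 r] times its l1 norm, which
   [rate_cubic_root] bounds by a multiple of [e `^ 3^-1]. *)
Definition hoelder_constant : R :=
  (2 * r * (2 * (stability_constant d r C K L * (d%:R + 1)) + (d%:R * r + d%:R * r))) `^ 2^-1.

(** One estimate for both claims: [e] is either the [L^2] distance of the projection to the
    identity, which bounds [proj_dist] up to the factor [d], or the distance of the data. *)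
Lemma family_hoelder P P' S S' Sn Sn' phin phin' psin psin' (T T' : Y -> U -> U) y y' e :
  admissible A r P -> admissible A r P' ->
  optimal_family mu A r C Phi K L P S Sn phin psin ->
  optimal_family mu A r C Phi K L P' S' Sn' phin' psin' ->
  measurable_fun setT (T y : borel U -> borel U) ->
  measurable_fun setT (T' y' : borel U -> borel U) ->
  (\int[mu]_x (norm1 (T y x - S y x))%:E = 0)%E ->
  (\int[mu]_x (norm1 (T' y' x - S' y' x))%:E = 0)%E ->
  0 <= e -> proj_dist mu A P P' + `|y - y'| <= (d%:R + 1) * e ->
  (L2norm mu (fun u => T y u - T' y' u)%R <= (hoelder_constant * e `^ 6^-1)%R%:E)%E.
Proof.
move=> aP aP' fam fam' mT mT' TS TS' e0 He.
set H := stability_constant d r C K L.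
have H0 : 0 <= H by exact: stability_constant_ge0.
have mS := family_slice y fam; have mS' := family_slice y' fam'.
have rS x : A x -> cube r (S y x) by move=> _; exact: family_cube fam y x.
have rS' x : A x -> cube r (S' y' x) by move=> _; exact: family_cube fam' y' x.
have bd := bfun_dist mS mS' rS rS'.
have d1 : 1 <= d%:R + 1 :> R by rewrite lerDr.
have Hd : 0 <= H * (d%:R + 1) by rewrite mulr_ge0// addr_ge0.
have aM : \int[mu]_(x in A) norm1 (S y x - S' y' x) <= d%:R * r + d%:R * r.
  rewrite -[leRHS](Rint_cst mA muA); apply: (@Rint_le _ _ _ mu A mA) => //.
    exact: bfun_cst.
  move=> x Ax; apply: (le_trans (ler_norm1D _ _)); rewrite norm1N.
  by apply: lerD; apply: ler_norm1_cube; [exact: rS|exact: rS'].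
have rate : \int[mu]_(x in A) norm1 (S y x - S' y' x) <=
    (2 * (H * (d%:R + 1)) + (d%:R * r + d%:R * r)) * e `^ 3^-1.
  apply: rate_cubic_root => //.
    by apply: Rintegral_ge0 => x _; exact: norm1_ge0.
  move=> t t0 t1.
  apply: le_trans (family_stability mA muA r0 Ar C0 HC Phi_gt0 Phi_le L0 PhiL1 PhiL2
    y y' aP aP' fam fam' t0 t1) _.
  rewrite -/H -mulrA; apply: ler_wpM2l => //; rewrite mulrDr; apply: lerD => //.
  by apply: ler_peMl => //; exact: sqr_ge0.
apply: (le_trans (L2norm_le mA muA r0 mT mT' mS mS' rS rS' TS TS' rate)).
rewrite lee_fin mulrA powR_sixth//.
by apply: mulr_ge0; [|apply: addr_ge0; [|apply: addr_ge0]]; rewrite mulr_ge0// ltW.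
Qed.

Lemma hoelder_constant_ge0 : 0 <= hoelder_constant.
Proof. exact: powR_ge0. Qed.

End Hoelder.

Local Open Scope ereal_scope.

Theorem proposition4p3 (R : realType) (d : nat)
    (* the separable Hilbert space Y *)
    (Y : completeNormedModType R) (ip : {dot Y for idfun})
    (norm_ip : forall y : Y, (`|y| ^+ 2)%R = ip y y)
    (separable_Y : exists D : set Y, countable D /\ dense D)
    (* (a) *)
    (A : set 'rV[R]_d) (compact_A : compact A) (convex_A : convex_set A)
    (mu : probability (borel 'rV[R]_d) R)
    (supp_mu : mu (~` A) = 0)
    (rho : borel 'rV[R]_d -> R) (measurable_rho : measurable_fun setT rho)
    (rho_ge0 : forall u, (0 <= rho u)%R)
    (density_mu : forall B : set (borel 'rV[R]_d), measurable B ->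
       mu B = \int[lebesgue_rV (n := d)]_(u in B) (rho u)%:E)
    (rho_bounds : exists m M : R, (0 < m)%R /\
       forall u, A u -> (m <= rho u <= M)%R)
    (* (b) *)
    (Phi : 'rV[R]_d -> Y -> R)
    (Phi_gt0 : forall u y, (0 < Phi u y)%R)
    (Phi_bounded : exists K : R, forall u y, (Phi u y <= K)%R)
    (Phi_bilipschitz : exists L : R,
       (forall u u' y, `|Phi u y - Phi u' y| <= L * enorm (u - u'))%R /\
       (forall u y y', `|Phi u y - Phi u y'| <= L * `|y - y'|)%R) :
  exists C1 C2 : R, [/\ (0 <= C1)%R, (0 <= C2)%R &
    forall (gamma : probability (borel Y) R) (F : 'rV[R]_d * Y -> Y),
    continuous F ->
    negative_log_likelihood gamma F Phi ->
    bayes_rule mu gamma F Phi ->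
    let nu := joint_law mu gamma F in
    forall Tstar : Y -> 'rV[R]_d -> 'rV[R]_d,
    conditional_OT_map (marginalY nu \x mu) nu Tstar ->
    (forall (N : nat) (UN : {vspace 'rV[R]_d}) (PN : 'rV[R]_d -> 'rV[R]_d),
       (N <= d)%N -> \dim UN = N -> orthogonal_projection UN PN ->
       let muN := pushforward mu (PN : borel 'rV[R]_d -> borel 'rV[R]_d) in
       let nuN := joint_law muN gamma F in
       bayes_rule muN gamma F Phi ->
       forall TN : Y -> 'rV[R]_d -> 'rV[R]_d,
       conditional_OT_map (marginalY nuN \x mu) nuN TN ->
       {ae marginalY nu, forall y,
         L2norm mu (fun u => TN y u - Tstar y u)%R <=
         C1%:E * L2norm mu (fun u => u - PN u)%R `^ 6^-1}) /\
    (exists E : set (borel Y), [/\ measurable E, marginalY nu (~` E) = 0 &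
       forall y y', E y -> E y' ->
         L2norm mu (fun u => Tstar y u - Tstar y' u)%R <=
         C2%:E * (`|(y : Y) - (y' : Y)|%R `^ 6^-1)%:E])].
Proof.
have mA : measurable (A : set (borel 'rV[R]_d)) by exact: compact_measurable_rV.
(* The l1 bound implies a Euclidean one, which orthogonal projections preserve, so the same [r]
   serves every [PN]. *)
have [r r0 rA] := compact_norm1_bounded compact_A.
have enormA u : A u -> (enorm u <= r)%R.
  by move=> Au; apply: le_trans (rA _ Au); exact: enorm_le_norm1.
have Ar : A `<=` @cube R d r by move=> u /enormA/cube_enorm.
have [m [M [_ mM]]] := rho_bounds.
have rM (u : borel 'rV[R]_d) : A u -> (rho u <= M)%R by move=> /mM/andP[].
have [C C0 HC] := bounded_density_second_difference r0 mA Ar measurable_rho rho_ge0 density_mu rM.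
have [K Phi_le] := Phi_bounded; have [L' [PhiL1' PhiL2']] := Phi_bilipschitz.
(* The sign of [L'] is not given, whereas the estimates multiply by a nonnegative constant. *)
pose L := `|L'|%R; have L0 : (0 <= L)%R by exact: normr_ge0.
have PhiL1 u u' y : (`|Phi u y - Phi u' y| <= L * enorm (u - u'))%R.
  by apply: (le_trans (PhiL1' u u' y)); apply: ler_wpM2r; rewrite ?enorm_ge0// ler_norm.
have PhiL2 u y y' : (`|Phi u y - Phi u y'| <= L * `|y - y'|)%R.
  by apply: (le_trans (PhiL2' u y y')); apply: ler_wpM2r; rewrite // ler_norm.
have [D [cD dD]] := separable_Y.
have aI : admissible A r (id : 'rV[R]_d -> 'rV[R]_d).
  by split; [exact: measurable_id|exact: Ar].
(* The undiscretised problem is the case of the identity. This family is fixed before [gamma] and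
   [F] are introduced, and [c] depends on neither. *)
have [S [Sn [phin [psin fam]]]] :=
  optimal_family_exists mA supp_mu r0 Ar C0 HC Phi_gt0 Phi_le L0 PhiL1 PhiL2 cD dD aI.
pose c := hoelder_constant d r C K L.
exists c, c; split; [exact: hoelder_constant_ge0|exact: hoelder_constant_ge0|].
move=> gamma F cF nll bayes nu Tstar optT.
have [B0 [mB0 nB0 TS0]] := conditional_OT_map_family mA supp_mu r0 Ar C0 HC Phi_gt0 Phi_le
  L0 PhiL1 PhiL2 cD dD cF aI fam bayes optT.
have mT0 y : measurable_fun setT (Tstar y : borel 'rV[R]_d -> borel 'rV[R]_d).
  by apply: triangular_slice; have [[]] := optT.
split.
- move=> N UN PN _ _ oP muN nuN bayesN TN optTN.
  have [_ leP] := orthogonal_projection_enorm oP.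
  have aP : admissible A r PN.
    split; first exact: orthogonal_projection_measurable oP.
    by move=> x /enormA xr; apply: cube_enorm; apply: le_trans xr; exact: leP.
  have [S' [Sn' [phin' [psin' fam']]]] :=
    optimal_family_exists mA supp_mu r0 Ar C0 HC Phi_gt0 Phi_le L0 PhiL1 PhiL2 cD dD aP.
  have [B1 [mB1 nB1 TS1]] := conditional_OT_map_family mA supp_mu r0 Ar C0 HC Phi_gt0 Phi_le
    L0 PhiL1 PhiL2 cD dD cF aP fam' bayesN optTN.
  have mT1 y : measurable_fun setT (TN y : borel 'rV[R]_d -> borel 'rV[R]_d).
    by apply: triangular_slice; have [[]] := optTN.
  have [Q QE] := push_probability mu (orthogonal_projection_measurable oP).
  (* [TN] is identified only outside a null set of the discretised data law, while the claim is for
     [marginalY nu]; the null set is transferred from the prior [Q], the law of [PN], to [mu]. *)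
  have nB1' : marginalY nu (~` B1) = 0.
    apply: (marginal_null_transfer Phi_gt0 Phi_le PhiL2 cD dD cF nll (m0 := Q)).
      exact: measurableC.
    by rewrite QE.
  have [e [e0 eE eP]] := proj_dist_L2norm mA supp_mu r0 aP Ar.
  have [N1 NE] := push_probability [the probability _ _ of (mu \x gamma)] (measurable_forward cD dD cF).
  have [NY NYE] := push_probability N1 (@measurable_fst _ _ (borel Y) (borel 'rV[R]_d)).
  have nuYE : marginalY nu = NY by rewrite NYE NE.
  exists (~` (B0 `&` B1)); split.
  + by apply: measurableC; exact: measurableI.
  + move: nB0 nB1'; rewrite nuYE setCI => nB0 nB1'.
    apply/eqP; rewrite eq_le [X in _ && X]measure_ge0 andbT.
    have := measureU2 NY (measurableC mB0) (measurableC mB1).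
    by rewrite [X in X + _]nB0 [X in _ + X]nB1' adde0.
  + move=> y /= nL [B0y B1y]; apply: nL.
    rewrite eE poweR_EFin -EFinM.
    apply: (family_hoelder mA supp_mu r0 Ar C0 HC Phi_gt0 Phi_le L0 PhiL1 PhiL2
      aP aI fam' fam) => //; [exact: TS1|exact: TS0|].
    rewrite subrr normr0 addr0; apply: (le_trans eP); apply: ler_wpM2r => //.
    by rewrite lerDl.
- exists B0; split=> // y y' B0y B0y'.
  rewrite -EFinM.
  apply: (family_hoelder mA supp_mu r0 Ar C0 HC Phi_gt0 Phi_le L0 PhiL1 PhiL2
    aI aI fam fam) => //; [exact: TS0|exact: TS0|].
  rewrite [X in (X + _ <= _)%R](_ : _ = 0%R) ?add0r.
    by rewrite ler_peMl// lerDr.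
  rewrite /proj_dist -[RHS](Rint_cst mA supp_mu 0%R).
  apply: eq_Rintegral => x _; rewrite subrr /norm1 big1// => i _.
  by rewrite mxE normr0.
Qed.
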